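(* Let $S=\Bbbk[x_1,\ldots,x_n]$ and $S'=\Bbbk[x'_1,\ldots,x'_{n'}]$ be polynomial rings over a field $\Bbbk$, and $I\subseteq S$, $I'\subseteq S'$ ideals generated by monomials of degree at least $2$; set $R=S/I$, $R'=S'/I'$. Let $\lambda:L_I\to L_{I'}$ be an isomorphism of lattices that induces an isomorphism of GCD graphs $G_I\to G_{I'}$. If $Q_R(y,t)=1+\sum_{i\ge1}\big(\sum_{\mathbf j}c_{i,\mathbf j}y^{\mathbf j}\big)t^i$, then $$Q_{R'}(y',t)=1+\sum_{i\ge1}\Big(\sum_{\mathbf j}c_{i,\mathbf j}\,(y')^{\lambda(\mathbf j)}\Big)t^i.$$ (Here every $y^{\mathbf j}$ with $c_{i,\mathbf j}\ne0$ lies in $L_I$, so $\lambda(\mathbf j)$ is defined.)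
   Context: $S$, $S'$ are $\mathbb Z^n$-, $\mathbb Z^{n'}$-graded with $\deg x_i=e_i$; monomials $x^{\mathbf j}$ are identified with $y^{\mathbf j}=y_1^{j_1}\cdots y_n^{j_n}$ (and similarly $x'$ with $y'$), and multidegrees with monomials. The multigraded Poincaré series is $P_R(y,t)=\sum_{i,\mathbf j}\dim_\Bbbk\mathrm{Tor}_i^R(\Bbbk,\Bbbk)_{\mathbf j}y^{\mathbf j}t^i=\prod_{i=1}^n(1+ty_i)/Q_R(y,t)$ with $Q_R\in\mathbb Z[y_1,\ldots,y_n][t]$ having constant term 1 (and similarly $Q_{R'}(y',t)$). The LCM lattice $L_I$ is the set of least common multiples of subsets of the minimal monomial generating set of $I$ (including $1$), ordered by divisibility. The GCD graph $G_I$ has vertex set $L_I$, with an edge between $a,b$ iff $\gcd(a,b)=1$; $\lambda$ induces a GCD graph isomorphism if for all $a,b\in L_I$, $\gcd(a,b)=1\iff\gcd(\lambda(a),\lambda(b))=1$. *)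

(* Defs.v *)
From HB Require Import structures.
From mathcomp Require Import all_boot all_order all_algebra.
Set Implicit Arguments. Unset Strict Implicit. Unset Printing Implicit Defensive.
Import Order.TTheory GRing.Theory Num.Theory.

(* Monomials of S = k[x_1..x_n] are identified with their exponent vectors
   (= multidegrees, since deg x_i = e_i). *)
Definition mon (n : nat) := {ffun 'I_n -> nat}.

Section Monomials.
Variable n : nat.

Definition mzero : mon n := [ffun _ => 0%N].
Definition mplus (a b : mon n) : mon n := [ffun k => (a k + b k)%N].
Definition msub (a b : mon n) : mon n := [ffun k => (a k - b k)%N].
Definition mlcm (a b : mon n) : mon n := [ffun k => maxn (a k) (b k)].
Definition mdeg (a : mon n) : nat := (\sum_(k < n) a k)%N.
Definition mdiv (a b : mon n) : bool := [forall k, a k <= b k].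
Definition mcoprime (a b : mon n) : bool := [forall k, (a k == 0%N) || (b k == 0%N)].

Definition mons_le (j : mon n) : seq (mon n) :=
  [seq m <- [seq [ffun k => nat_of_ord (f k)] | f : {ffun 'I_n -> 'I_(mdeg j).+1}]
     | mdiv m j].

Definition inI (G : seq (mon n)) (m : mon n) : bool := has (fun g => mdiv g m) G.

Definition mingens (G : seq (mon n)) : seq (mon n) :=
  undup [seq g <- G | ~~ has (fun h => mdiv h g && (h != g)) G].

Definition lcm_lattice (G : seq (mon n)) : seq (mon n) :=
  undup [seq \big[mlcm/mzero]_(g <- mask (val t) (mingens G)) g
        | t : (size (mingens G)).-tuple bool].

(* Normalized bar complex of R = S/I (over k) computing Tor^R(k,k).
   Basis of \bar R^{(x) i} in multidegree j: sequences (m_1,...,m_i) of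
   nonconstant monomials not in I with m_1 ... m_i = x^j. *)
Fixpoint bar_basis (G : seq (mon n)) (i : nat) (j : mon n) : seq (seq (mon n)) :=
  match i with
  | 0 => if j == mzero then [:: [::]] else [::]
  | i'.+1 =>
      flatten [seq [seq m :: s | s <- bar_basis G i' (msub j m)]
              | m <- [seq m <- mons_le j | (m != mzero) && ~~ inI G m]]
  end.

Definition bar_face (k : nat) (s : seq (mon n)) : seq (mon n) :=
  take k s ++ mplus (nth mzero s k) (nth mzero s k.+1) :: drop k.+2 s.

(* matrix of d : B_{i+1} -> B_i in multidegree j,
   d(a_1|...|a_{i+1}) = sum_{k=1}^{i} (-1)^k (a_1|..|a_k a_{k+1}|..|a_{i+1}),
   where a_k a_{k+1} = 0 in R if it lies in I *)
Definition bar_mx (K : fieldType) (G : seq (mon n)) (i : nat) (j : mon n) :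
  'M[K]_(size (bar_basis G i.+1 j), size (bar_basis G i j)) :=
  \matrix_(a, b)
    (\sum_(k < i)
       ((-1) ^+ k.+1) *+
       ((bar_face k (nth [::] (bar_basis G i.+1 j) a) == nth [::] (bar_basis G i j) b)
        && ~~ inI G (mplus (nth mzero (nth [::] (bar_basis G i.+1 j) a) k)
                           (nth mzero (nth [::] (bar_basis G i.+1 j) a) k.+1))))%R.

Definition bar_rank (K : fieldType) (G : seq (mon n)) (i : nat) (j : mon n) : nat :=
  match i with 0 => 0%N | i'.+1 => \rank (bar_mx K G i' j) end.

(* dim_k Tor_i^R(k,k)_j = dim ker d_i - dim im d_{i+1} *)
Definition tor_dim (K : fieldType) (G : seq (mon n)) (i : nat) (j : mon n) : nat :=
  (size (bar_basis G i j) - bar_rank K G i j - bar_rank K G i.+1 j)%N.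

(* coefficient of y^j t^i in prod_{k}(1 + t y_k) *)
Definition ecoef (i : nat) (j : mon n) : int :=
  if [forall k, j k <= 1] && (mdeg j == i) then 1%R else 0%R.

(* Coefficients of Q_R = prod_k (1 + t y_k) / P_R as a formal power series,
   i.e. the unique series with P_R * Q_R = prod_k (1 + t y_k).
   Qcoefs G i = [q_0; ...; q_i], q_l j = coefficient of y^j t^l. *)
Fixpoint Qcoefs (K : fieldType) (G : seq (mon n)) (i : nat) : seq (mon n -> int) :=
  match i with
  | 0 => [:: fun j => ecoef 0 j]
  | i'.+1 =>
      let L := Qcoefs K G i' in
      rcons L (fun j => (ecoef i'.+1 j -
         \sum_(k < i'.+1) \sum_(a <- mons_le j)
            (tor_dim K G (i'.+1 - k) a)%:Z * nth (fun _ => 0%R) L k (msub j a))%R)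
  end.

Definition Qcoef (K : fieldType) (G : seq (mon n)) (i : nat) (j : mon n) : int :=
  nth (fun _ => 0%R) (Qcoefs K G i) i j.

End Monomials.

Definition lattice_iso n n' (G : seq (mon n)) (G' : seq (mon n')) (lam : mon n -> mon n') :=
  [/\ {in lcm_lattice G, forall a, lam a \in lcm_lattice G'},
      {in lcm_lattice G &, injective lam},
      {in lcm_lattice G', forall b, exists2 a, a \in lcm_lattice G & lam a = b} &
      {in lcm_lattice G &, forall a b, mdiv a b = mdiv (lam a) (lam b)}].

Definition gcd_graph_iso n n' (G : seq (mon n)) (lam : mon n -> mon n') :=
  {in lcm_lattice G &, forall a b, mcoprime a b = mcoprime (lam a) (lam b)}.

(* Main.v *)
(* Let m_1, ..., m_N generate I, let m_S be the lcm of the m_i with i in S, and let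
   c(S) = deg m_S - rk S be the number of connected components of S in the graph joining
   non-coprime generators.  The pairs (u, S) with m_S | u are a basis of the Taylor
   DG algebra, which resolves R, so Tor^R(k, k) is the homology of its bar complex, whose
   words have such pairs as letters.  Give a letter the weight |u| - rk S and a word w the
   level dlt w = sum of (weight - 1).  The differential never lowers the level, and keeps it
   only when it deletes from S a generator i that is tight, i.e. rk (S - i) = rk S; then also
   m_(S - i) = m_S.  Splitting an atom (a variable, or a connected component of S) off a
   letter is a contracting homotopy from level > p into level >= p.  So each inclusion of
   filtration stages vanishes in homology, and the Betti numbers of the bar complex are
   alternating sums of those of its level slices.  The latter are tensor powers of the complex
   of tight deletions.  Summing over words, and with H a homology basis of tight deletions,
     Q_R = sum over S in H of (-1)^c(S) y^(m_S) t^(c(S) + |S|).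
   Tightness, c(S), and the coincidences m_S = m_T depend only on the lattice L_I together
   with its coprime pairs, hence are preserved by lambda. *)
Require Import Defs.
From HB Require Import structures.
From mathcomp Require Import all_boot all_order all_algebra.
From mathcomp Require Import zify ring.
Import Order.TTheory GRing.Theory Num.Theory.
Set Implicit Arguments. Unset Strict Implicit. Unset Printing Implicit Defensive.
Local Open Scope ring_scope.

(** * Ranks of complexes *)

(** The splitting contraction is not an exact homotopy. With S the splitting and D the differential,
    S D + D S is the identity plus words that come later in a finite order, and this only on words
    of positive level; [cycle_boundary] turns such a triangular identity into exactness by
    iteration. A coprime product adds weights and removes a letter, so it raises the level by one,
    and merging undoes splitting. That S D + D S does not lower the level is a separate fact: the
    part below is the anticommutator of S with the tight deletions, and it vanishes because a tight
    deletion moves neither lcms nor the degrees of atoms. Degree at least 2 guarantees an edge at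
    every point of a generator; a generator of degree 1 would have no edge, and deleting it could
    lower the lcm while keeping the rank. The ranks [rk] live over the rationals, whereas H depends
    on K. This is harmless for the transfer: on both sides the tight deletions form one and the same
    matrix over K, indexed by the same subsets S, so a single H serves both. *)

Section LinearAlgebra.
Variables (K : fieldType) (N : nat).
Implicit Types (A B F E H : pred 'I_N) (M S U : 'M[K]_N) (v : 'rV[K]_N).

(** Spans of basis vectors are encoded as row spaces of diagonal projectors, so that all matrices
    stay square of one size. Vectors are rows and matrices act on the right. *)
Definition sel A : 'M[K]_N := diag_mx (\row_i (A i)%:R).

Lemma sel_mulE p A (M : 'M[K]_(N, p)) i k : (sel A *m M) i k = (A i)%:R * M i k.
Proof. by rewrite mul_diag_mx !mxE. Qed.

Lemma mul_selE p A (M : 'M[K]_(p, N)) i k : (M *m sel A) i k = M i k * (A k)%:R.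
Proof. by rewrite mul_mx_diag !mxE. Qed.

Definition emb m (f : 'I_m -> 'I_N) : 'M[K]_(m, N) :=
  \matrix_(i, k) (f i == k)%:R.

Lemma emb_mulE m p (f : 'I_m -> 'I_N) (Q : 'M[K]_(N, p)) i k :
  (emb f *m Q) i k = Q (f i) k.
Proof.
rewrite mxE (bigD1 (f i)) //= mxE eqxx mul1r big1 ?addr0 // => l nl.
by rewrite mxE eq_sym (negPf nl) mul0r.
Qed.

Lemma mul_tr_embE m p (f : 'I_m -> 'I_N) (Q : 'M[K]_(p, N)) i k :
  (Q *m (emb f)^T) i k = Q i (f k).
Proof.
rewrite mxE (bigD1 (f k)) //= !mxE eqxx mulr1 big1 ?addr0 // => l nl.
by rewrite !mxE eq_sym (negPf nl) mulr0.
Qed.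

Lemma emb_tr_mul m (f : 'I_m -> 'I_N) : injective f -> emb f *m (emb f)^T = 1%:M.
Proof. by move=> fI; apply/matrixP=> i k; rewrite emb_mulE !mxE (inj_eq fI) eq_sym. Qed.

Lemma tr_emb_mul m (f : 'I_m -> 'I_N) A :
  injective f -> (forall k, A k = (k \in codom f)) -> (emb f)^T *m emb f = sel A.
Proof.
move=> fI cf; apply/matrixP=> i k; rewrite !mxE.
have [Ai|nAi] := boolP (A i).
  move: (Ai); rewrite cf => /codomP[l ->].
  rewrite (bigD1 l) //= !mxE eqxx mul1r big1 ?addr0 // => t nt.
  by rewrite !mxE (inj_eq fI) (negPf nt) mul0r.
rewrite mul0rn big1 // => l _; rewrite !mxE; case: eqVneq => [e|]; last by rewrite mul0r.
by rewrite cf -e codom_f in nAi.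
Qed.

Lemma rank_sel A : \rank (sel A) = #|A|.
Proof.
have fI : injective (@enum_val _ (mem A)) by exact: enum_val_inj.
have e := tr_emb_mul fI (A := A) _.
rewrite -e; last first.
  move=> k; apply/idP/codomP => [Ak|[i ->]]; last exact: (enum_valP i).
  by exists (enum_rank_in (Ak : k \in A) k); rewrite enum_rankK_in.
apply/eqP; rewrite eqn_leq (leq_trans (mxrankM_maxr _ _)) ?rank_leq_row //=.
set E := emb _; have EE : \rank (E *m E^T *m (E *m E^T)) = #|A|.
  by rewrite emb_tr_mul // mulmx1 mxrank1.
rewrite -[X in (X <= _)%N]EE mulmxA -(mulmxA E).
by rewrite (leq_trans (mxrankM_maxl _ _)) // mxrankM_maxr.
Qed.

(** The submatrix and the full matrix with the other rows and columns set to zero are obtained from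
    each other by multiplication with [emb] matrices. *)
Lemma rank_sub_sel m p (f : 'I_m -> 'I_N) (g : 'I_p -> 'I_N) A B (M : 'M[K]_N) :
  injective f -> injective g -> (forall k, A k = (k \in codom f)) ->
  (forall k, B k = (k \in codom g)) ->
  \rank (\matrix_(i, k) M (f i) (g k)) = \rank (sel A *m M *m sel B).
Proof.
move=> fI gI Af Bg.
have -> : \matrix_(i, k) M (f i) (g k) = emb f *m M *m (emb g)^T.
  by apply/matrixP=> i k; rewrite mul_tr_embE emb_mulE mxE.
rewrite -(tr_emb_mul fI Af) -(tr_emb_mul gI Bg).
apply/eqP; rewrite eqn_leq; apply/andP; split; last first.
  rewrite -!mulmxA (leq_trans (mxrankM_maxr _ _)) // !mulmxA.
  exact: mxrankM_maxl.
set Q := (emb f)^T *m emb f *m M *m ((emb g)^T *m emb g).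
have -> : emb f *m M *m (emb g)^T = emb f *m Q *m (emb g)^T.
  rewrite /Q !mulmxA emb_tr_mul // mul1mx -!mulmxA emb_tr_mul // mulmx1.
  by [].
by rewrite (leq_trans (mxrankM_maxl _ _)) // mxrankM_maxr.
Qed.

Lemma supp_selP A v : v = v *m sel A <-> (forall i, v 0 i != 0 -> A i).
Proof.
split=> [-> i|h]; first by rewrite mul_selE; case: (A i); rewrite // mulr0 eqxx.
apply/rowP=> i; rewrite mul_selE; case: (eqVneq (v 0 i) 0) => [->|/h ->].
  by rewrite mul0r.
by rewrite mulr1.
Qed.

Lemma sub_selP A v : reflect (v = v *m sel A) (v <= sel A)%MS.
Proof.
apply: (iffP idP) => [/submxP[u ->]|->]; last exact: submxMl.
apply/rowP=> i; rewrite !mul_selE -mulrA; congr (_ * _).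
by case: (A i); rewrite ?mulr1 ?mulr0.
Qed.

(** With U = S M + M S, a cycle v equals v S M + v (1 - U). The first summand is a boundary; the
    second is again a cycle in F, and the least [phi] on its support is larger than for v. Since
    [phi] is bounded, iteration reaches zero. *)
Lemma cycle_boundary M S (F F' : pred 'I_N) (phi : 'I_N -> nat) :
  M *m M = 0 ->
  (forall i k, F i -> S i k != 0 -> F' k) ->
  (forall i k, F i -> (S *m M + M *m S) i k != 0 -> F k) ->
  (forall i k, F i -> (phi k <= phi i)%N ->
     (S *m M + M *m S) i k = (i == k)%:R) ->
  forall v, (v <= sel F)%MS -> v *m M = 0 -> (v <= sel F' *m M)%MS.
Proof.
move=> MM SF UF Uphi; set U := _ + _ in UF Uphi.
have oneB i k : (1%:M - U) i k = (i == k)%:R - U i k.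
  by move: U {UF Uphi} => U; rewrite !mxE.
pose B := (\max_i phi i).+1.
suff main n v : (v <= sel F)%MS -> v *m M = 0 ->
    (forall i, v 0 i != 0 -> (B - n <= phi i)%N) -> (v <= sel F' *m M)%MS.
  by move=> v vF vM; apply: (main B v vF vM) => i _; rewrite subnn.
elim: n v => [|n IHn] v /sub_selP vF vM vphi.
  suff -> : v = 0 by exact: sub0mx.
  apply/rowP=> i; rewrite [RHS]mxE; apply/eqP; apply: contraT => /vphi.
  by rewrite subn0 leqNgt ltnS leq_bigmax.
have -> : v = v *m S *m M + v *m (1%:M - U).
  by rewrite mulmxBr mulmx1 mulmxDr !mulmxA vM mul0mx addr0 addrC subrK.
have vsupp := (supp_selP F v).1 vF.
have vSF' : v *m S = v *m S *m sel F'.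
  apply/supp_selP => k; rewrite mxE; apply: contraR => nF'.
  rewrite big1 // => i _; case: (eqVneq (v 0 i) 0) => [->|/vsupp Fi].
    by rewrite mul0r.
  case: (eqVneq (S i k) 0) => [->|/(SF _ _ Fi)]; first by rewrite mulr0.
  by rewrite (negPf nF').
rewrite addmx_sub //; first by rewrite vSF' -mulmxA submxMl.
apply: IHn.
- apply/sub_selP/supp_selP => k; rewrite mxE; apply: contraR => nFk.
  rewrite big1 // => i _; case: (eqVneq (v 0 i) 0) => [->|/vsupp Fi].
    by rewrite mul0r.
  rewrite oneB; case: (eqVneq i k) => [eik|nik]; first by rewrite eik (negPf nFk) in Fi.
  suff /eqP -> : U i k == 0 by rewrite subrr mulr0.
  by apply: contraR nFk; exact: UF.
- rewrite -mulmxA mulmxBl mul1mx mulmxBr vM sub0r.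
  by rewrite mulmxDl -mulmxA MM mulmx0 add0r -mulmxA mulmxA vM mul0mx oppr0.
- move=> k; rewrite mxE; apply: contraR; rewrite -ltnNge => ltk.
  rewrite big1 // => i _; case: (eqVneq (v 0 i) 0) => [->|vi].
    by rewrite mul0r.
  have := vphi _ vi; have := vsupp _ vi => Fi lei.
  rewrite oneB Uphi // ?subrr ?mulr0 //.
  by apply: leq_trans lei; lia.
Qed.

(** Fp is a filtration stage, E its quotient by the next stage, F1 that next stage one degree lower.
    Project the image of Fp onto E: the kernel consists of the boundaries lying in F1, and by the
    last hypothesis these are all cycles of F1, a space of dimension |F1| minus the rank of M on
    F1. *)
Lemma graded_rank M (Fp F1 E : pred 'I_N) (A : pred 'I_N) :
  M *m M = 0 ->
  (forall i, Fp i && E i = A i) ->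
  (forall i k, Fp i -> M i k != 0 -> E k || F1 k) ->
  (forall i k, Fp i -> ~~ E i -> M i k != 0 -> ~~ E k) ->
  (forall k, F1 k -> ~~ E k) ->
  (forall v, (v <= sel F1)%MS -> v *m M = 0 -> (v <= sel Fp *m M)%MS) ->
  (\rank (sel A *m M *m sel E) + #|F1| = \rank (sel Fp *m M) + \rank (sel F1 *m M))%N.
Proof.
move=> MM AE ME ME' F1E acyc; set X := sel Fp *m M.
have -> : sel A *m M *m sel E = X *m sel E.
  apply/matrixP=> i k; rewrite !mul_selE !sel_mulE -AE.
  have [Fi|nF] := boolP (Fp i); rewrite ?mul0r //=.
  have [Ei|nE] := boolP (E i); rewrite ?mul0r ?mul1r //=.
  case: (eqVneq (M i k) 0) => [->|Mik]; rewrite ?mul0r //.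
  by rewrite (negPf (ME' i k Fi nE Mik)) mulr0.
rewrite -(mxrank_mul_ker X (sel E)) -rank_sel -(mxrank_mul_ker (sel F1) M).
suff -> : \rank (X :&: kermx (sel E)) = \rank (sel F1 :&: kermx M) by lia.
suff /eqmx_rank -> : (X :&: kermx (sel E) == sel F1 :&: kermx M)%MS by [].
apply/andP; split; apply/rV_subP => v; rewrite !sub_capmx => /andP[].
- move=> vX /sub_kermxP vE; apply/andP; split; last first.
    by apply/sub_kermxP; case/submxP: vX => u ->; rewrite -!mulmxA MM !mulmx0.
  apply/sub_selP/supp_selP => k vk.
  have nEk : ~~ E k.
    apply: contra vk => Ek; move/rowP/(_ k): vE; rewrite mul_selE Ek mulr1 => ->.
    by rewrite mxE.
  case/submxP: vX vk => u ->; rewrite mxE => h.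
  have [i Fi Mik] : exists2 i, Fp i & M i k != 0.
    case: (pickP (fun i => Fp i && (M i k != 0))) => [i /andP[]|noi]; first by exists i.
    case/eqP: h; apply: big1 => i _; rewrite sel_mulE; move: (noi i).
    by case: (Fp i) => //= [/negbFE/eqP->|]; rewrite ?mul0r ?mulr0.
  by move: (ME i k Fi Mik); rewrite (negPf nEk).
- move=> vF /sub_kermxP vM; rewrite acyc //=; apply/sub_kermxP/rowP=> k.
  rewrite mul_selE !mxE; move/sub_selP/supp_selP/(_ k): vF.
  case: (eqVneq (v 0 k) 0) => [->|_ /(_ isT)/F1E/negPf->]; by rewrite ?mul0r ?mulr0.
Qed.

(** I, P and S retract the complex onto one with zero differential, so the cycles in A are the
    direct sum of the image of H and the boundaries coming from A', one degree higher. *)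
Lemma contraction_rank M (I P S : 'M[K]_N) (A A' H Hall : pred 'I_N) :
  M *m M = 0 -> I *m P = sel Hall -> I *m M = 0 -> M *m P = 0 ->
  P *m I + M *m S + S *m M = 1%:M ->
  (forall k, H k -> Hall k) ->
  (forall i k, A i -> P i k != 0 -> H k) ->
  (forall i k, H i -> I i k != 0 -> A k) ->
  (forall i k, A i -> S i k != 0 -> A' k) ->
  (forall i k, A' i -> M i k != 0 -> A k) ->
  #|A| = (#|H| + \rank (sel A *m M) + \rank (sel A' *m M))%N.
Proof.
move=> MM IP IM MP one HHall PH IA SA' MA.
have supp_mul (B C : pred 'I_N) (Q : 'M[K]_N) : (forall i k, B i -> Q i k != 0 -> C k) ->
    sel B *m Q = sel B *m Q *m sel C.
  move=> h; apply/matrixP=> i k; rewrite mul_selE sel_mulE.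
  have [Bi|] := boolP (B i); rewrite ?mul0r // mul1r.
  by case: (eqVneq (Q i k) 0) => [->|/(h _ _ Bi) ->]; rewrite ?mul0r ?mulr1.
rewrite -rank_sel -(mxrank_mul_ker (sel A) M).
suff : \rank (sel A :&: kermx M) = (#|H| + \rank (sel A' *m M))%N by lia.
have rH : \rank (sel H *m I) = #|H|.
  have e : sel H *m I *m P = sel H.
    rewrite -mulmxA IP; apply/matrixP=> i k; rewrite mul_selE mxE.
    case: (eqVneq i k) => [->|]; rewrite ?mulr0n ?mul0r // mulr1n mxE.
    by case Hk : (H k); rewrite ?mul0r // (HHall _ Hk) mulr1.
  apply/eqP; rewrite eqn_leq -{1}rank_sel mxrankM_maxl /=.
  by rewrite -rank_sel -{1}e mxrankM_maxl.
have dis : \rank (sel H *m I :&: sel A' *m M)%MS = 0%N.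
  apply/eqP; rewrite mxrank_eq0 -submx0; apply/rV_subP=> v.
  rewrite sub_capmx => /andP[/submxP[b vb] /submxP[a va]].
  have vP : v *m P = 0 by rewrite va -!mulmxA MP !mulmx0.
  have : v *m P = b *m sel H.
    rewrite vb -!mulmxA IP; apply/rowP=> k; rewrite mulmxA mul_selE.
    rewrite mul_selE; case Hk : (H k); rewrite ?(HHall _ Hk) ?mulr1 // !mulr0 ?mul0r //.
  by rewrite vP => e; rewrite vb mulmxA -e mul0mx sub0mx.
rewrite -rH -mxrank_sum_cap dis addn0.
suff /eqmx_rank -> : (sel A :&: kermx M == sel H *m I + sel A' *m M)%MS by [].
apply/andP; split.
  apply/rV_subP=> v; rewrite sub_capmx => /andP[/sub_selP vA /sub_kermxP vM].
  have -> : v = v *m P *m I + v *m S *m M.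
    by rewrite -{1}[v]mulmx1 -one !mulmxDr !mulmxA vM mul0mx addr0.
  have vQ (C : pred 'I_N) (Q : 'M[K]_N) : (forall i k, A i -> Q i k != 0 -> C k) ->
      v *m Q = v *m Q *m sel C.
    by move=> /supp_mul e; rewrite {1}vA -(mulmxA v) e !mulmxA -vA.
  rewrite (vQ _ _ PH) (vQ _ _ SA').
  by rewrite addmx_sub_adds // -(mulmxA (v *m _)) submxMl.
rewrite addsmx_sub !sub_capmx; apply/andP; split; apply/andP; split.
- by rewrite (supp_mul _ _ _ IA) submxMl.
- by apply/sub_kermxP; rewrite -mulmxA IM mulmx0.
- by rewrite (supp_mul _ _ _ MA) submxMl.
- by apply/sub_kermxP; rewrite -mulmxA MM mulmx0.
Qed.

End LinearAlgebra.

(** * The bar differential, acting on functions of words *)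

Section Bar.
Variables (K : fieldType) (X : eqType).
Implicit Types (w : seq X) (f : seq X -> K).

(** Chains are not built as vectors: a combination is a list of weighted terms, used only through
    the value of a function on it. Accordingly an operator O is given by its transpose, [O f w]
    being f evaluated on the image of w. *)
Definition lin (Y : Type) (l : seq (K * Y)) (g : Y -> K) : K :=
  \sum_(p <- l) p.1 * g p.2.

Lemma eq_lin (Y : eqType) (l : seq (K * Y)) (g g' : Y -> K) :
  (forall p, p \in l -> g p.2 = g' p.2) -> lin l g = lin l g'.
Proof. by move=> e; apply: eq_big_seq => p /e ->. Qed.

Lemma lin0 (Y : eqType) (l : seq (K * Y)) g :
  (forall p, p \in l -> g p.2 = 0) -> lin l g = 0.
Proof. by move=> e; rewrite /lin big_seq big1 // => p /e ->; rewrite mulr0. Qed.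

Lemma lin_nil (Y : Type) (g : Y -> K) : lin [::] g = 0.
Proof. exact: big_nil. Qed.

Lemma lin_cons (Y : Type) p (l : seq (K * Y)) g : lin (p :: l) g = p.1 * g p.2 + lin l g.
Proof. exact: big_cons. Qed.

Lemma lin_cat (Y : Type) (l l' : seq (K * Y)) g : lin (l ++ l') g = lin l g + lin l' g.
Proof. exact: big_cat. Qed.

Lemma linZ (Y : Type) (l : seq (K * Y)) c g : lin l (fun y => c * g y) = c * lin l g.
Proof. by rewrite /lin mulr_sumr; apply: eq_bigr => p _; rewrite mulrCA. Qed.

Lemma linD (Y : Type) (l : seq (K * Y)) g g' :
  lin l (fun y => g y + g' y) = lin l g + lin l g'.
Proof. by rewrite /lin -big_split; apply: eq_bigr => p _; rewrite mulrDr. Qed.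

Lemma linN (Y : Type) (l : seq (K * Y)) g : lin l (fun y => - g y) = - lin l g.
Proof. by rewrite /lin -sumrN; apply: eq_bigr => p _; rewrite mulrN. Qed.

Section Differential.
Variables (dl : X -> seq (K * X)) (ml : X -> X -> seq (K * X)) (par : X -> K).

(** [dl] is the differential of a letter, [ml] the product of neighbours, and [par] the sign for
    passing a shifted letter. *)
Fixpoint bard f w : K :=
  match w with
  | [::] => 0
  | x :: w' => - lin (dl x) (fun x' => f (x' :: w')) + par x *
     ((if w' is y :: w'' then lin (ml x y) (fun z => f (z :: w'')) else 0)
      + bard (fun w1 => f (x :: w1)) w')
  end.

(** R over-approximates the words reachable by one application of the differential; choosing R gives
    the locality and support statements for its variants. *)
Lemma bard_local (R : seq X -> seq X -> Prop) :
  (forall x w p, p \in dl x -> R (x :: w) (p.2 :: w)) ->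
  (forall x y w p, p \in ml x y -> R [:: x, y & w] (p.2 :: w)) ->
  (forall x w w', R w w' -> R (x :: w) (x :: w')) ->
  forall w f g, (forall w', R w w' -> f w' = g w') -> bard f w = bard g w.
Proof.
move=> Rd Rm Rc; elim=> [|x w IHw] f g fg //=.
congr (- _ + _ * (_ + _)); first by apply: eq_lin => p /Rd h; exact/fg/h.
  case: w fg {IHw} => // y w fg; apply: eq_lin => p /Rm h; exact/fg/h.
by apply: IHw => w' /(Rc x) /fg.
Qed.

Lemma eq_bard f g w : f =1 g -> bard f w = bard g w.
Proof. by move=> e; apply: (@bard_local (fun _ _ => True)). Qed.

Lemma bardZ c f w : bard (fun w => c * f w) w = c * bard f w.
Proof.
elim: w f => [|x w IHw] f /=; first by rewrite mulr0.
rewrite linZ IHw; case: w {IHw} => [|y w]; rewrite ?linZ; ring.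
Qed.

Lemma bardD f g w : bard (fun w => f w + g w) w = bard f w + bard g w.
Proof.
elim: w f g => [|x w IHw] f g /=; first by rewrite addr0.
rewrite linD IHw; case: w {IHw} => [|y w]; rewrite ?linD; ring.
Qed.

Lemma bard0 w : bard (fun=> 0) w = 0.
Proof. by rewrite (eq_bard _ (g := fun=> 0 * 0)) ?bardZ ?mul0r // => ?; rewrite mul0r. Qed.

Lemma bardN f w : bard (fun w => - f w) w = - bard f w.
Proof. by rewrite -mulN1r -bardZ; apply: eq_bard => w'; rewrite mulN1r. Qed.

Lemma bard_sum (J : Type) (r : seq J) (c : J -> K) (F : J -> seq X -> K) w :
  bard (fun w => \sum_(j <- r) c j * F j w) w = \sum_(j <- r) c j * bard (F j) w.
Proof.
elim: r => [|j r IHr].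
  by rewrite big_nil -[RHS](bard0 w); apply: eq_bard => w'; rewrite big_nil.
rewrite big_cons -IHr -bardZ -bardD; apply: eq_bard => w'.
by rewrite big_cons.
Qed.

Lemma bard_lin (Y : Type) (l : seq (K * Y)) (F : Y -> seq X -> K) w :
  bard (fun w => lin l (fun y => F y w)) w = lin l (fun y => bard (F y) w).
Proof. exact: bard_sum. Qed.

(** The hypotheses are those of a DG algebra with shifted signs. Unrolling the first two letters,
    the terms cancel in pairs by Leibniz and associativity, and the tail is the induction
    hypothesis. *)
Lemma bard_square :
  (forall x p, p \in dl x -> par p.2 = - par x) ->
  (forall x y p, p \in ml x y -> par p.2 = - (par x * par y)) ->
  (forall x g, lin (dl x) (fun x' => lin (dl x') g) = 0) ->
  (forall x y g, lin (ml x y) (fun z => lin (dl z) g) =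
     lin (dl x) (fun x' => lin (ml x' y) g)
     - par x * lin (dl y) (fun y' => lin (ml x y') g)) ->
  (forall x y z g, lin (ml x y) (fun u => lin (ml u z) g) =
     lin (ml y z) (fun u => lin (ml x u) g)) ->
  forall f w, bard (bard f) w = 0.
Proof.
move=> pard parm dd leib assoc f w; elim: w f => [//|x w IHw] f /=.
rewrite (eq_lin (g' := fun x' => - lin (dl x') (fun x2 => f (x2 :: w)) - par x *
   ((if w is y :: w'' then lin (ml x' y) (fun z => f (z :: w'')) else 0)
      + bard (fun w1 => f (x' :: w1)) w))); last first.
  by move=> p /pard ->; rewrite mulNr.
rewrite linD linN dd oppr0 add0r linN linZ linD -bard_lin opprK -mulrDr.
rewrite -[RHS](mulr0 (par x)); congr (_ * _).
rewrite bardD bardN bardZ bardD IHw addr0.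
case: w {IHw} => [|y w]; first by rewrite (lin0 (l := dl x)) //=; ring.
set A := bard _ _; rewrite /=.
rewrite (eq_lin (l := ml x y) (g' := fun z => - lin (dl z) (fun x2 => f (x2 :: w))
   - (par x * par y) *
   ((if w is y0 :: w'' then lin (ml z y0) (fun z => f (z :: w'')) else 0)
      + bard (fun w1 => f (z :: w1)) w))); last first.
  by move=> p /parm ->; rewrite mulNr.
rewrite linD !linN linZ linD leib -bard_lin.
have -> : lin (ml x y) (fun z => if w is y0 :: w'' then lin (ml z y0) (fun z0 => f (z0 :: w'')) else 0)
  = if w is y0 :: w'' then lin (ml y y0) (fun z => lin (ml x z) (fun z0 => f (z0 :: w''))) else 0.
  by case: w {A} => [|z w]; [rewrite lin0 | rewrite assoc].
by ring.
Qed.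

End Differential.

Lemma bard_split dl dl' ml ml' par f w :
  bard (fun x => dl x ++ dl' x) (fun x y => ml x y ++ ml' x y) par f w =
  bard dl ml par f w + bard dl' ml' par f w.
Proof.
elim: w f => [|x w IHw] f /=; first by rewrite addr0.
rewrite lin_cat IHw; case: w {IHw} => [|y w]; rewrite ?lin_cat; ring.
Qed.

Lemma bard_eq_lin dl dl' ml ml' par f w :
  (forall x g, lin (dl x) g = lin (dl' x) g) ->
  (forall x y g, lin (ml x y) g = lin (ml' x y) g) ->
  bard dl ml par f w = bard dl' ml' par f w.
Proof.
move=> ed em; elim: w f => [|x w IHw] f //=.
by rewrite ed IHw; case: w {IHw} => [|y w]; rewrite ?em.
Qed.

End Bar.

(** * Matrices of operators on a finite list of words *)

Section OperatorMatrix.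
Variables (K : fieldType) (W : eqType) (ws : seq W).
Let N := size ws.
Implicit Types (O : (W -> K) -> W -> K) (f g : W -> K).

Definition wd (i : 'I_N) : W := tnth (in_tuple ws) i.

Definition dirac (k : 'I_N) : W -> K := fun w => (w == wd k)%:R.

Definition mxo O : 'M[K]_N := \matrix_(i, k) O (dirac k) (wd i).

(** Linearity, together with closure of [ws] under O: what makes O act as the matrix [mxo O]. *)
Definition operates O :=
  (forall (r : seq 'I_N) (c : 'I_N -> K) (F : 'I_N -> W -> K) w,
     O (fun w => \sum_(j <- r) c j * F j w) w = \sum_(j <- r) c j * O (F j) w) /\
  (forall w f g, w \in ws -> {in ws, f =1 g} -> O f w = O g w).

Hypothesis uws : uniq ws.

Lemma wd_inj : injective wd.
Proof.
move=> i k; rewrite /wd !(tnth_nth (wd i)) /= => /eqP.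
by rewrite nth_uniq // => /eqP/val_inj.
Qed.

Lemma mem_wd i : wd i \in ws.
Proof. exact: mem_tnth. Qed.

Lemma wdP w : w \in ws -> exists i, w = wd i.
Proof. by move=> h; have /tnthP := (h : w \in in_tuple ws). Qed.

Lemma mxoE O f i : operates O -> O f (wd i) = \sum_k mxo O i k * f (wd k).
Proof.
move=> [Olin Oloc].
rewrite (Oloc _ _ (fun w => \sum_k f (wd k) * dirac k w)) ?mem_wd //.
  by rewrite Olin; apply: eq_bigr => k _; rewrite mxE mulrC.
move=> _ /wdP[l ->]; rewrite (bigD1 l) //= /dirac eqxx mulr1 big1 ?addr0 // => k nk.
by rewrite (inj_eq wd_inj) eq_sym (negPf nk) mulr0.
Qed.

Lemma mxo_comp O1 O2 : operates O1 -> mxo (fun f => O1 (O2 f)) = mxo O1 *m mxo O2.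
Proof.
move=> h1; apply/matrixP=> i k; rewrite mxE (mxoE _ _ h1) [RHS]mxE.
by apply: eq_bigr => l _; rewrite !mxE.
Qed.

(** The entry is O applied to [dirac k], and if Q fails at the word k, this function vanishes on all
    words that Q allows. *)
Lemma mxo_supp O (Q : W -> W -> bool) i k : mxo O i k != 0 ->
  (forall f, (forall w', Q (wd i) w' -> f w' = 0) -> O f (wd i) = 0) -> Q (wd i) (wd k).
Proof.
rewrite mxE => ne h; apply: contraNT ne => nQ; apply/eqP/h => w' Qw'.
by rewrite /dirac; case: eqP => // e; rewrite -e Qw' in nQ.
Qed.

End OperatorMatrix.

(** * Monomials and their lcms *)

Section Exponents.
Variable n : nat.
Implicit Types a b c : mon n.
Local Open Scope nat_scope.

Lemma mdivP a b : reflect (forall v, a v <= b v) (mdiv a b).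
Proof. exact: forallP. Qed.

Lemma mcoprimeP a b : reflect (forall v, a v = 0 \/ b v = 0) (mcoprime a b).
Proof.
by apply: (iffP forallP) => h v; have := h v; [case/orP=> /eqP|case=> ->; rewrite ?orbT]; auto.
Qed.

Lemma mcoprimeC a b : mcoprime a b = mcoprime b a.
Proof. by apply: eq_forallb => v; rewrite orbC. Qed.

Lemma mplusE a b v : mplus a b v = (a v + b v)%N.
Proof. by rewrite ffunE. Qed.

Lemma msubE a b v : msub a b v = (a v - b v)%N.
Proof. by rewrite ffunE. Qed.

Lemma mdivv a : mdiv a a. Proof. by apply/mdivP. Qed.

Lemma mdiv_trans b a c : mdiv a b -> mdiv b c -> mdiv a c.
Proof. by move=> /mdivP h /mdivP k; apply/mdivP=> v; apply: leq_trans (h v) (k v). Qed.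

Lemma mdiv0 a : mdiv (mzero n) a. Proof. by apply/mdivP=> v; rewrite ffunE. Qed.

Lemma mdeg_eq0 a : (mdeg a == 0) = (a == mzero n).
Proof.
rewrite sum_nat_eq0; apply/forallP/eqP => [h|-> v]; last by rewrite ffunE.
by apply/ffunP=> v; rewrite ffunE; apply/eqP; have := h v.
Qed.

Lemma mdeg_plus a b : mdeg (mplus a b) = mdeg a + mdeg b.
Proof. by rewrite -big_split; apply: eq_bigr => v _; rewrite ffunE. Qed.

Lemma mdeg_le a b : mdiv a b -> mdeg a <= mdeg b.
Proof. by move=> /mdivP h; apply: leq_sum => v _. Qed.

Lemma mdeg_sub a b : mdiv b a -> mdeg (msub a b) = mdeg a - mdeg b.
Proof.
move=> ab; have /mdivP h := ab; apply/eqP.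
rewrite -(eqn_add2r (mdeg b)) subnK ?mdeg_le //.
by rewrite -mdeg_plus; apply/eqP; congr mdeg; apply/ffunP=> v; rewrite !ffunE subnK.
Qed.

Lemma mplusA : associative (@mplus n).
Proof. by move=> a b c; apply/ffunP=> v; rewrite !ffunE addnA. Qed.

Lemma mplusC : commutative (@mplus n).
Proof. by move=> a b; apply/ffunP=> v; rewrite !ffunE addnC. Qed.

Lemma mplus0 a : mplus (mzero n) a = a.
Proof. by apply/ffunP=> v; rewrite !ffunE. Qed.

Lemma msub_plus a b : msub (mplus a b) a = b.
Proof. by apply/ffunP=> v; rewrite !ffunE addKn. Qed.

Lemma mplus_sub a b : mdiv a b -> mplus a (msub b a) = b.
Proof. by move=> /mdivP h; apply/ffunP=> v; rewrite !ffunE subnKC. Qed.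

Lemma mdiv_plusr a b : mdiv a (mplus a b).
Proof. by apply/mdivP=> v; rewrite ffunE leq_addr. Qed.

Lemma mem_mons_le (j m : mon n) : (m \in mons_le j) = mdiv m j.
Proof.
rewrite mem_filter; case: (boolP (mdiv m j)) => //= /mdivP h.
have lt v : m v < (mdeg j).+1.
  by rewrite ltnS (leq_trans (h v)) // /mdeg (bigD1 v) //= leq_addr.
apply/imageP; exists [ffun v => Ordinal (lt v)] => //.
by apply/ffunP=> v; rewrite !ffunE.
Qed.

Lemma uniq_mons_le (j : mon n) : uniq (mons_le j).
Proof.
rewrite filter_uniq // map_inj_uniq ?enum_uniq // => f g /ffunP h.
by apply/ffunP=> v; apply: val_inj; have := h v; rewrite !ffunE.
Qed.

End Exponents.

(** * Lcms of sets of generators and their connected components *)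

Section Generators.
Variables (n N : nat) (gens : 'I_N -> mon n).
Hypothesis gens2 : forall i, (2 <= mdeg (gens i))%N.
Implicit Types (S T C : {set 'I_N}) (v : 'I_n) (i : 'I_N).

Definition mS S : mon n := [ffun v => (\max_(i in S) gens i v)%N].

Lemma mS0 : mS set0 = mzero n.
Proof. by apply/ffunP=> v; rewrite !ffunE big_set0. Qed.

Lemma mS_le S a : reflect (forall i, i \in S -> mdiv (gens i) a) (mdiv (mS S) a).
Proof.
apply: (iffP (mdivP _ _)) => [h i iS|h v].
  apply/mdivP=> v; have := h v; rewrite ffunE => /bigmax_leqP; exact.
by rewrite ffunE; apply/bigmax_leqP => i /h/mdivP.
Qed.

Lemma mS_sub S T : S \subset T -> mdiv (mS S) (mS T).
Proof.
move=> /subsetP ST; apply/mS_le => i /ST iT.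
by apply/mdivP=> v; rewrite ffunE; apply: leq_bigmax_cond.
Qed.

Lemma gens_le_mS i S : i \in S -> mdiv (gens i) (mS S).
Proof. by have /mS_le h := mdivv (mS S) => /h. Qed.

Lemma mSU S T v : mS (S :|: T) v = maxn (mS S v) (mS T v).
Proof.
apply/eqP; rewrite eqn_leq; apply/andP; split.
  rewrite ffunE; apply/bigmax_leqP => i; rewrite inE leq_max => /orP[] iS.
    by have /mdivP-> := gens_le_mS iS.
  by have /mdivP-> := gens_le_mS iS; rewrite orbT.
by rewrite geq_max; have /mdivP-> := mS_sub (subsetUl S T);
   have /mdivP-> := mS_sub (subsetUr S T).
Qed.

Lemma mS_pos S v : (0 < mS S v)%N -> exists2 i, i \in S & (0 < gens i v)%N.
Proof.
move=> h; case: (pickP (fun i => (i \in S) && (0 < gens i v)%N)) => [i /andP[]|none].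
  by exists i.
suff e : (mS S v <= 0)%N by rewrite leqn0 in e; rewrite (eqP e) in h.
rewrite ffunE; apply/bigmax_leqP => i iS; move: (none i); rewrite iS /=.
by case: (gens i v).
Qed.

Lemma gens_neq0 i : exists v, (0 < gens i v)%N.
Proof.
apply/existsP; apply: contraLR (gens2 i); rewrite negb_exists -ltnNge => /forallP h.
by rewrite /mdeg big1 // => v _; apply/eqP; have := h v; rewrite lt0n negbK.
Qed.

Lemma mS_eq0 S : mS S = mzero n -> S = set0.
Proof.
move=> e; apply/eqP/set0Pn => -[i iS]; have [v iv] := gens_neq0 i.
by have /mdivP/(_ v) := gens_le_mS iS; rewrite e ffunE leqNgt iv.
Qed.

Lemma mcoprime_sub S T S' T' : S' \subset S -> T' \subset T ->
  mcoprime (mS S) (mS T) -> mcoprime (mS S') (mS T').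
Proof.
move=> /mS_sub/mdivP h /mS_sub/mdivP k /mcoprimeP c; apply/mcoprimeP=> v.
by have := h v; have := k v; have := c v; lia.
Qed.

Lemma mcoprimeUl S S' a : mcoprime (mS (S :|: S')) a = mcoprime (mS S) a && mcoprime (mS S') a.
Proof.
apply/mcoprimeP/andP => [h|[/mcoprimeP h /mcoprimeP h'] v].
  by split; apply/mcoprimeP => v; have := h v; rewrite mSU; lia.
by rewrite mSU; have := h v; have := h' v; lia.
Qed.

Lemma coprime_disjoint S T : mcoprime (mS S) (mS T) -> [disjoint S & T].
Proof.
move=> /mcoprimeP h; apply/pred0P => i /=; apply/negP => /andP[iS iT].
have [v iv] := gens_neq0 i; have := h v.
by have /mdivP/(_ v) := gens_le_mS iS; have /mdivP/(_ v) := gens_le_mS iT; lia.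
Qed.

Lemma mS_plus S T : mcoprime (mS S) (mS T) -> mS (S :|: T) = mplus (mS S) (mS T).
Proof.
move=> /mcoprimeP h; apply/ffunP=> v; rewrite mSU mplusE.
by have := h v; lia.
Qed.

Lemma mdeg_mSU_lt S T : ~~ mcoprime (mS S) (mS T) ->
  (mdeg (mS (S :|: T)) < mdeg (mS S) + mdeg (mS T))%N.
Proof.
rewrite negb_forall => /existsP[v]; rewrite negb_or -!lt0n => /andP[a b].
rewrite -mdeg_plus /mdeg (bigD1 v) //= [X in (_ < X)%N](bigD1 v) //=.
rewrite -addSn leq_add //; first by rewrite mSU mplusE; lia.
by apply: leq_sum => u _; rewrite mSU mplusE; lia.
Qed.

(* A subset of S is closed when no generator in it shares a variable with one outside;
   component S v is the connected component, in the gcd graph on S, of the generators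
   involving x_v. *)
Definition closed_in S C := (C \subset S) && mcoprime (mS C) (mS (S :\: C)).

Definition component S v : {set 'I_N} :=
  [set i in S | [forall C : {set 'I_N}, closed_in S C && (0 < mS C v)%N ==> (i \in C)]].

Lemma closedI S C C' : closed_in S C -> closed_in S C' -> closed_in S (C :&: C').
Proof.
move=> /andP[CS h] /andP[CS' h']; rewrite /closed_in subIset ?CS //=.
rewrite setDIr mcoprimeC mcoprimeUl ![mcoprime _ (mS (_ :&: _))]mcoprimeC.
apply/andP; split; [apply: mcoprime_sub h | apply: mcoprime_sub h'];
  by rewrite ?subsetIl ?subsetIr.
Qed.

Lemma closed_full S : closed_in S S.
Proof.
by rewrite /closed_in subxx setDv mS0; apply/mcoprimeP => v; right; rewrite ffunE.
Qed.

Lemma closed_mem S C v i : closed_in S C -> (0 < mS C v)%N -> i \in S ->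
  (0 < gens i v)%N -> i \in C.
Proof.
move=> /andP[_ /mcoprimeP/(_ v) h] hC iS iv; apply: contraT => iC.
have : (0 < mS (S :\: C) v)%N.
  apply: leq_trans (iv) _; have iD : i \in S :\: C by rewrite inE iC.
  by have /mdivP := gens_le_mS iD.
by lia.
Qed.

Lemma component_min S C v : closed_in S C -> (0 < mS C v)%N -> component S v \subset C.
Proof.
by move=> h hv; apply/subsetP=> i; rewrite inE => /andP[_ /forallP/(_ C)]; rewrite h hv.
Qed.

Lemma component_sub S v : component S v \subset S.
Proof. by apply/subsetP => i; rewrite inE => /andP[]. Qed.

Lemma mem_component S v i : i \in S -> (0 < gens i v)%N -> i \in component S v.
Proof.
move=> iS iv; rewrite inE iS; apply/forallP => C; apply/implyP => /andP[hC hv].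
exact: closed_mem hC hv iS iv.
Qed.

Lemma component_pos S v : (0 < mS S v)%N -> (0 < mS (component S v) v)%N.
Proof.
move=> /mS_pos[i iS iv]; apply: leq_trans (iv) _.
by have /mdivP := gens_le_mS (mem_component iS iv).
Qed.

(** By [closedI], a closed set of least size involving x_v is contained in every other one, so the
    intersection defining [component] is attained. *)
Lemma component_closed S v : (0 < mS S v)%N -> closed_in S (component S v).
Proof.
move=> Sv; pose P := [pred C | closed_in S C && (0 < mS C v)%N].
have PS : P S by rewrite /= closed_full.
case: (arg_minnP (fun C : {set 'I_N} => #|C|) PS) => C /= /andP[hC Cv] minC.
suff -> : component S v = C by [].
apply/eqP; rewrite eqEsubset component_min //=; apply/subsetP=> i iC.
rewrite inE (subsetP (proj1 (andP hC))) //; apply/forallP=> C'; apply/implyP=> /andP[hC' Cv'].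
have hI := closedI hC hC'.
have [k kC kv] := mS_pos Cv.
have kI : k \in C :&: C'.
  by rewrite inE kC (closed_mem hC' Cv' _ kv) // (subsetP (proj1 (andP hC))).
have Iv : (0 < mS (C :&: C') v)%N.
  by apply: leq_trans (kv) _; have /mdivP := gens_le_mS kI.
have := minC (C :&: C'); rewrite hI Iv => /(_ isT) le.
have /eqP e : C :&: C' == C by rewrite eqEcard subsetIl.
by move: iC; rewrite -e inE => /andP[].
Qed.

Lemma componentU S T v : mcoprime (mS S) (mS T) -> (0 < mS T v)%N ->
  component (S :|: T) v = component T v.
Proof.
move=> cop Tv; have disj := coprime_disjoint cop.
have STv : (0 < mS (S :|: T) v)%N by rewrite mSU leq_max Tv orbT.
have /andP[CT cC] := component_closed Tv.
have cl : closed_in (S :|: T) (component T v).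
  rewrite /closed_in (subset_trans CT) ?subsetUr //= setDUl mcoprimeC mcoprimeUl.
  apply/andP; split; last by rewrite mcoprimeC.
  by apply: mcoprime_sub cop => //; rewrite subsetDl.
apply/eqP; rewrite eqEsubset component_min ?component_pos //=.
have /andP[_ cC'] := component_closed STv.
have sub : component (S :|: T) v \subset component T v by rewrite component_min ?component_pos.
apply: component_min; rewrite ?component_pos // /closed_in (subset_trans sub) //=.
by apply: mcoprime_sub cC' => //; rewrite setSD // subsetUr.
Qed.

Lemma component_id S v : (0 < mS S v)%N -> component (component S v) v = component S v.
Proof.
move=> Sv; have /andP[sub cop] := component_closed Sv.
have e : (S :\: component S v) :|: component S v = S.
  by rewrite setUC -[X in X :|: _](setIidPr sub) setID.
by rewrite -[in RHS]e componentU ?component_pos // mcoprimeC.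
Qed.

End Generators.

(** * The graphic rank of a set of generators *)

Section Rank.
Variables (n N : nat) (gens : 'I_N -> mon n).
Hypothesis gens2 : forall i, (2 <= mdeg (gens i))%N.
Implicit Types (S T C : {set 'I_N}) (v : 'I_n) (i : 'I_N).
Local Notation mS := (mS gens).

(** A common bound on all exponents makes the points (v, i) a finite type. *)
Let bnd := (\max_i mdeg (gens i)).+1.
Let pt := ('I_n * 'I_bnd)%type.
Let E := {ffun pt -> rat^o}.

Definition under (a : mon n) : pred pt := fun p => (p.2 < a p.1)%N.

Definition evec (p : pt) : E := [ffun q => (q == p)%:R].

(* A generator x^a becomes the complete graph on the points (v, i), i < a v; [rk S] is the
   rank of the union of these graphs, i.e. deg m_S minus the number of components of S. *)
Definition edges i : {vspace E} :=
  <<[seq evec p - evec q | p <- enum (under (gens i)), q <- enum (under (gens i))]>>%VS.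

Definition graph S : {vspace E} := (\sum_(i in S) edges i)%VS.

Definition rk S : nat := \dim (graph S).

Lemma gens_bnd i v : (gens i v < bnd)%N.
Proof.
rewrite ltnS; apply: leq_trans (leq_bigmax i).
by rewrite /mdeg (bigD1 v) //= leq_addr.
Qed.

Lemma mS_bnd S v : (mS S v < bnd)%N.
Proof. by rewrite ffunE ltnS; apply/bigmax_leqP => i _; rewrite -ltnS gens_bnd. Qed.

Lemma card_under (a : mon n) : (forall v, a v <= bnd)%N -> #|under a| = mdeg a.
Proof.
move=> ab; rewrite -sum1_card.
rewrite (eq_bigl (fun p : pt => xpredT p.1 && (p.2 < a p.1)%N)) //.
rewrite -(pair_big_dep xpredT (fun v (k : 'I_bnd) => (k < a v)%N) (fun _ _ => 1%N)) /=.
apply: eq_bigr => v _; rewrite sum1_card -[RHS](card_ord (a v)).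
rewrite -(card_image (f := widen_ord (ab v))); last by move=> i k /(congr1 val)/= /val_inj.
apply: eq_card => k; apply/idP/imageP => [lt|[i _ ->]]; last by rewrite unfold_in; apply: (ltn_ord i).
by exists (Ordinal lt) => //; apply: val_inj.
Qed.

(** These linear forms exclude vectors from [graph S]: each vanishes on all edges whose ends A does
    not separate. *)
Definition mass (A : pred pt) (f : E) : rat^o := \sum_(p | A p) f p.

Lemma mass_is_linear A : linear (mass A).
Proof.
move=> c f g; rewrite /mass scaler_sumr -big_split /=.
by apply: eq_bigr => p _; rewrite !ffunE.
Qed.
HB.instance Definition _ A := GRing.isLinear.Build rat E rat^o *:%R (mass A) (mass_is_linear A).

Lemma mass_evec A p : mass A (evec p) = (A p)%:R.
Proof.
rewrite /mass big_mkcond (bigD1 p) //= ffunE eqxx big1 ?addr0; first by case: (A p).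
by move=> q nq; rewrite ffunE (negPf nq); case: ifP.
Qed.

Lemma edges_mass A i : (forall p q, under (gens i) p -> under (gens i) q -> A p = A q) ->
  forall f, f \in edges i -> mass A f = 0.
Proof.
move=> h f fi; suff : (edges i <= lker (linfun (mass A)))%VS.
  by move/subvP/(_ _ fi); rewrite memv_ker lfunE /= => /eqP.
apply/span_subvP => _ /allpairsP[[p q] [/= hp hq ->]].
rewrite memv_ker lfunE /= linearB /= !mass_evec (h p q) ?subrr //.
  by move: hp; rewrite mem_enum.
by move: hq; rewrite mem_enum.
Qed.

Lemma graph_mass A S :
  (forall i p q, i \in S -> under (gens i) p -> under (gens i) q -> A p = A q) ->
  forall f, f \in graph S -> mass A f = 0.
Proof.
move=> h f /memv_sumP[fi hfi ->]; rewrite linear_sum big1 //= => i iS.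
by apply: (edges_mass (i := i)); [move=> p q; apply: h | apply: hfi].
Qed.

Lemma graph_supp S f p : f \in graph S -> f p != 0 -> under (mS S) p.
Proof.
move=> fS; apply: contraR => np.
have mp : mass (pred1 p) f = f p by rewrite /mass big_pred1_eq.
rewrite -mp; apply/eqP; apply: graph_mass fS => i q r iS hq hr /=.
have [/mdivP gi] := gens_le_mS gens iS.
have no s : under (gens i) s -> (s == p) = false.
  by move=> hs; apply: contraNF np => /eqP <-; apply: leq_trans hs _.
by rewrite !no.
Qed.

Lemma graph_sum0 S f : f \in graph S -> mass predT f = 0.
Proof. by apply: graph_mass. Qed.

Lemma graph_sub S T : S \subset T -> (graph S <= graph T)%VS.
Proof.
move=> /subsetP ST; apply/subv_sumP => i /ST iT; exact: (sumv_sup i).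
Qed.

Lemma graphU S T : graph (S :|: T) = (graph S + graph T)%VS.
Proof.
apply/eqP; rewrite eqEsubv subv_add !graph_sub ?subsetUl ?subsetUr // !andbT.
apply/subv_sumP => i; rewrite inE => /orP[] iS.
  by apply: subv_trans (addvSl _ _); apply: (sumv_sup i).
by apply: subv_trans (addvSr _ _); apply: (sumv_sup i).
Qed.

Lemma rk_sub S T : S \subset T -> (rk S <= rk T)%N.
Proof. by move=> /graph_sub; apply: dimvS. Qed.

Lemma rkU S T : (rk (S :|: T) <= rk S + rk T)%N.
Proof. by rewrite /rk graphU; apply: (leq_trans (dimv_add_leqif _ _)). Qed.

Lemma rk0 : rk set0 = 0%N.
Proof. by rewrite /rk /graph big_set0 dimv0. Qed.

Lemma mem_edges i p q : under (gens i) p -> under (gens i) q ->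
  evec p - evec q \in edges i.
Proof.
by move=> hp hq; apply/memv_span/allpairsP; exists (p, q); rewrite !mem_enum.
Qed.

Lemma mem_graph S i p q : i \in S -> under (gens i) p -> under (gens i) q ->
  evec p - evec q \in graph S.
Proof.
by move=> iS hp hq; apply: (subvP (sumv_sup i iS (subvv _))); apply: mem_edges.
Qed.

Lemma under_coprime a b p : mcoprime a b -> under a p -> under b p -> False.
Proof. by move=> /mcoprimeP/(_ p.1); rewrite /under; lia. Qed.

Lemma rk_coprime S T : mcoprime (mS S) (mS T) -> rk (S :|: T) = (rk S + rk T)%N.
Proof.
move=> cop; rewrite /rk graphU dimv_disjoint_sum //.
apply/eqP; rewrite -subv0; apply/subvP => f; rewrite memv_cap => /andP[fS fT].
rewrite memv0; apply/eqP/ffunP=> p; rewrite [RHS]ffunE; apply/eqP; apply: contraT => fp.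
by case: (under_coprime cop (graph_supp fS fp) (graph_supp fT fp)).
Qed.

Lemma evec_notin S p : evec p \notin graph S.
Proof. by apply: contraT => /negPn/graph_sum0; rewrite mass_evec => /eqP; rewrite oner_eq0. Qed.

Lemma dim_span_evec (A : pred pt) : \dim <<[seq evec p | p <- enum A]>>%VS = #|A|.
Proof.
apply/eqP; rewrite eqn_leq cardE -(size_map evec) dim_span /=.
suff fr : free [seq evec p | p <- enum A] by rewrite (eqP fr) leqnn.
set X := [seq _ | _ <- _]; have -> : X = in_tuple X by [].
apply/freeP => k k0 i.
have ltk l : (l < size X)%N -> (l < size (enum A))%N by rewrite size_map.
have [p0 _] : {p | p \in enum A}.
  by case: (enum A) ltk => [|p s] h; [have := h i (ltn_ord i) | exists p; rewrite mem_head].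
have := congr1 (mass (pred1 (nth p0 (enum A) i))) k0.
rewrite linear0 linear_sum (bigD1 i) //= linearZ /= big1 ?addr0.
  rewrite (nth_map p0) ?ltk // mass_evec /= eqxx => e.
  by rewrite -e; apply/esym/mulr1.
move=> l nl; rewrite linearZ /= (nth_map p0) ?ltk // mass_evec /=.
by rewrite nth_uniq ?enum_uniq ?ltk // (inj_eq val_inj) (negPf nl) scaler0.
Qed.

Lemma span_evecP (A : pred pt) (f : E) :
  (forall p, f p != 0 -> A p) -> f \in <<[seq evec p | p <- enum A]>>%VS.
Proof.
move=> h; have -> : f = \sum_(p | A p) f p *: evec p.
  apply/ffunP=> q; rewrite sum_ffunE.
  case Aq : (A q).
    rewrite (bigD1 q) //= !ffunE eqxx big1 ?addr0 => [|p /andP[_ np]]; first exact/esym/mulr1.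
    by rewrite !ffunE eq_sym (negPf np) scaler0.
  rewrite big1; first by apply/eqP; apply: contraFT Aq => /h.
  move=> p Ap; rewrite !ffunE; case: eqP => [e|_]; last exact: scaler0.
  by rewrite e Ap in Aq.
apply: memv_suml => p Ap; apply: memvZ; apply: memv_span.
by apply: map_f; rewrite mem_enum.
Qed.

(** Vectors of [graph S] have coordinate sum zero, whereas a point has sum one. *)
Lemma dim_cone S p : \dim (graph S + <[evec p]>)%VS = (rk S).+1.
Proof.
rewrite dimv_disjoint_sum; last first.
  apply/eqP; rewrite -subv0; apply/subvP => f; rewrite memv_cap => /andP[fS /vlineP[c fe]].
  move: fS; rewrite fe => /graph_sum0; rewrite linearZ /= mass_evec /= => /eqP.
  by rewrite scaler_eq0 oner_eq0 orbF => /eqP ->; rewrite scale0r memv0.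
rewrite dim_vline; suff -> : evec p != 0 by rewrite addn1.
by apply: contraNneq (evec_notin set0 p) => ->; rewrite mem0v.
Qed.

(** [graph S] and one of its points span a space of dimension rk S + 1 inside the span of the deg
    m_S points under m_S. *)
Lemma rk_lt S : S != set0 -> (rk S < mdeg (mS S))%N.
Proof.
move=> /set0Pn[i iS]; have [v iv] := gens_neq0 gens2 i.
have p0 : under (mS S) (v, @ord0 (bnd.-1)).
  by apply: leq_trans (iv) _; have /mdivP := gens_le_mS gens iS.
rewrite -(dim_cone S (v, ord0)) -card_under => [|u]; last exact/ltnW/mS_bnd.
rewrite -dim_span_evec; apply: dimvS; rewrite subv_add; apply/andP; split.
  by apply/subvP => f fS; apply: span_evecP => p; apply: graph_supp fS.
by rewrite -memvE memv_span // map_f // mem_enum.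
Qed.

Lemma rk_le S : (rk S <= mdeg (mS S))%N.
Proof. by case: (eqVneq S set0) => [->|/rk_lt/ltnW //]; rewrite rk0. Qed.

(** The generators having a point joined to p0 modulo [graph S] form a closed set, hence all of S;
    so [graph S] and p0 together span every point under m_S. *)
Lemma rk_connected S v : (0 < mS S v)%N -> component gens S v = S ->
  (rk S).+1 = mdeg (mS S).
Proof.
move=> Sv con; apply/eqP; rewrite eqn_leq rk_lt /=; last first.
  by have [i iS _] := mS_pos Sv; apply/set0Pn; exists i.
pose p0 : pt := (v, ord0).
rewrite -(dim_cone S p0) -card_under => [|u]; last exact/ltnW/mS_bnd.
rewrite -dim_span_evec; apply: dimvS; apply/span_subvP => _ /mapP[p pS ->].
rewrite mem_enum in pS.
suff : evec p - evec p0 \in graph S.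
  move=> h; rewrite -(subrK (evec p0) (evec p)); apply: memv_add => //.
  by rewrite memv_line.
pose C := [set i in S | [exists q, under (gens i) q && (evec q - evec p0 \in graph S)]].
have CP i q : i \in C -> under (gens i) q -> evec q - evec p0 \in graph S.
  rewrite inE => /andP[iS /existsP[r /andP[hr hr']]] hq.
  rewrite -(subrK (evec r) (evec q)) -addrA rpredD //.
  exact: mem_graph iS hq hr.
have clC : closed_in gens S C.
  rewrite /closed_in; apply/andP; split; first by apply/subsetP=> i; rewrite inE => /andP[].
  apply/mcoprimeP=> u; case: (posnP (mS C u)) => [|/mS_pos[i iC iu]]; first by left.
  case: (posnP (mS (S :\: C) u)) => [|/mS_pos[k]]; first by right.
  rewrite 2!inE => /andP[nkC kS] ku; case/negP: nkC; rewrite kS /=.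
  apply/existsP; exists (u, ord0); apply/andP; split; first exact: ku.
  exact: CP iC _.
have p0C : (0 < mS C v)%N.
  have [i iS iv] := mS_pos Sv; apply: leq_trans (iv) _.
  have iC : i \in C.
    rewrite inE iS; apply/existsP; exists p0; apply/andP; split; first exact: iv.
    by rewrite subrr mem0v.
  by have /mdivP := gens_le_mS gens iC.
have SC : S \subset C by rewrite -{1}con component_min.
have [i iS ip] : exists2 i, i \in S & under (gens i) p.
  move: pS; rewrite unfold_in /under => pS.
  case: (pickP (fun i => (i \in S) && (p.2 < gens i p.1)%N)) => [i /andP[]|none].
    by exists i.
  suff : (mS S p.1 <= p.2)%N by rewrite leqNgt pS.
  rewrite ffunE; apply/bigmax_leqP => i iS; rewrite leqNgt.
  by have := none i; rewrite iS => /negbT.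
exact: CP (subsetP SC i iS) ip.
Qed.

End Rank.

(** * Deletions that keep the rank *)

Section RankDeletion.
Variables (n N : nat) (gens : 'I_N -> mon n).
Hypothesis gens2 : forall i, (2 <= mdeg (gens i))%N.
Implicit Types (S T C : {set 'I_N}) (v : 'I_n) (i : 'I_N).
Local Notation mS := (mS gens).
Local Notation rk := (rk gens).

Definition tight S i := rk (S :\ i) == rk S.

(** Degree at least 2 supplies a second point, so the top point of generator i in direction v is the
    end of an edge. *)
Lemma two_points i v : (0 < gens i v)%N ->
  exists q : 'I_n * 'I_(\max_i mdeg (gens i)).+1, under (gens i) q /\
    (q.1 != v \/ (nat_of_ord q.2) != (gens i v).-1).
Proof.
move=> iv; case: (posnP (gens i v).-1) => [e|iv1]; last first.
  by exists (v, ord0); split; [| right; rewrite /= eq_sym -lt0n].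
case: (pickP (fun u => (u != v) && (0 < gens i u)%N)) => [u /andP[uv iu]|none].
  by exists (u, ord0); split => //; left.
have := gens2 i; rewrite /mdeg (bigD1 v) //= big1; first by lia.
by move=> u uv; move: (none u); rewrite uv /=; case: (gens i u).
Qed.

(** If the lcm dropped at v, the top point of generator i in direction v would lie outside m_(S -
    i). But an edge at this point lies in [graph S], which equals [graph (S - i)] by dimension. *)
Lemma tight_mS S i : i \in S -> tight S i -> mS (S :\ i) = mS S.
Proof.
move=> iS ti; have gE : graph gens (S :\ i) = graph gens S.
  by apply/eqP; rewrite eqEdim graph_sub ?subsetDl //= -/(rk S) -(eqP ti).
apply/ffunP=> v; apply/eqP; rewrite eqn_leq.
have /mdivP-> := mS_sub gens (subsetDl S [set i]); rewrite /= leqNgt.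
apply/negP => lt.
have iv : (mS (S :\ i) v < gens i v)%N.
  by move: lt; rewrite -{2}(setD1K iS) mSU !ffunE big_set1 leq_max; lia.
have i0 : (0 < gens i v)%N by lia.
have [q [hq nq]] := two_points i0.
have kb : ((gens i v).-1 < (\max_i mdeg (gens i)).+1)%N.
  by apply: leq_ltn_trans (gens_bnd gens i v); rewrite leq_pred.
pose p : 'I_n * 'I_(\max_i mdeg (gens i)).+1 := (v, Ordinal kb).
have hp : under (gens i) p by rewrite /under /= prednK.
have qp : (p == q) = false.
  by apply/eqP => e; move: nq; rewrite -e /= !eqxx; case.
have := mem_graph iS hp hq; rewrite -gE => /graph_supp -/(_ p).
rewrite !ffunE eqxx qp subr0 oner_eq0 => /(_ isT); rewrite /under /=.
by lia.
Qed.

Lemma tightU S T i : mcoprime (mS S) (mS T) -> i \in S -> tight (S :|: T) i = tight S i.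
Proof.
move=> cop iS; have iT : i \notin T by apply: contraL iS => iT;
  rewrite (disjointFl (coprime_disjoint gens2 cop)).
rewrite /tight setDUl (setDidPl _ : T :\ i = T); last by rewrite disjoint_sym disjoints1.
by rewrite !rk_coprime ?eqn_add2r //; apply: mcoprime_sub cop; rewrite ?subsetDl.
Qed.

(** Let C' be the component in S - i. The [mass] of the points under m_(C') vanishes on
    [graph (S - i)], which is [graph S], so the points of i lie all under m_(C') or all outside it.
    Adding i to C' in the former case gives a set closed in S, which therefore contains the
    component in S. *)
Lemma tight_component S i v : i \in S -> tight S i -> (0 < mS S v)%N ->
  mS (component gens (S :\ i) v) = mS (component gens S v) /\
  component gens (S :\ i) v = component gens S v :\ i.
Proof.
move=> iS ti Sv; have mE := tight_mS iS ti; set C := component gens S v.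
have := component_closed Sv; rewrite -/C => /andP[CS copC].
have mC : mS (C :\ i) = mS C.
  apply/ffunP=> u; apply/eqP; rewrite eqn_leq.
  have /mdivP-> /= := mS_sub gens (subsetDl C [set i]).
  case: (posnP (mS C u)) => [->//|Cu].
  have SC : mS S u = mS C u :> nat.
    have e : S = C :|: (S :\: C) by rewrite -[X in X :|: _](setIidPr CS) setID.
    by rewrite [in LHS]e mSU; have /mcoprimeP/(_ u) := copC; lia.
  have : mS (S :\ i) u = maxn (mS (C :\ i) u) (mS ((S :\: C) :\ i) u).
    by rewrite -mSU -setDUl -[X in X :|: _](setIidPr CS) setID.
  rewrite mE SC; have /mdivP/(_ u) := mS_sub gens (subsetDl (S :\: C) [set i]).
  by have /mcoprimeP/(_ u) := copC; lia.
have Siv : (0 < mS (S :\ i) v)%N by rewrite mE.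
set C' := component gens (S :\ i) v.
have := component_closed Siv; rewrite -/C' => /andP[CS' copC'].
suff e : C' = C :\ i by rewrite e.
apply/eqP; rewrite eqEsubset; apply/andP; split.
  apply: component_min; last by rewrite mC component_pos.
  rewrite /closed_in setSD //=; apply: mcoprime_sub copC; rewrite ?subsetDl //.
  by apply/subsetP => k; rewrite !inE; case: eqP; case: (k \in C).
have gE : graph gens (S :\ i) = graph gens S.
  by apply/eqP; rewrite eqEdim graph_sub ?subsetDl //= -/(rk S) -(eqP ti).
pose A (p : 'I_n * 'I_(\max_i mdeg (gens i)).+1) := under (mS C') p.
have same p q : under (gens i) p -> under (gens i) q -> A p = A q.
  move=> hp hq; have := mem_graph iS hp hq; rewrite -gE => /(graph_mass (A := A)).
  rewrite linearB /= !mass_evec => e.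
  have : (A p)%:R - (A q)%:R == 0 :> rat^o.
    apply/eqP/e => k r s; rewrite 2!inE => /andP[ki kS] hr hs.
    have kSi : k \in S :\ i by rewrite !inE ki.
    case: (boolP (k \in C')) => kC.
      have /mdivP h := gens_le_mS gens kC.
      by rewrite /A /under (leq_trans hr) // (leq_trans hs).
    have kD : k \in (S :\ i) :\: C' by rewrite inE kC.
    have /mdivP h := gens_le_mS gens kD.
    have no t : under (gens k) t -> A t = false.
      move=> ht; apply/negP => At; apply: (under_coprime (p := t) copC' At).
      exact: leq_trans ht (h _).
    by rewrite !no.
  by rewrite subr_eq0; case: (A p); case: (A q); rewrite // ?[_ == _]eq_sym oner_eq0.
have bnd u : (gens i u < (\max_i mdeg (gens i)).+1)%N by exact: gens_bnd.
pose C'' := if [exists u, (0 < gens i u)%N && (0 < mS C' u)%N] then i |: C' else C'.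
have C''S : C'' \subset S.
  rewrite /C''; case: ifP => _; rewrite ?subUset ?sub1set ?iS /=;
  exact: subset_trans CS' (subsetDl _ _).
have C'C'' : C' \subset C'' by rewrite /C''; case: ifP => _; rewrite ?subsetUr.
have cl : closed_in gens S C''.
  rewrite /closed_in C''S /= /C''; case: ifPn => [/existsP[u /andP[iu Cu]]|none].
    have gi : mdiv (gens i) (mS C').
      apply/mdivP => t; rewrite leqNgt; apply/negP => lt.
      have t0 : (0 < gens i t)%N by lia.
      have kb : ((gens i t).-1 < (\max_i mdeg (gens i)).+1)%N by have := bnd t; lia.
      have := same (t, Ordinal kb) (u, ord0); rewrite /A /under /= prednK // Cu iu.
      by move=> /(_ (leqnn _) isT); lia.
    have -> : S :\: (i |: C') = (S :\ i) :\: C' by rewrite setDDl.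
    apply/mcoprimeP => t; have /mcoprimeP/(_ t) := copC'.
    have -> : mS (i |: C') t = mS C' t; last by [].
    rewrite mSU [mS [set i] t]ffunE big_set1.
    by have /mdivP/(_ t) := gi; lia.
  have -> : S :\: C' = i |: ((S :\ i) :\: C').
    apply/setP=> k; rewrite !inE; by case: (eqVneq k i) => [->|]; rewrite ?iS ?andbT.
  rewrite mcoprimeC mcoprimeUl [X in _ && X]mcoprimeC copC' andbT.
  apply/mcoprimeP => t; rewrite ffunE big_set1.
  move: none; rewrite negb_exists => /forallP/(_ t).
  by case: (posnP (gens i t)); case: (posnP (mS C' t)); auto.
have : C \subset C''.
  apply: component_min => //; apply: leq_trans (component_pos Siv) _.
  by have /mdivP := mS_sub gens C'C''.
move=> /subsetP h; apply/subsetP => k; rewrite 2!inE => /andP[ki /h].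
by rewrite /C''; case: ifP => // _; rewrite !inE (negPf ki).
Qed.

(** By monotonicity of the rank both sides say that removing i and k together keeps it. This makes
    the tight deletions square to zero. *)
Lemma tight_comm S i k : i \in S -> k \in S -> i != k ->
  tight S i && tight (S :\ i) k = tight S k && tight (S :\ k) i.
Proof.
have sand (A : {set 'I_N}) j l : j \in A -> l \in A :\ j -> tight A j && tight (A :\ j) l = (rk (A :\ j :\ l) == rk A).
  move=> jA lA; rewrite /tight; have := rk_sub gens (subsetDl A [set j]).
  have := rk_sub gens (subsetDl (A :\ j) [set l]).
  by move: (rk _) (rk _) (rk _) => a b c; lia.
move=> iS kS nik; rewrite !sand // ?inE 1?eq_sym ?nik ?kS ?iS //; last by rewrite eq_sym nik.
by rewrite !setDDl setUC.
Qed.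

End RankDeletion.

Lemma big_disjointU (R : Type) (idx : R) (op : Monoid.com_law idx) (I : finType)
  (A B : {set I}) (F : I -> R) : [disjoint A & B] ->
  \big[op/idx]_(i in A :|: B) F i =
  op (\big[op/idx]_(i in A) F i) (\big[op/idx]_(i in B) F i).
Proof.
by move=> d; rewrite -bigU //; apply: eq_bigl => i; rewrite !inE.
Qed.

(** * The Taylor algebra *)

Section Signs.
Variables (K : fieldType) (N : nat).
Implicit Types (S T : {set 'I_N}) (i k : 'I_N).

(* e_S e_T = sg S T e_(S u T) in the exterior algebra, for S and T disjoint. *)
Definition sg S T : K := \prod_(i in S) \prod_(k in T) (if (k < i)%N then -1 else 1).

(** The sign of e_S after the shift by one in the bar construction. *)
Definition par S : K := (-1) ^+ #|S|.+1.

Lemma sgUl S S' T : [disjoint S & S'] -> sg (S :|: S') T = sg S T * sg S' T.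
Proof. by move=> d; rewrite /sg big_disjointU. Qed.

Lemma sgUr S T T' : [disjoint T & T'] -> sg S (T :|: T') = sg S T * sg S T'.
Proof.
by move=> d; rewrite /sg -big_split; apply: eq_bigr => i _; rewrite big_disjointU.
Qed.

Lemma sg_sq S T : sg S T * sg S T = 1.
Proof.
rewrite /sg -big_split big1 //= => i _; rewrite -big_split big1 //= => k _.
by case: ifP; rewrite ?mulrNN mulr1.
Qed.

Lemma sg1_comm i T : i \notin T -> sg [set i] T * sg T [set i] = (-1) ^+ #|T|.
Proof.
move=> iT; rewrite /sg big_set1 -prodr_const -big_split; apply: eq_bigr => k kT.
rewrite /= big_set1; case: ltngtP => [lt|lt|/val_inj e]; rewrite ?mulr1 ?mul1r //.
by rewrite -e kT in iT.
Qed.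

Lemma par_sq S : par S * par S = 1.
Proof. by rewrite /par -expr2 sqrr_sign. Qed.

Lemma parU S T : [disjoint S & T] -> par (S :|: T) = - (par S * par T).
Proof.
move=> d; rewrite /par cardsU (disjoint_setI0 d) cards0 subn0 -exprD.
by rewrite addnS addSn !exprS; ring.
Qed.

Lemma par_D1 S i : i \in S -> par (S :\ i) = - par S.
Proof. by move=> iS; rewrite /par [in RHS](cardsD1 i) iS add1n [in RHS]exprS mulN1r opprK. Qed.

End Signs.

Section Letters.
Variables (K : fieldType) (n N : nat).
Local Notation X := (mon n * {set 'I_N})%type.
Implicit Types (x y z : X) (S T : {set 'I_N}).
Local Notation sg := (@sg K N).

Definition lpar x : K := par K x.2.

(** A letter (u, S) stands for x^u / m_S times e_S. Recording the total multidegree u makes deletion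
    leave it fixed, without monomial coefficients. The predicate [ok] selects the deletions that are
    kept. *)
Definition ldel (ok : {set 'I_N} -> 'I_N -> bool) x : seq (K * X) :=
  [seq (sg [set i] (x.2 :\ i), (x.1, x.2 :\ i)) | i <- enum x.2 & ok x.2 i].

Definition prodl x y : X := (mplus x.1 y.1, x.2 :|: y.2).

(** The relation c is disjointness for the Taylor algebra, coprimality for the part of the product
    that splitting inverts. *)
Definition lmul (c : rel X) x y : seq (K * X) :=
  if c x y then [:: (sg x.2 y.2, prodl x y)] else [::].

Lemma lin_ldel ok x g : lin (ldel ok x) g =
  \sum_(i in x.2 | ok x.2 i) sg [set i] (x.2 :\ i) * g (x.1, x.2 :\ i).
Proof.
rewrite /lin /ldel big_map big_filter_cond big_enum_cond.
by apply: eq_bigl => i; rewrite andbT.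
Qed.

Lemma lin_lmul c x y g : lin (lmul c x y) g =
  if c x y then sg x.2 y.2 * g (prodl x y) else 0.
Proof. by rewrite /lin /lmul; case: (c x y); rewrite ?big_seq1 ?big_nil. Qed.

Lemma mem_ldel ok x p : p \in ldel ok x ->
  exists i, [/\ i \in x.2, ok x.2 i & p = (sg [set i] (x.2 :\ i), (x.1, x.2 :\ i))].
Proof.
by case/mapP => i; rewrite mem_filter mem_enum => /andP[h k] ->; exists i.
Qed.

Lemma mem_lmul c x y p : p \in lmul c x y -> c x y /\ p = (sg x.2 y.2, prodl x y).
Proof. by rewrite /lmul; case: (c x y); rewrite ?inE => // /eqP. Qed.

(** Deleting i and k in the two possible orders gives opposite signs; the hypothesis makes both
    orders occur or neither. *)
Lemma ldel_sq ok x g :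
  (forall S i k, i \in S -> k \in S -> i != k ->
     ok S i && ok (S :\ i) k = ok S k && ok (S :\ k) i) ->
  lin (ldel ok x) (fun y => lin (ldel ok y) g) = 0.
Proof.
move=> okC; case: x => u S; rewrite lin_ldel /=.
pose F i k := if ok S i && ok (S :\ i) k then
  sg [set i] (S :\ i) * sg [set k] (S :\ i :\ k) * g (u, S :\ i :\ k) else 0.
have -> : \sum_(i in S | ok S i) sg [set i] (S :\ i) * lin (ldel ok (u, S :\ i)) g =
    \sum_(p : 'I_N * 'I_N | [&& p.1 \in S, p.2 \in S & p.1 != p.2]) F p.1 p.2.
  rewrite -(pair_big_dep (mem S) (fun i k => (k \in S) && (i != k)) F) /=.
  rewrite [RHS](bigID (ok S)) /= [X in _ = _ + X]big1 ?addr0; last first.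
    by move=> i /andP[_ /negPf nok]; rewrite big1 // => k _; rewrite /F nok.
  apply: eq_bigr => i /andP[iS oki]; rewrite lin_ldel mulr_sumr /=.
  rewrite (eq_bigl (fun k => ((k \in S) && (i != k)) && ok (S :\ i) k)); last first.
    by move=> k; rewrite !inE eq_sym; case: (k \in S); rewrite ?andbF ?andbT.
  rewrite big_mkcondr; apply: eq_bigr => k _; rewrite /F oki /=.
  by case: ifP; rewrite ?mulrA.
rewrite (bigID (fun p : 'I_N * 'I_N => (p.1 < p.2)%N)) /=.
rewrite [X in _ + X](reindex_inj (h := fun p : 'I_N * 'I_N => (p.2, p.1))); last first.
  by move=> [a b] [c d] [-> ->].
rewrite [X in _ + X](eq_bigl (fun p : 'I_N * 'I_N => [&& p.1 \in S, p.2 \in S & p.1 != p.2] && (p.1 < p.2)%N)); last first.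
  move=> [i k] /=; case: (i \in S); case: (k \in S); rewrite //= eq_sym.
  by case: ltngtP => [||/val_inj ->]; rewrite ?eqxx ?andbF ?andbT.
rewrite -big_split big1 //= => -[i k] /= /andP[/and3P[iS kS nik] ltik].
rewrite /F okC //; case: ifP => _; last by rewrite addr0.
have e1 (a b : 'I_N) : a \in S -> b \in S -> a != b ->
    sg [set a] (S :\ a) = sg [set a] [set b] * sg [set a] (S :\ a :\ b).
  move=> aS bS nab; rewrite -sgUr ?setD1K ?inE 1?eq_sym ?nab //.
  by rewrite disjoints1 !inE eqxx.
rewrite (e1 i k) // (e1 k i) // 1?eq_sym // !setDDl [[set k] :|: _]setUC.
rewrite {1 4}/sg !big_set1 ltik ltnNge (ltnW ltik) /=; ring.
Qed.

Definition ldisj : rel X := fun x y => [disjoint x.2 & y.2].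

Lemma lmul_assoc (c : rel X) x y z g :
  (forall x y z, c x y && c (prodl x y) z = c y z && c x (prodl y z)) ->
  (forall x y, c x y -> ldisj x y) ->
  lin (lmul c x y) (fun u => lin (lmul c u z) g) =
  lin (lmul c y z) (fun u => lin (lmul c x u) g).
Proof.
move=> cA cd; rewrite !lin_lmul.
have := cA x y z; case: (boolP (c x y)) => cxy; case: (boolP (c y z)) => cyz //=.
- move=> e; rewrite -e; case: ifP => cxyz; rewrite ?mulr0 ?mulrA //.
  have dxy := cd _ _ cxy; have dyz := cd _ _ cyz.
  rewrite /= sgUl // sgUr //; congr (_ * g _); first ring.
  by rewrite /prodl /= mplusA setUA.
- by move=> ->; rewrite mulr0.
- by move=> <-; rewrite mulr0.
Qed.

Lemma ldisjA x y z : ldisj x y && ldisj (prodl x y) z = ldisj y z && ldisj x (prodl y z).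
Proof.
rewrite /ldisj /= -!setI_eq0 setIUl setIUr !setU_eq0.
by rewrite [RHS]andbC andbA.
Qed.

(** The delicate case is S and T sharing exactly one generator i: the product is zero, but the terms
    deleting i from S and from T both survive, and they cancel. With two or more shared generators
    every term vanishes. *)
Lemma ldel_leibniz x y g (dall := ldel (fun _ _ => true)) :
  lin (lmul ldisj x y) (fun z => lin (dall z) g) =
  lin (dall x) (fun x' => lin (lmul ldisj x' y) g)
  - lpar x * lin (dall y) (fun y' => lin (lmul ldisj x y') g).
Proof.
have linT z h : lin (dall z) h = \sum_(i in z.2) sg [set i] (z.2 :\ i) * h (z.1, z.2 :\ i).
  by rewrite lin_ldel; apply: eq_bigl => i; rewrite andbT.
rewrite lin_lmul !linT; case: x y => [u S] [v T] /=.
under [X in _ = X - _]eq_bigr do rewrite lin_lmul /ldisj /=.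
under [X in _ - _ * X]eq_bigr do rewrite lin_lmul /ldisj /=.
rewrite /prodl /= /ldisj /=.
case: ifP => [dST|/negbT nd].
  have S_T i : i \in S -> i \notin T by move=> iS; rewrite (disjointFr dST iS).
  have T_S i : i \in T -> i \notin S by move=> iT; rewrite (disjointFl dST iT).
  rewrite big_disjointU //= mulrDr; congr (_ + _).
    rewrite mulr_sumr; apply: eq_bigr => i iS.
    have dS : [disjoint S :\ i & T] by apply: disjointWl dST; rewrite subsetDl.
    rewrite dS setDUl [T :\ i](setDidPl _) ?[[disjoint T & _]]disjoint_sym ?disjoints1 ?S_T //.
    rewrite sgUr // -[in sg S T](setD1K iS) sgUl; last by rewrite disjoints1 !inE eqxx.
    by have := sg_sq K [set i] T; move: (sg _ T) => a h; ring: h.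
  rewrite mulr_sumr -mulrN -sumrN mulr_sumr; apply: eq_bigr => i iT.
  have dT : [disjoint S & T :\ i] by apply: disjointWr dST; rewrite subsetDl.
  rewrite dT setDUl [S :\ i](setDidPl _) ?[[disjoint S & [set i]]]disjoint_sym ?disjoints1 ?T_S //.
  rewrite sgUr // -[in sg S T](setD1K iT) sgUr; last by rewrite disjoints1 !inE eqxx.
  have /= := sg1_comm K (T_S _ iT); rewrite /lpar /par /= exprS => <-.
  have := sg_sq K S [set i]; move: (sg S [set i]) (sg [set i] S) => a b h; ring: h.
have [i /andP[iS iT]] : exists i, (i \in S) && (i \in T).
  by apply/existsP; apply: contraNT nd; rewrite negb_exists => /forallP h;
     apply/pred0P => i; apply: negbTE (h i).
have nS k : k != i -> [disjoint S :\ k & T] = false.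
  move=> ki; apply/negbTE; rewrite -setI_eq0; apply/set0Pn; exists i.
  by rewrite !inE eq_sym ki iS.
have nT k : k != i -> [disjoint S & T :\ k] = false.
  move=> ki; apply/negbTE; rewrite -setI_eq0; apply/set0Pn; exists i.
  by rewrite !inE eq_sym ki iS.
rewrite (bigD1 i) //= big1 ?addr0; last by move=> k /andP[_ /nS ->]; rewrite mulr0.
rewrite (bigD1 i) //= big1 ?addr0; last by move=> k /andP[_ /nT ->]; rewrite mulr0.
have -> : [disjoint S & T :\ i] = [disjoint S :\ i & T].
  rewrite -!setI_eq0; congr (_ == set0); apply/setP => k; rewrite !inE.
  by rewrite andbCA andbA.
case: ifP => d; last by rewrite !mulr0 subr0.
have -> : S :\ i :|: T = S :|: T.
  by rewrite -[in RHS](setD1K iS) setUAC [i |: T](setUidPr _) ?sub1set // setUC.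
have -> : S :|: T :\ i = S :|: T.
  by rewrite -[in RHS](setD1K iT) setUA [S :|: [set i]](setUidPl _) ?sub1set.
have iSi : i \notin S :\ i by rewrite !inE eqxx.
have iTi : i \notin T :\ i by rewrite !inE eqxx.
rewrite -[in sg (S :\ i) T](setD1K iT) sgUr ?disjoints1 //.
rewrite -[in sg S (T :\ i)](setD1K iS) sgUl ?disjoints1 //.
have := sg1_comm K iSi; rewrite /lpar /par /= (cardsD1 i S) iS add1n !exprS => <-.
by have := sg_sq K [set i] (T :\ i); move: (sg [set i] (T :\ i)) => a h; ring: h.
Qed.

End Letters.

(** * Weights of letters and their atoms *)

Section Words.
Variables (K : fieldType) (n N : nat) (gens : 'I_N -> mon n).
Hypothesis gens2 : forall i, (2 <= mdeg (gens i))%N.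
Local Notation X := (mon n * {set 'I_N})%type.
Local Notation mS := (mS gens).
Local Notation rk := (rk gens).
Implicit Types (x y z : X) (w : seq X) (S T : {set 'I_N}) (v : 'I_n).

(** The letters span the augmentation ideal, hence the exclusion of the constant monomial. *)
Definition lvalid x := (x.1 != mzero n) && mdiv (mS x.2) x.1.
Definition cop x y := mcoprime (mS x.2) (mS y.2).
Definition wgt x : nat := (mdeg x.1 - rk x.2)%N.
Definition exc x v : nat := (x.1 v - mS x.2 v)%N.

Lemma cop_disj x y : cop x y -> ldisj x y.
Proof. exact: coprime_disjoint. Qed.

Lemma lvalid_prodl x y : lvalid x -> lvalid y -> lvalid (prodl x y).
Proof.
move=> /andP[x0 /mdivP hx] /andP[y0 /mdivP hy]; apply/andP; split.
  by move: x0; rewrite -!mdeg_eq0 mdeg_plus addn_eq0 => /negPf->.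
by apply/mdivP => v; rewrite mSU mplusE geq_max; have := hx v; have := hy v; lia.
Qed.

Lemma wgt_ge1 x : lvalid x -> (0 < wgt x)%N.
Proof.
case: x => u S /andP[/= u0 hu]; rewrite subn_gt0 /=.
case: (eqVneq S set0) => [->|/(rk_lt gens2) lt]; last exact: leq_trans lt (mdeg_le hu).
by rewrite rk0 lt0n mdeg_eq0.
Qed.

Lemma rk_le_mdeg x : lvalid x -> (rk x.2 <= mdeg x.1)%N.
Proof. by move=> /andP[_ /mdeg_le]; apply: leq_trans; apply: rk_le. Qed.

Lemma wgt_prodl x y : lvalid x -> lvalid y -> cop x y -> wgt (prodl x y) = (wgt x + wgt y)%N.
Proof.
move=> /rk_le_mdeg hx /rk_le_mdeg hy c; rewrite /wgt /= mdeg_plus rk_coprime //.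
lia.
Qed.

Lemma wgt_prodl_ge x y : lvalid x -> lvalid y -> (wgt x + wgt y <= wgt (prodl x y))%N.
Proof.
move=> /rk_le_mdeg hx /rk_le_mdeg hy; rewrite /wgt /= mdeg_plus.
have := rkU gens x.2 y.2; lia.
Qed.

Lemma exc_prodl x y v : lvalid x -> lvalid y -> cop x y ->
  exc (prodl x y) v = (exc x v + exc y v)%N.
Proof.
move=> /andP[_ /mdivP/(_ v) hx] /andP[_ /mdivP/(_ v) hy] /mcoprimeP/(_ v) c.
by rewrite /exc /= mplusE mSU; lia.
Qed.

(* The atom split off a letter: the variable x_v in mode (true, v), the component
   containing v in mode (false, v). *)
Definition mode := (bool * 'I_n)%type.
Implicit Type m : mode.

Definition evar v : mon n := [ffun u => nat_of_bool (u == v)].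

Definition atom m x : X :=
  if m.1 then (evar m.2, set0)
  else (mS (component gens x.2 m.2), component gens x.2 m.2).

Definition rest m x : X := (msub x.1 (atom m x).1, x.2 :\: (atom m x).2).

Definition carries m x : bool := if m.1 then (0 < exc x m.2)%N else (0 < mS x.2 m.2)%N.

(** Comparing degrees is enough: by [alone_atom] the letter then equals its atom. *)
Definition alone m x : bool := x.1 == (atom m x).1.

Lemma mdeg_evar v : mdeg (evar v) = 1%N.
Proof.
rewrite /mdeg (bigD1 v) //= ffunE eqxx big1 // => u uv.
by rewrite ffunE (negPf uv).
Qed.

Lemma evarE v u : evar v u = nat_of_bool (u == v). Proof. by rewrite ffunE. Qed.

Lemma atom_sub m x : carries m x -> (atom m x).2 \subset x.2.
Proof. by rewrite /atom; case: m.1 => _; rewrite ?sub0set ?component_sub. Qed.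

Lemma mS_split m x : carries m x -> x.2 = (rest m x).2 :|: (atom m x).2.
Proof.
by move=> h; rewrite /rest /= setUC -[X in X :|: _](setIidPr (atom_sub h)) setID.
Qed.

Lemma cop_rest m x : carries m x -> cop (rest m x) (atom m x).
Proof.
rewrite /cop /rest /atom /carries; case: m => -[] v /= h.
  by rewrite mS0; apply/mcoprimeP => u; right; rewrite ffunE.
by have /andP[_] := component_closed h; rewrite mcoprimeC.
Qed.

Lemma atom_le m x : lvalid x -> carries m x -> mdiv (atom m x).1 x.1.
Proof.
move=> /andP[_ /mdivP hx]; rewrite /carries /atom /exc; case: m => -[] v /= h.
  by apply/mdivP => u; rewrite evarE; case: eqP => [->|//] /=; lia.
by apply: mdiv_trans (mS_sub _ (component_sub _ _ _)) _; apply/mdivP.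
Qed.

Lemma prodl_rest m x : lvalid x -> carries m x -> prodl (rest m x) (atom m x) = x.
Proof.
move=> vx h; case: x vx h => u S vx h; rewrite /prodl -mS_split //=; congr (_, _).
by rewrite mplusC mplus_sub // (atom_le vx h).
Qed.

Lemma lvalid_atom m x : carries m x -> lvalid (atom m x).
Proof.
rewrite /lvalid /carries /atom; case: m => -[] v /= h.
  by rewrite mS0 mdiv0 -mdeg_eq0 mdeg_evar.
rewrite mdivv andbT; apply/eqP => /(congr1 (fun a : mon n => a v)) e.
by have := component_pos h; rewrite e ffunE.
Qed.

Lemma wgt_atom m x : carries m x -> wgt (atom m x) = 1%N.
Proof.
rewrite /wgt /carries /atom; case: m => -[] v /= h; first by rewrite mdeg_evar rk0.
have := rk_connected gens2 (component_pos h) (component_id gens2 h).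
by move=> <-; rewrite subSnn.
Qed.

Lemma alone_atom m x : lvalid x -> carries m x -> alone m x -> atom m x = x.
Proof.
move=> /andP[_ /mdivP vx] h /eqP e; rewrite {2}[x]surjective_pairing e [LHS]surjective_pairing.
congr (_, _); apply/eqP; rewrite eqEsubset atom_sub //=.
suff : x.2 :\: (atom m x).2 = set0 by move/eqP; rewrite setD_eq0.
apply: (mS_eq0 gens2); apply/ffunP => u; rewrite [RHS]ffunE.
have := cop_rest h; rewrite /cop /rest /= => /mcoprimeP/(_ u).
have /mdivP/(_ u) := mS_sub gens (subsetDl x.2 (atom m x).2); have := vx u.
rewrite e; move: h e; rewrite /carries /atom /exc; case: m => -[] v /= h e.
  rewrite setD0; move: h; rewrite e !evarE eqxx.
  by case: (eqVneq u v) => [->|]; lia.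
by lia.
Qed.

Lemma lvalid_rest m x : lvalid x -> carries m x -> ~~ alone m x -> lvalid (rest m x).
Proof.
move=> vx h na; have ax := atom_le vx h; apply/andP; split.
  apply: contra na; rewrite /rest /= => /eqP e; apply/eqP.
  by rewrite -(mplus_sub ax) e mplusC mplus0.
have := cop_rest h; rewrite /cop => /mcoprimeP c.
have /andP[_ /mdivP vx'] := vx.
apply/mdivP => u; have /mdivP/(_ u) := ax; have := vx' u; have := c u.
rewrite {1}(mS_split h) mSU /rest /= msubE.
move: h; rewrite /carries /atom /exc; case: m {na ax c} => -[] v /= h.
  rewrite mS0 evarE [mzero n u]ffunE setD0; case: (eqVneq u v) => [->|]; lia.
by lia.
Qed.

Lemma wgt_rest m x : lvalid x -> carries m x -> ~~ alone m x ->
  wgt x = (wgt (rest m x)).+1.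
Proof.
move=> vx h na; rewrite -{1}(prodl_rest vx h) wgt_prodl ?cop_rest ?lvalid_rest ?lvalid_atom //.
by rewrite wgt_atom // addn1.
Qed.

Lemma wgt_alone m x : lvalid x -> carries m x -> alone m x -> wgt x = 1%N.
Proof. by move=> vx h /(alone_atom vx h) <-; rewrite wgt_atom. Qed.

Lemma carries_prodl m x y : lvalid x -> lvalid y -> cop x y ->
  carries m (prodl x y) = carries m x || carries m y.
Proof.
move=> vx vy c; rewrite /carries; case: m => -[] v /=; first by rewrite exc_prodl // addn_gt0.
by rewrite mSU leq_max.
Qed.

Lemma atom_prodl m x y : cop x y -> carries m y -> atom m (prodl x y) = atom m y.
Proof. by rewrite /atom /carries; case: m => -[] v //= c h; rewrite componentU. Qed.

Lemma copC x y : cop x y = cop y x.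
Proof. exact: mcoprimeC. Qed.

Lemma rest_prodl m x y : lvalid y -> cop x y -> carries m y -> alone m y -> rest m (prodl x y) = x.
Proof.
move=> vy c h a; rewrite /rest atom_prodl // (alone_atom vy) //.
case: x c => u S /cop_disj/= d; rewrite mplusC msub_plus; congr (_, _).
by rewrite setDUl setDv setU0; apply/setDidPl.
Qed.

End Words.
Arguments atom : simpl never.
Arguments rest : simpl never.

Lemma ltn_double_addr a b : (0 < a -> 1 < 2 * a + b)%N.
Proof. lia. Qed.

Lemma ltn_double_pred a b c : (a.+1 = b + c -> 1 < c -> 2 * b + 1 < 2 * a)%N.
Proof. lia. Qed.

(** * Splitting one located letter, as a triangular homotopy *)

Section Contraction.
Variables (K : fieldType) (n N : nat) (gens : 'I_N -> mon n).
Hypothesis gens2 : forall i, (2 <= mdeg (gens i))%N.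
Local Notation X := (mon n * {set 'I_N})%type.
Local Notation mS := (mS gens).
Local Notation lpar := (@lpar K n N).
Local Notation sg := (@sg K N).
Local Notation lvalid := (lvalid gens).
Local Notation cop := (cop gens).
Local Notation wgt := (wgt gens).
Local Notation exc := (exc gens).
Local Notation atom := (atom gens).
Local Notation rest := (rest gens).
Local Notation carries := (carries gens).
Local Notation alone := (alone gens).
Implicit Types (x y z : X) (w : seq X) (S T : {set 'I_N}) (v : 'I_n) (m : mode n).
Implicit Type f : seq X -> K.

Definition wdeg w : mon n := foldr (fun x a => mplus x.1 a) (mzero n) w.
Definition wsum (F : X -> nat) w : nat := sumn (map F w).
Definition lexp x : nat := mdeg (mS x.2).
Definition lcard x : nat := #|x.2|.
Definition wexc w v : nat := wsum (exc^~ v) w.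

(* In mode (true, v) the located letter is the last one divisible by x_v beyond m_S, in
   mode (false, v) the first one whose m_S involves x_v. *)
Definition here m x w : bool := carries m x && (m.1 ==> (wexc w m.2 == 0%N)).

(** The lcm of the component to which [init] refers. *)
Fixpoint lab v w : mon n :=
  if w is x :: w' then
    if (0 < mS x.2 v)%N then mS (component gens x.2 v) else lab v w'
  else mzero n.

(* The component of v in the first letter involving v commutes with all earlier letters. *)
Fixpoint init v w : bool :=
  if w is x :: w' then
    (0 < mS x.2 v)%N || (init v w' && mcoprime (lab v w') (mS x.2))
  else false.

Definition located m w : bool := if m.1 then (0 < wexc w m.2)%N else init m.2 w.

Definition same_loc w w' : Prop :=
  forall v, [/\ wexc w' v = wexc w v, init v w' = init v w & lab v w' = lab v w].

(** The invariants common to merging two coprime letters and splitting off an atom; these operations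
    change the number of letters but none of this data. *)
Definition eqv w w' : Prop :=
  [/\ wdeg w' = wdeg w, wsum wgt w' = wsum wgt w, wsum lexp w' = wsum lexp w,
      wsum lcard w' = wsum lcard w & same_loc w w'].

Lemma wsum_cons F x w : wsum F (x :: w) = (F x + wsum F w)%N.
Proof. by []. Qed.

Lemma wexc_cons x w v : wexc (x :: w) v = (exc x v + wexc w v)%N.
Proof. by []. Qed.

Lemma eqv_refl w : eqv w w. Proof. by split. Qed.

Lemma eqv_trans w2 w1 w3 : eqv w1 w2 -> eqv w2 w3 -> eqv w1 w3.
Proof.
move=> [a b c d e] [a' b' c' d' e']; split; rewrite ?a' ?b' ?c' ?d' // => v.
by have [-> -> ->] := e' v; apply: e.
Qed.

Lemma eqv_sym w w' : eqv w w' -> eqv w' w.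
Proof. by move=> [a b c d e]; split=> // v; have [-> -> ->] := e v. Qed.

Lemma eqv_cons x w w' : eqv w w' -> eqv (x :: w) (x :: w').
Proof.
move=> [a b c d e]; rewrite /eqv !wsum_cons /= a b c d; split=> // v.
by rewrite !wexc_cons /=; have [-> -> ->] := e v.
Qed.

Lemma eqv_merge x y w : lvalid x -> lvalid y -> cop x y ->
  eqv [:: x, y & w] (prodl x y :: w).
Proof.
move=> vx vy c; have cC := c; rewrite copC in cC.
rewrite /eqv !wsum_cons /= mplusA wgt_prodl // addnA; split=> //.
- by rewrite /lexp /= mS_plus // mdeg_plus addnA.
- by rewrite /lcard /= cardsU (disjoint_setI0 (cop_disj gens2 c)) cards0 subn0 addnA.
move=> v; rewrite !wexc_cons exc_prodl // addnA /= mSU leq_max; split=> //.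
  case: (posnP (mS x.2 v)) => //= x0; case: (posnP (mS y.2 v)) => /= y0.
    rewrite [mcoprime (lab v w) (mS (_ :|: _))]mcoprimeC mcoprimeUl.
    by rewrite ![mcoprime _ (lab v w)]mcoprimeC -andbA [X in _ = _ && X]andbC.
  by apply/esym; have /andP[sub _] := component_closed y0; apply: mcoprime_sub cC.
case: (posnP (mS x.2 v)) => [x0|x0] /=; last first.
  by rewrite setUC componentU.
by case: (posnP (mS y.2 v)) => //= y0; rewrite componentU.
Qed.

Lemma eqv_split m x w : lvalid x -> carries m x -> ~~ alone m x ->
  eqv (x :: w) [:: rest m x, atom m x & w].
Proof.
move=> vx h na; have := eqv_merge w (lvalid_rest vx h na) (lvalid_atom h) (cop_rest h).
by rewrite prodl_rest //; apply: eqv_sym.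
Qed.

Lemma eqv_located m w w' : eqv w w' -> located m w' = located m w.
Proof. by move=> [_ _ _ _ /(_ m.2)]; rewrite /located => -[-> -> _]. Qed.

Lemma same_loc_here m x w w' : same_loc w w' -> here m x w' = here m x w.
Proof. by move=> /(_ m.2); rewrite /here => -[-> _ _]. Qed.

Lemma eqv_here m x w w' : eqv w w' -> here m x w' = here m x w.
Proof. by case=> _ _ _ _; apply: same_loc_here. Qed.

Lemma same_loc_cons x w w' : same_loc w w' -> same_loc (x :: w) (x :: w').
Proof. by move=> e v; rewrite !wexc_cons /=; have [-> -> ->] := e v. Qed.

Lemma located_cons m x w : located m (x :: w) -> ~~ here m x w -> located m w.
Proof.
rewrite /located /here /carries; case: m => -[] v /=; last by rewrite andbT => /orP[->|/andP[]].
by rewrite !wexc_cons; lia.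
Qed.

Lemma here_prodl m x y w : lvalid x -> lvalid y -> cop x y ->
  here m (prodl x y) w = here m x (y :: w) || here m y w.
Proof.
move=> vx vy c; rewrite /here carries_prodl // /carries; case: m => -[] v /=; rewrite ?andbT //.
by rewrite !wexc_cons; lia.
Qed.

Lemma here_rest m x w : lvalid x -> carries m x -> ~~ here m (rest m x) (atom m x :: w).
Proof.
move=> vx h; have := cop_rest h; move: h; rewrite /here /cop /carries /atom; case: m => -[] v h /=.
  rewrite wexc_cons /exc /= mS0 evarE eqxx [mzero n v]ffunE.
  by rewrite addn_eq0 andbF.
move=> /mcoprimeP/(_ v); have := component_pos h; rewrite andbT => /=; lia.
Qed.

Lemma carries_atom m x : carries m x -> carries m (atom m x).
Proof.
rewrite /carries /atom; case: m => -[] v /= h; last exact: component_pos.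
by rewrite /exc /= mS0 evarE eqxx [mzero n v]ffunE.
Qed.

Lemma atom_atom m x : carries m x -> atom m (atom m x) = atom m x.
Proof.
rewrite /carries /atom; case: m => -[] v //= h.
by rewrite component_id.
Qed.

Lemma here_atom m x w : here m x w -> here m (atom m x) w.
Proof. by case/andP => h hw; rewrite /here carries_atom. Qed.

Lemma alone_atom2 m x : carries m x -> alone m (atom m x).
Proof. by move=> h; rewrite /alone atom_atom. Qed.

(** Twice the weight standing before the located letter, plus one if that letter can still be split.
    The homotopy is triangular for this order. On valid words a value above 1 means that the first
    letter is not the located one. *)
Fixpoint psi m w : nat :=
  if w is x :: w' then
    if here m x w' then nat_of_bool (~~ alone m x) else (2 * wgt x + psi m w')%N
  else 0%N.

Lemma psi_here m x w : here m x w -> psi m (x :: w) = nat_of_bool (~~ alone m x).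
Proof. by move=> /= ->. Qed.

Lemma psi_nhere m x w : ~~ here m x w -> psi m (x :: w) = (2 * wgt x + psi m w)%N.
Proof. by move=> /= /negPf->. Qed.

Lemma psi_split m x w : lvalid x -> here m x w ->
  psi m [:: rest m x, atom m x & w] = (2 * wgt (rest m x))%N.
Proof.
move=> vx h; have /andP[hx _] := h.
rewrite psi_nhere ?here_rest // psi_here ?here_atom //.
by rewrite alone_atom2 // addn0.
Qed.

(** The coefficient with which the differential merges rest and atom back; being a sign, it is its
    own inverse. *)
Definition eps m x : K := lpar (rest m x) * sg (rest m x).2 (atom m x).2.

(** The rest is placed before the atom so that the atom is the located letter of the new word: a
    variable stays the last one of its kind, and the rest of a component no longer involves v. *)
Fixpoint spf m f w : K :=
  if w is x :: w' then
    if here m x w' then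
      if alone m x then 0 else eps m x * f [:: rest m x, atom m x & w']
    else lpar x * spf m (fun w1 => f (x :: w1)) w'
  else 0.

Lemma spf_here m f x w : here m x w -> ~~ alone m x ->
  spf m f (x :: w) = eps m x * f [:: rest m x, atom m x & w].
Proof. by move=> /= -> /negPf->. Qed.

Lemma spf_alone m f x w : here m x w -> alone m x -> spf m f (x :: w) = 0.
Proof. by move=> /= -> ->. Qed.

Lemma spf_nhere m f x w : ~~ here m x w ->
  spf m f (x :: w) = lpar x * spf m (fun w1 => f (x :: w1)) w.
Proof. by move=> /= /negPf->. Qed.

Lemma spf_local m w f g : all lvalid w -> located m w ->
  (forall w', all lvalid w' -> eqv w w' -> size w' = (size w).+1 ->
     (psi m w < psi m w')%N -> (1 < psi m w')%N -> f w' = g w') ->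
  spf m f w = spf m g w.
Proof.
elim: w f g => [//|x w IHw] f g /= /andP[vx vw] loc fg.
case: ifP => hx; last first.
  congr (_ * _); apply: IHw => //; first by apply: located_cons loc _; rewrite hx.
  move=> w' vw' ew' sw' lt lt1; have nh : ~~ here m x w' by rewrite (eqv_here _ _ ew') hx.
  apply: fg; rewrite ?psi_nhere //=; first by rewrite vx.
  - exact: eqv_cons.
  - by rewrite sw'.
  - by rewrite hx ltn_add2l.
  - by rewrite ltn_addl.
case: ifP => // /negbT na; congr (_ * _); have /andP[h _] := hx.
have vr := lvalid_rest vx h na; have va := lvalid_atom h.
have p := psi_split vx hx; have w1 := wgt_ge1 gens2 vr.
by apply: fg; rewrite ?p //=; [rewrite vr va | exact: eqv_split | rewrite hx na; lia | lia].
Qed.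

Lemma spf0 m w f : all lvalid w -> located m w ->
  (forall w', all lvalid w' -> eqv w w' -> size w' = (size w).+1 ->
     (psi m w < psi m w')%N -> (1 < psi m w')%N -> f w' = 0) ->
  spf m f w = 0.
Proof.
have z : spf m (fun=> 0) w = 0.
  by elim: w => //= x w ->; case: ifP => _; [case: ifP => _|]; rewrite ?mulr0.
by move=> vw lw h; rewrite (spf_local (g := fun=> 0)).
Qed.

Lemma spfZ m c f w : spf m (fun w => c * f w) w = c * spf m f w.
Proof.
elim: w f => [|x w IHw] f /=; first by rewrite mulr0.
by rewrite IHw; do 2?case: ifP => _; ring.
Qed.

Lemma spfD m f g w : spf m (fun w => f w + g w) w = spf m f w + spf m g w.
Proof.
elim: w f g => [|x w IHw] f g /=; first by rewrite addr0.
by rewrite IHw; do 2?case: ifP => _; ring.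
Qed.

Definition Dcop f w : K := bard (fun=> [::]) (lmul K cop) lpar f w.

Definition junc x w f : K := if w is y :: w' then lin (lmul K cop x y) (fun z => f (z :: w')) else 0.

Lemma Dcop_cons f x w :
  Dcop f (x :: w) = lpar x * (junc x w f + Dcop (fun w1 => f (x :: w1)) w).
Proof. by rewrite /Dcop /= {1}/lin big_nil oppr0 add0r. Qed.

Lemma junc_cons x y w f :
  junc x (y :: w) f = if cop x y then sg x.2 y.2 * f (prodl x y :: w) else 0.
Proof. exact: lin_lmul. Qed.

Lemma Dcop_local w f g : all lvalid w ->
  (forall w', all lvalid w' -> eqv w w' -> size w = (size w').+1 -> f w' = g w') ->
  Dcop f w = Dcop g w.
Proof.
move=> vw fg; pose R w w' := all lvalid w -> [/\ all lvalid w', eqv w w' & size w = (size w').+1].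
apply: (bard_local lpar (R := R)) => //.
- move=> x y w' p /mem_lmul[c ->] /= /and3P[vx vy vw'].
  by split=> //; [rewrite /= lvalid_prodl | apply: eqv_merge].
- move=> x w1 w2 h /= /andP[vx /h[v2 e2 s2]].
  by split; [rewrite /= vx | apply: eqv_cons | rewrite /= s2].
- by move=> w' /(_ vw)[]; apply: fg.
Qed.

Lemma Dcop0 w f : all lvalid w ->
  (forall w', all lvalid w' -> eqv w w' -> size w = (size w').+1 -> f w' = 0) ->
  Dcop f w = 0.
Proof. by move=> vw h; rewrite (Dcop_local (g := fun=> 0)) //; apply: bard0. Qed.

Lemma eps_unit m x : carries m x -> eps m x * (lpar (rest m x) * sg (rest m x).2 (atom m x).2) = 1.
Proof.
move=> h; rewrite /eps mulrACA /lpar par_sq mul1r sg_sq //.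
Qed.

Definition front_alone m w : bool := if w is x :: w' then here m x w' && alone m x else false.

Lemma here_carries m x w : here m x w -> carries m x. Proof. by case/andP. Qed.

Lemma wgt_ge2 m x w : lvalid x -> here m x w -> ~~ alone m x -> (1 < wgt x)%N.
Proof.
move=> vx /here_carries h na; rewrite (wgt_rest gens2 vx h na) ltnS.
by apply: wgt_ge1 => //; apply: lvalid_rest.
Qed.

Lemma alone_prodl m x y : carries m (prodl x y) -> lvalid x -> lvalid y -> cop x y ->
  ~~ alone m (prodl x y).
Proof.
move=> h vx vy c; apply/negP => /(wgt_alone gens2 (lvalid_prodl vx vy) h).
by rewrite wgt_prodl //; have := wgt_ge1 gens2 vx; have := wgt_ge1 gens2 vy; lia.
Qed.

Lemma nhere_eqv m x y w w' : eqv (y :: w) w' -> ~~ here m x (y :: w) -> ~~ here m x w'.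
Proof. by move=> /(eqv_here m x) ->. Qed.

Lemma here_located m x w : here m x w -> located m (x :: w).
Proof.
rewrite /located /here /carries; case: m => -[] v /=; rewrite ?wexc_cons ?andbT; last by move=> ->.
by case/andP; lia.
Qed.

(** Splitting x and merging the two pieces returns the word. All other terms lead to words whose
    located letter is not in front, hence with [psi] above 1, where f vanishes. *)
Lemma contract_head m x w f : all lvalid (x :: w) -> here m x w -> ~~ alone m x ->
  (forall w', all lvalid w' -> eqv (x :: w) w' -> size w' = (size w).+1 ->
     (1 < psi m w')%N -> f w' = 0) ->
  spf m (Dcop f) (x :: w) + Dcop (spf m f) (x :: w) = f (x :: w).
Proof.
move=> vxw hx na f0; have /andP[vx vw] := vxw.
have h := here_carries hx; have vr := lvalid_rest vx h na; have va := lvalid_atom h.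
have c := cop_rest h; have w1 := wgt_ge1 gens2 vr.
have es := eqv_split w vx h na.
rewrite spf_here // Dcop_cons.
have -> : Dcop (fun w1 => f (rest m x :: w1)) (atom m x :: w) = 0.
  apply: Dcop0; first by rewrite /= va.
  move=> w' vw' ew' /= [sw']; apply: f0; rewrite /= ?vr //.
  + by apply: eqv_trans es _; apply: eqv_cons.
  + by rewrite sw'.
  + have := here_rest w vx h; rewrite -(eqv_here _ _ ew') => /negPf->.
    exact: ltn_double_addr.
rewrite addr0 junc_cons c prodl_rest //.
have -> : eps m x * (lpar (rest m x) * (sg (rest m x).2 (atom m x).2 * f (x :: w))) = f (x :: w).
  by rewrite [lpar _ * _]mulrA mulrA eps_unit // mul1r.
suff -> : Dcop (spf m f) (x :: w) = 0 by rewrite addr0.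
rewrite Dcop_cons Dcop0 //; last first.
  move=> w' vw' ew' sw'; have hx' : here m x w' by rewrite (eqv_here _ _ ew').
  apply: spf0; rewrite /= ?vx //.
    by rewrite (eqv_located m (eqv_cons x ew')) (here_located hx).
  move=> w2 vw2 ew2 sw2; rewrite hx' na => lt _; apply: f0 => //.
    exact: eqv_trans (eqv_cons x ew') ew2.
  by rewrite sw2 /= sw'.
rewrite addr0; case: w vw vxw hx f0 es => [|z w] vw vxw hx f0 es; first by rewrite mulr0.
have /and3P[_ vz vw'] := vxw.
rewrite junc_cons; case: ifP => [cxz|]; last by rewrite mulr0.
have vxz := lvalid_prodl vx vz.
have hxz : here m (prodl x z) w by rewrite here_prodl // hx.
have naxz : ~~ alone m (prodl x z) by rewrite alone_prodl // (here_carries hxz).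
rewrite spf_here // f0 ?mulr0 //=.
- by rewrite lvalid_rest ?lvalid_atom ?(here_carries hxz).
- by apply: eqv_trans (eqv_merge _ _ _ _) (eqv_split _ _ _ _) => //; exact: here_carries hxz.
- rewrite (negPf (here_rest _ _ (here_carries hxz))) //.
  by apply: ltn_double_addr; apply: wgt_ge1 => //; apply: lvalid_rest => //; apply: here_carries hxz.
Qed.

Lemma wgt_prodl_rest m x y : lvalid x -> lvalid y -> cop x y -> carries m (prodl x y) ->
  (wgt (rest m (prodl x y))).+1 = (wgt x + wgt y)%N.
Proof.
move=> vx vy c h; rewrite -wgt_prodl // -(wgt_rest gens2) //; first exact: lvalid_prodl.
exact: alone_prodl.
Qed.

(** This is what [init] is for: an atom that is a component is coprime to its left neighbour. An
    atom that is a variable carries no generators, so it is coprime to everything. *)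
Lemma located_cop m x a w : lvalid a -> located m [:: x, a & w] ->
  ~~ here m x (a :: w) -> here m a w -> alone m a -> cop x a.
Proof.
move=> va; rewrite /located /here /cop /carries /alone => lo nx ha aa.
have ea : atom m a = a by apply: alone_atom => //; case/andP: ha.
rewrite mcoprimeC -ea; move: lo nx ha {aa ea}; rewrite /atom; case: m => -[] v /=.
  by move=> *; rewrite mS0; apply/mcoprimeP => u; left; rewrite ffunE.
rewrite !andbT => lo nx ha; move: lo; rewrite (negPf nx) ha /=.
by [].
Qed.

(** The located letter is already an atom, so splitting first gives zero; the word is recovered by
    merging x with a and then splitting again. *)
Lemma contract_second m x a w f : all lvalid [:: x, a & w] -> located m [:: x, a & w] ->
  ~~ here m x (a :: w) -> here m a w -> alone m a ->
  (forall w', all lvalid w' -> eqv [:: x, a & w] w' -> size w' = (size w).+2 ->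
     (psi m [:: x, a & w] < psi m w')%N -> f w' = 0) ->
  Dcop (spf m f) [:: x, a & w] = f [:: x, a & w].
Proof.
move=> vxaw lo nx ha aa f0; have /and3P[vx va vw] := vxaw.
have c := located_cop va lo nx ha aa; have h := here_carries ha.
have psE : psi m [:: x, a & w] = (2 * wgt x)%N by rewrite psi_nhere // psi_here // aa addn0.
rewrite Dcop_cons junc_cons c.
have hxa : here m (prodl x a) w by rewrite here_prodl // ha orbT.
have nxa : ~~ alone m (prodl x a) by rewrite alone_prodl // (here_carries hxa).
have -> : Dcop (fun w1 => spf m f (x :: w1)) (a :: w) = 0; last first.
  rewrite addr0 spf_here // /eps atom_prodl // rest_prodl // (alone_atom gens2 va h aa).
  have s1 := sg_sq K x.2 a.2; have p1 := par_sq K x.2; rewrite /lpar.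
  by move: (sg _ _) (par _ _) s1 p1 => s p s1 p1; ring: s1 p1.
rewrite (Dcop_local (g := fun w1 => lpar x * spf m (fun w2 => f (x :: w2)) w1)); first last.
- by move=> w' vw' ew' sw'; rewrite spf_nhere // (eqv_here _ _ ew').
- by rewrite /= va.
rewrite [Dcop _ _]bardZ -/(Dcop _ _) Dcop_cons.
have -> : Dcop (fun w1 => spf m (fun w2 => f (x :: w2)) (a :: w1)) w = 0.
  apply: Dcop0 => // w' vw' ew' sw'; rewrite spf_alone // (eqv_here _ _ ew') //.
rewrite addr0; case: w vw vxaw lo nx ha f0 psE hxa => [|z w] vw vxaw lo nx ha f0 psE _.
  by rewrite !mulr0.
have /andP[vz vw'] := vw; rewrite junc_cons; case: ifP => [caz|]; rewrite ?mulr0 //.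
have haz : here m (prodl a z) w by rewrite here_prodl // ha.
rewrite (spf0 (m := m)) ?mulr0 //.
- by rewrite /= lvalid_prodl.
- exact: here_located.
move=> w' v' e' s' lt lt1; have ez := eqv_trans (eqv_merge w va vz caz) e'.
apply: f0; rewrite /= ?vx //.
- exact: eqv_cons.
- by rewrite s'.
- rewrite -[X in (X < _)%N]/(psi m [:: x, a, z & w]) psE (negPf (nhere_eqv ez nx)).
  by rewrite -[X in (X < _)%N]addn0 ltn_add2l (ltn_trans _ lt1).
Qed.

(** Induction passes the letters before the located one, with [contract_head] and [contract_second]
    as base cases. A located atom in front is excluded: it can neither be split nor merged with a
    left neighbour. *)
Lemma contract_mode m w f : all lvalid w -> located m w -> ~~ front_alone m w ->
  (forall w', all lvalid w' -> eqv w w' -> size w' = size w ->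
     (psi m w < psi m w')%N -> f w' = 0) ->
  spf m (Dcop f) w + Dcop (spf m f) w = f w.
Proof.
elim: w f => [|x w IHw] f; first by rewrite /located; case: m => -[].
move=> vxw lo fa f0; have /andP[vx vw] := vxw.
have [hx|nx] := boolP (here m x w).
  have na : ~~ alone m x by move: fa; rewrite /= hx.
  by apply: contract_head => // w' v' e' s' lt; apply: f0; rewrite // psi_here // na.
have low := located_cons lo nx.
have [fw|nfw] := boolP (front_alone m w).
  case: w fw vxw lo f0 nx vw low {IHw fa} => [//|a w] /andP[ha aa] vxw lo f0 nx vw low.
  rewrite spf_nhere // spf_alone // mulr0 add0r.
  exact: contract_second.
have nx' w' : eqv w w' -> ~~ here m x w' by move=> e; rewrite (eqv_here _ _ e).
have -> : Dcop (spf m f) (x :: w) = Dcop (spf m (fun w1 => f (x :: w1))) w.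
  rewrite Dcop_cons (Dcop_local (g := fun w1 => lpar x * spf m (fun w2 => f (x :: w2)) w1)) //; last first.
    by move=> w' _ e _; rewrite spf_nhere ?nx'.
  rewrite [Dcop (fun _ => _ * _) _]bardZ -/(Dcop _ _) mulrDr mulrA /lpar par_sq mul1r.
  rewrite [X in X + _](_ : _ = 0) ?add0r //.
  case: w vxw lo f0 nx vw low nx' nfw {IHw fa} => [|z w] vxw lo f0 nx vw low nx' nfw; first by rewrite mulr0.
  have /andP[vz vw'] := vw; rewrite junc_cons; case: ifP => [cxz|]; rewrite ?mulr0 //.
  have e1 := eqv_merge w vx vz cxz; have vxz := lvalid_prodl vx vz.
  have [hz|nz] := boolP (here m z w).
    have hxz : here m (prodl x z) w by rewrite here_prodl // hz orbT.
    have nxz : ~~ alone m (prodl x z) by rewrite alone_prodl // (here_carries hxz).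
    have naz : ~~ alone m z by move: nfw; rewrite /= hz.
    have hc := here_carries hxz.
    rewrite spf_here // f0 ?mulr0 //.
    - by rewrite /= lvalid_rest ?lvalid_atom.
    - exact: eqv_trans e1 (eqv_split _ _ _ _).
    - rewrite psi_split // psi_nhere // psi_here // naz.
      by apply: ltn_double_pred (wgt_prodl_rest vx vz cxz hc) (wgt_ge2 vz hz naz).
  have nxz : ~~ here m (prodl x z) w by rewrite here_prodl // negb_or nx.
  rewrite (spf0 (m := m)) ?mulr0 //.
  - by rewrite /= vxz.
  - by rewrite (eqv_located _ e1).
  move=> w' v' e' s' lt _; apply: f0 => //.
  - exact: eqv_trans e1 e'.
  - apply: leq_trans lt; by rewrite ltnS !psi_nhere // wgt_prodl // mulnDr addnA.
rewrite spf_nhere //.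
have -> : spf m (fun w1 => Dcop f (x :: w1)) w =
    lpar x * spf m (Dcop (fun w1 => f (x :: w1))) w.
  rewrite -spfZ -[RHS]add0r.
  (* Merging x with the first letter z after a splitting further right gives a word with larger
     [psi], where f vanishes, so these terms can be added for free. *)
  have <- : spf m (fun w1 => lpar x * junc x w1 f) w = 0.
    apply: spf0 => // w' v' e' s' lt lt1.
    case: w' v' e' s' lt lt1 => [|z w'] v' e' s' lt lt1; first by rewrite mulr0.
    have /andP[vz vw'] := v'; rewrite junc_cons; case: ifP => [cxz|]; rewrite ?mulr0 //.
    have nz : ~~ here m z w'.
      by apply: contraL lt1 => hz; rewrite psi_here // -leqNgt leq_b1.
    have nxz : ~~ here m (prodl x z) w'.
      by rewrite here_prodl // negb_or nz (nhere_eqv _ (nx' _ e')) //; exact: eqv_refl.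
    rewrite f0 ?mulr0 //.
    - by rewrite /= lvalid_prodl.
    - exact: eqv_trans (eqv_cons x e') (eqv_merge _ _ _ _).
    - by rewrite (psi_nhere nx) (psi_nhere nxz) wgt_prodl // mulnDr -addnA ltn_add2l -psi_nhere.
  rewrite -spfD; apply: spf_local => // w' _ _ _ _ _.
  by rewrite Dcop_cons mulrDr.
rewrite mulrA /lpar par_sq mul1r IHw // => w' v' e' s' lt.
apply: f0; rewrite /= ?vx //; first exact: eqv_cons.
  by rewrite s'.
by rewrite (negPf nx) (negPf (nx' _ e')) ltn_add2l.
Qed.

End Contraction.

(** * The homotopy on all words of positive level *)

Section Homotopy.
Variables (K : fieldType) (n N : nat) (gens : 'I_N -> mon n).
Hypothesis gens2 : forall i, (2 <= mdeg (gens i))%N.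
Local Notation X := (mon n * {set 'I_N})%type.
Local Notation mS := (mS gens).
Local Notation lpar := (@lpar K n N).
Local Notation lvalid := (lvalid gens).
Local Notation cop := (cop gens).
Local Notation wgt := (wgt gens).
Local Notation exc := (exc gens).
Local Notation carries := (carries gens).
Local Notation alone := (alone gens).
Implicit Types (x y z : X) (w : seq X) (S T : {set 'I_N}) (v : 'I_n) (m : mode n).
Implicit Type f : seq X -> K.

Local Notation located := (located gens).
Local Notation eqv := (eqv gens).
Local Notation here := (here gens).
Local Notation psi := (psi gens).
Local Notation spf := (@spf K n N gens).
Local Notation Dcop := (@Dcop K n N gens).
Local Notation junc := (@junc K n N gens).
Local Notation front_alone := (front_alone gens).
Local Notation wexc := (wexc gens).
Local Notation init := (init gens).

(** Variables take precedence. Without excess in any letter, every v dividing the first letter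
    satisfies [init], so a nonempty valid word always has a mode. The choice depends only on
    invariants in [eqv], hence is constant along each step of the homotopy. *)
Definition mode_of w : option (mode n) :=
  if [pick v | (0 < wexc w v)%N] is Some v then Some (true, v)
  else if [pick v | init v w] is Some v then Some (false, v) else None.

Lemma same_loc_mode w w' : same_loc gens w w' -> mode_of w' = mode_of w.
Proof.
move=> e; rewrite /mode_of.
rewrite (eq_pick (Q := fun v => (0 < wexc w v)%N)) => [|v]; last by have [-> _ _] := e v.
by rewrite (@eq_pick _ (init^~ w') (init^~ w)) => // v; have [_ -> _] := e v.
Qed.

Lemma eqv_mode w w' : eqv w w' -> mode_of w' = mode_of w.
Proof. by case=> _ _ _ _; apply: same_loc_mode. Qed.

Lemma mode_located w m : mode_of w = Some m -> located m w.
Proof.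
rewrite /mode_of; case: pickP => [v h [<-] //|_].
by case: pickP => // v h [<-].
Qed.

Lemma mode_some x w : lvalid x -> exists m, mode_of (x :: w) = Some m.
Proof.
move=> /andP[x0 hx]; rewrite /mode_of; case: pickP => [v _|none]; first by eexists.
case: pickP => [v _|none']; first by eexists.
case/eqP: x0; apply/ffunP => v; rewrite [RHS]ffunE; apply/eqP; rewrite -leqn0 leqNgt.
apply/negP => x0; have := none' v => /=; have := none v.
rewrite wexc_cons /exc; case: (posnP (mS x.2 v)) => // ->.
by rewrite subn0 addn_gt0 x0.
Qed.

Fixpoint sf f w : K :=
  if w is x :: w' then
    if mode_of w is Some m then
      if here m x w' && alone m x then lpar x * sf (fun w1 => f (x :: w1)) w'
      else spf m f w
    else 0
  else 0.

(** Words with fewer atoms peeled off the front must come later in the order. Their remaining weight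
    is larger, and the factor 4 makes the gap 8a + 4 between consecutive values of 4 a^2 exceed the
    bound 2a + 1 on [psi]. *)
Fixpoint phi w : nat :=
  if w is x :: w' then
    if mode_of w is Some m then
      if here m x w' && alone m x then phi w'
      else (4 * (wsum wgt w * wsum wgt w) + psi m w)%N
    else 0%N
  else 0%N.

Lemma sf_front m f x w : mode_of (x :: w) = Some m -> front_alone m (x :: w) ->
  sf f (x :: w) = lpar x * sf (fun w1 => f (x :: w1)) w.
Proof. by move=> e fa; rewrite [LHS]/= e (fa : here m x w && alone m x). Qed.

Lemma sf_spf m f w : mode_of w = Some m -> ~~ front_alone m w -> sf f w = spf m f w.
Proof.
case: w => // x w e nf; rewrite [LHS]/= e.
by rewrite (negPf (nf : ~~ (here m x w && alone m x))).
Qed.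

Lemma phi_front m x w : mode_of (x :: w) = Some m -> front_alone m (x :: w) ->
  phi (x :: w) = phi w.
Proof. by move=> e fa; rewrite [LHS]/= e (fa : here m x w && alone m x). Qed.

Lemma phi_psi m x w : mode_of (x :: w) = Some m -> ~~ front_alone m (x :: w) ->
  phi (x :: w) = (4 * (wsum wgt (x :: w) * wsum wgt (x :: w)) + psi m (x :: w))%N.
Proof.
by move=> e nf; rewrite [LHS]/= e (negPf (nf : ~~ (here m x w && alone m x))).
Qed.

Lemma psi_le m w : (psi m w <= 2 * wsum wgt w + 1)%N.
Proof.
elim: w => //= x w IHw; rewrite wsum_cons; case: ifP => _; last by rewrite mulnDr -addnA leq_add2l.
by case: (alone m x); rewrite // addn1.
Qed.

Lemma phi_arith1 p a : (p <= 2 * a + 1 -> 4 * (a * a) + p < 4 * (a.+1 * a.+1))%N.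
Proof. nia. Qed.

Lemma phi_arith2 a b : (4 * (a.+1 * a.+1) <= 4 * ((b + a).+1 * (b + a).+1))%N.
Proof. nia. Qed.

Lemma phi_lt w : (phi w < 4 * ((wsum wgt w).+1 * (wsum wgt w).+1))%N.
Proof.
elim: w => [|x w IHw]; first by [].
rewrite [phi _]/=; case: (mode_of _) => [m|]; last by rewrite muln_gt0.
case: ifP => _; last exact: phi_arith1 (psi_le m (x :: w)).
by apply: leq_trans IHw _; rewrite wsum_cons phi_arith2.
Qed.

Lemma sf_local w f g : all lvalid w ->
  (forall w', all lvalid w' -> eqv w w' -> size w' = (size w).+1 -> f w' = g w') ->
  sf f w = sf g w.
Proof.
elim: w f g => [//|x w IHw] f g vxw fg; have /andP[vx vw] := vxw.
have [m em] := mode_some w vx; have [fa|nfa] := boolP (front_alone m (x :: w)).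
  rewrite !(sf_front _ em fa); congr (_ * _); apply: IHw => // w' v' e' s'.
  by apply: fg; rewrite /= ?vx //; [exact: eqv_cons | rewrite s'].
rewrite !(sf_spf _ em nfa); apply: spf_local => //; first exact: mode_located.
by move=> w' v' e' s' _ _; apply: fg.
Qed.

Lemma sf_cst0 w : sf (fun=> 0) w = 0.
Proof.
have z m w' : spf m (fun=> 0) w' = 0.
  by elim: w' => //= y w' ->; do 2?case: ifP => _; rewrite ?mulr0.
elim: w => [//|x w IHw]; rewrite [LHS]/=; case: (mode_of _) => // m.
case: ifP => _; first by rewrite IHw mulr0.
exact: (z m (x :: w)).
Qed.

Lemma sf0 w f : all lvalid w ->
  (forall w', all lvalid w' -> eqv w w' -> size w' = (size w).+1 -> f w' = 0) ->
  sf f w = 0.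
Proof. by move=> vw f0; rewrite (sf_local (g := fun=> 0)) ?sf_cst0. Qed.

Lemma sfZ c f w : sf (fun w => c * f w) w = c * sf f w.
Proof.
elim: w f => [|x w IHw] f; rewrite /= ?mulr0 //; case: (mode_of _) => [m|]; rewrite ?mulr0 //.
case: ifP => _; first by rewrite IHw mulrCA.
exact: (spfZ gens m c f (x :: w)).
Qed.

Lemma sfD f g w : sf (fun w => f w + g w) w = sf f w + sf g w.
Proof.
elim: w f g => [|x w IHw] f g; rewrite /= ?addr0 //; case: (mode_of _) => [m|]; rewrite ?addr0 //.
case: ifP => _; first by rewrite IHw mulrDr.
exact: (spfD gens m f g (x :: w)).
Qed.

(** A product of two letters has weight at least 2, so merging never creates an atom in front. *)
Lemma Dcop_local_front w f g : all lvalid w ->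
  (forall w', all lvalid w' -> eqv w w' -> size w = (size w').+1 ->
     (forall m, front_alone m w' -> front_alone m w) -> f w' = g w') ->
  Dcop f w = Dcop g w.
Proof.
move=> vw fg; pose R w w' := all lvalid w -> [/\ all lvalid w', eqv w w',
  size w = (size w').+1 & forall m, front_alone m w' -> front_alone m w].
apply: (bard_local lpar (R := R)) => //.
- move=> x y w' p /mem_lmul[c ->] /= /and3P[vx vy vw'].
  split=> //; [by rewrite /= lvalid_prodl | by apply: eqv_merge |].
  by move=> m /= /andP[/here_carries h]; rewrite (negPf (alone_prodl gens2 h _ _ _)).
- move=> x w1 w2 h /= /andP[vx /h[v2 e2 s2 _]].
  split; [by rewrite /= vx | exact: eqv_cons | by rewrite /= s2 |].
  by move=> m /=; rewrite (eqv_here _ _ e2).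
- by move=> w' /(_ vw)[]; apply: fg.
Qed.

Lemma wgt_front m x w : lvalid x -> front_alone m (x :: w) -> wgt x = 1%N.
Proof. by move=> vx /andP[/here_carries h a]; apply: (wgt_alone gens2 vx h a). Qed.

Lemma front_psi m w : front_alone m w -> psi m w = 0%N.
Proof. by case: w => //= x w /andP[-> ->]. Qed.

(** Front atoms have weight 1 and are peeled off one by one. Since the total weight exceeds the
    number of letters, some letter is not an atom and the peeling stops before the word is empty. *)
Lemma contract_all w f : all lvalid w -> (size w < wsum wgt w)%N ->
  (forall w', all lvalid w' -> eqv w w' -> size w' = size w ->
     (phi w < phi w')%N -> f w' = 0) ->
  sf (Dcop f) w + Dcop (sf f) w = f w.
Proof.
elim: w f => [//|x w IHw] f vxw sw f0; have /andP[vx vw] := vxw.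
have [m em] := mode_some w vx.
have memo w' : eqv (x :: w) w' -> mode_of w' = Some m by move=> /eqv_mode ->.
have big w' : eqv (x :: w) w' -> ~~ front_alone m w' -> size w' = (size w).+1 ->
    phi w' = (4 * (wsum wgt (x :: w) * wsum wgt (x :: w)) + psi m w')%N.
  case: w' => // y w' e nf _; rewrite (phi_psi (memo _ e) nf).
  by have [_ -> _ _ _] := e.
have [fa|nfa] := boolP (front_alone m (x :: w)); last first.
  rewrite !(sf_spf _ em nfa) (Dcop_local_front (g := spf m f)) //; last first.
    by move=> w' v' e' s' fr; rewrite (sf_spf _ (memo _ e')) //; apply: contra (fr m) nfa.
  apply: contract_mode => //; first exact: mode_located.
  move=> w' v' e' s' lt; apply: f0 => //.
  have nf' : ~~ front_alone m w' by apply: contraL lt => /front_psi ->.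
  by rewrite (phi_psi em nfa) (big _ e' nf' s') ltn_add2l.
have w1 := wgt_front vx fa; have /andP[hx ax] := fa.
have small : (phi (x :: w) < 4 * (wsum wgt (x :: w) * wsum wgt (x :: w)))%N.
  by rewrite (phi_front em fa) wsum_cons w1 add1n phi_lt.
have f0' w' : all lvalid w' -> eqv (x :: w) w' -> size w' = (size w).+1 ->
    ~~ front_alone m w' -> f w' = 0.
  by move=> v' e' s' nf; apply: f0 => //; rewrite (big _ e' nf s') ltn_addr.
have nf_prodl y w' : lvalid y -> cop x y -> ~~ front_alone m (prodl x y :: w').
  move=> vy c; apply/negP => /andP[/here_carries h].
  by rewrite (negPf (alone_prodl gens2 h _ _ _)).
have fr w' : eqv w w' -> front_alone m (x :: w').
  by move=> e; rewrite /front_alone (eqv_here _ _ e) hx ax.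
have -> : sf (Dcop f) (x :: w) = sf (Dcop (fun w1 => f (x :: w1))) w.
  rewrite (sf_front _ em fa).
  rewrite (sf_local (g := fun w' => lpar x * junc x w' f + lpar x * Dcop (fun w1 => f (x :: w1)) w')) //; last first.
    by move=> w' *; rewrite Dcop_cons mulrDr.
  rewrite sfD !sfZ mulrDr !mulrA /lpar par_sq !mul1r sf0 ?add0r //.
  case=> [|y w'] v' e' s' //; have /andP[vy vw'] := v'; rewrite junc_cons.
  case: ifP => // c; rewrite f0' ?mulr0 ?nf_prodl //.
  - by rewrite /= lvalid_prodl.
  - exact: eqv_trans (eqv_cons x e') (eqv_merge gens2 _ vx vy c).
have -> : Dcop (sf f) (x :: w) = Dcop (sf (fun w1 => f (x :: w1))) w.
  rewrite Dcop_cons (Dcop_local gens2 (g := fun w1 => lpar x * sf (fun w2 => f (x :: w2)) w1)) //; last first.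
    by move=> w' _ e _; rewrite (sf_front _ (memo _ _)) ?fr //; exact: eqv_cons.
  rewrite [Dcop (fun _ => _ * _) _]bardZ -/(Dcop _ _) mulrDr mulrA /lpar par_sq mul1r.
  rewrite [X in X + _](_ : _ = 0) ?add0r //.
  case: w vxw sw f0 vw em memo big fa hx small f0' fr {IHw} => [|y w] vxw sw f0 vw em memo big fa hx small f0' fr.
    by rewrite mulr0.
  have /andP[vy vw'] := vw; rewrite junc_cons; case: ifP => [c|]; rewrite ?mulr0 //.
  have e1 := eqv_merge gens2 w vx vy c.
  rewrite (sf_spf _ (memo _ e1)) ?nf_prodl // (spf0 gens2 (m := m)) ?mulr0 //.
  - by rewrite /= lvalid_prodl.
  - by rewrite (eqv_located _ e1); apply: mode_located.
  move=> w' v' e' s' lt lt1; apply: f0' => //; first exact: eqv_trans e1 e'.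
  by apply: contraL lt1 => /front_psi ->.
apply: IHw => //; first by move: sw; rewrite wsum_cons w1 add1n ltnS.
move=> w' v' e' s' lt; apply: f0; rewrite ?[size _]/= ?s' //.
- by rewrite /= vx.
- exact: eqv_cons.
have em' := memo _ (eqv_cons x e').
by rewrite (phi_front em fa) (phi_front em' (fr _ e')).
Qed.

End Homotopy.

(** * Tight deletions anticommute with splitting *)

Section TightDifferential.
Variables (K : fieldType) (n N : nat) (gens : 'I_N -> mon n).
Hypothesis gens2 : forall i, (2 <= mdeg (gens i))%N.
Local Notation X := (mon n * {set 'I_N})%type.
Local Notation mS := (mS gens).
Local Notation lpar := (@lpar K n N).
Local Notation sg := (@sg K N).
Local Notation lvalid := (lvalid gens).
Local Notation wgt := (wgt gens).
Local Notation exc := (exc gens).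
Local Notation atom := (atom gens).
Local Notation rest := (rest gens).
Local Notation carries := (carries gens).
Local Notation alone := (alone gens).
Implicit Types (x y z : X) (w : seq X) (S T : {set 'I_N}) (v : 'I_n) (m : mode n).
Implicit Type f : seq X -> K.

Local Notation here := (here gens).
Local Notation spf := (@spf K n N gens).
Local Notation front_alone := (front_alone gens).

Local Notation tight := (tight gens).
Local Notation same_loc := (same_loc gens).
Local Notation sf := (@sf K n N gens).
Local Notation mode_of := (mode_of gens).
Local Notation eps := (eps K gens).

Definition D0 f w : K := bard (ldel K tight) (fun _ _ => [::]) lpar f w.

Lemma D0_cons f x w :
  D0 f (x :: w) = - lin (ldel K tight x) (fun x' => f (x' :: w))
                  + lpar x * D0 (fun w1 => f (x :: w1)) w.
Proof.
by rewrite /D0 /=; case: w => [|y w]; rewrite ?[lin [::] _]/lin ?big_nil ?add0r.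
Qed.

Definition del x i : X := (x.1, x.2 :\ i).

Lemma lin_tight x g : lin (ldel K tight x) g =
  \sum_(i in x.2 | tight x.2 i) sg [set i] (x.2 :\ i) * g (del x i).
Proof. exact: lin_ldel. Qed.

Lemma eq_lin_tight x g g' :
  (forall i, i \in x.2 -> tight x.2 i -> g (del x i) = g' (del x i)) ->
  lin (ldel K tight x) g = lin (ldel K tight x) g'.
Proof. by move=> e; apply: eq_lin => p /mem_ldel[i [ix ti ->]]; apply: e. Qed.

Section Deletion.
Variables (x : X) (i : 'I_N).
Hypotheses (ix : i \in x.2) (ti : tight x.2 i).

Lemma del_mS : mS (x.2 :\ i) = mS x.2.
Proof. exact: tight_mS. Qed.

Lemma del_lvalid : lvalid (del x i) = lvalid x.
Proof. by rewrite /lvalid /= del_mS. Qed.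

Lemma del_wgt : wgt (del x i) = wgt x.
Proof. by rewrite /wgt /= (eqP ti). Qed.

Lemma del_carries m : carries m (del x i) = carries m x.
Proof. by rewrite /carries /exc /= del_mS. Qed.

Lemma del_atom1 m : carries m x -> (atom m (del x i)).1 = (atom m x).1.
Proof.
rewrite /carries /atom; case: m => -[] v //= h.
by have [] := tight_component gens2 ix ti h.
Qed.

Lemma del_alone m : carries m x -> alone m (del x i) = alone m x.
Proof. by move=> h; rewrite /alone del_atom1. Qed.

Lemma del_here m w : here m (del x i) w = here m x w.
Proof. by rewrite /here del_carries. Qed.

Lemma del_same_loc w : same_loc (x :: w) (del x i :: w).
Proof.
move=> v; rewrite !wexc_cons /exc /= del_mS; split=> //.
by case: (posnP (mS x.2 v)) => //= h; have [->] := tight_component gens2 ix ti h.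
Qed.

Lemma del_lpar : lpar (del x i) = - lpar x.
Proof. exact: par_D1. Qed.

Lemma del_in_rest m : carries m x -> i \in (rest m x).2 ->
  atom m (del x i) = atom m x /\ rest m (del x i) = del (rest m x) i.
Proof.
move=> h ir; have e : atom m (del x i) = atom m x.
  have := del_atom1 h; move: h ir; rewrite /carries /rest /atom; case: m => -[] v //= h ir e.
  have [_ ->] := tight_component gens2 ix ti h; rewrite inE in ir; case/andP: ir => ni _.
  by have /setDidPl -> : [disjoint component gens x.2 v & [set i]] by rewrite disjoint_sym disjoints1.
by rewrite /rest e; split=> //; rewrite /del /= !setDDl setUC.
Qed.

Lemma del_in_atom m : carries m x -> i \in (atom m x).2 ->
  atom m (del x i) = del (atom m x) i /\ rest m (del x i) = rest m x.
Proof.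
move=> h ia; have e : atom m (del x i) = del (atom m x) i.
  rewrite [LHS]surjective_pairing del_atom1 //; congr (_, _).
  move: h ia; rewrite /carries /atom; case: m => -[] v //= h; first by rewrite inE.
  by have [_ ->] := tight_component gens2 ix ti h.
rewrite /rest e /=; split=> //; congr (_, _); apply/setP => k; rewrite !inE.
by case: eqVneq => [->|] /=; rewrite ?ia ?andbT ?andbF.
Qed.

End Deletion.

Definition D0rel w w' : Prop := all lvalid w ->
  [/\ all lvalid w', wdeg w' = wdeg w, wsum wgt w' = wsum wgt w, size w' = size w &
      [/\ wsum (@lcard n N) w = (wsum (@lcard n N) w').+1, same_loc w w' &
         forall m, front_alone m w' = front_alone m w]].

Lemma D0_local w f g : all lvalid w -> (forall w', D0rel w w' -> f w' = g w') -> D0 f w = D0 g w.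
Proof.
move=> vw fg; apply: (bard_local lpar (R := D0rel)) => //.
- move=> x w' p /mem_ldel[i [ix ti ->]] /andP[vx vw'].
  have ds := del_same_loc ix ti w'.
  split=> //=; first by rewrite del_lvalid ?vx.
    by rewrite !wsum_cons del_wgt.
  split=> //; first by rewrite !wsum_cons /lcard /= (cardsD1 i x.2) ix.
  move=> m; rewrite (del_here ix ti); case hx : (here m x w') => //=.
  by rewrite (del_alone ix ti) // (here_carries hx).
- move=> x w1 w2 h /andP[vx /h[v2 d2 g2 s2 [c2 l2 fr2]]]; split=> //=; rewrite ?vx ?d2 ?s2 //.
    by rewrite !wsum_cons g2.
  split; [by rewrite !wsum_cons c2 addnS | exact: same_loc_cons |].
  by move=> m; rewrite (same_loc_here _ _ l2).
Qed.

Lemma eq_spf m f g w : f =1 g -> spf m f w = spf m g w.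
Proof.
elim: w f g => //= x w IHw f g e.
by rewrite e (IHw (fun w1 => f (x :: w1)) (fun w1 => g (x :: w1))).
Qed.

Lemma spf_lin m (Y : Type) (l : seq (K * Y)) (F : Y -> seq X -> K) w :
  spf m (fun w => lin l (fun t => F t w)) w = lin l (fun t => spf m (F t) w).
Proof.
elim: l => [|p l IHl].
  rewrite lin_nil -[RHS](mul0r (spf m (fun=> 0) w)) -spfZ.
  by apply: eq_spf => w'; rewrite lin_nil mul0r.
rewrite lin_cons -IHl -spfZ -spfD.
by apply: eq_spf => w'; rewrite lin_cons.
Qed.

Lemma eq_sf f g w : f =1 g -> sf f w = sf g w.
Proof.
elim: w f g => [//|x w IHw] f g e; rewrite [LHS]/= [RHS]/=.
case: (mode_of _) => // m; rewrite (IHw _ (fun w1 => g (x :: w1))) //.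
by case: ifP => // _; apply: (eq_spf m (x :: w) e).
Qed.

Lemma sf_lin (Y : Type) (l : seq (K * Y)) (F : Y -> seq X -> K) w :
  sf (fun w => lin l (fun t => F t w)) w = lin l (fun t => sf (F t) w).
Proof.
elim: l => [|p l IHl].
  rewrite lin_nil -[RHS](mul0r (sf (fun=> 0) w)) -sfZ.
  by apply: eq_sf => w'; rewrite lin_nil mul0r.
rewrite lin_cons -IHl -sfZ -sfD.
by apply: eq_sf => w'; rewrite lin_cons.
Qed.

Lemma lpar_split m x : carries m x -> lpar x = - (lpar (rest m x) * lpar (atom m x)).
Proof.
by move=> h; rewrite /lpar (mS_split h) parU //; apply/coprime_disjoint/cop_rest.
Qed.

Lemma sg_D1l i S T : i \in S -> sg S T = sg [set i] T * sg (S :\ i) T.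
Proof. by move=> iS; rewrite -{1}(setD1K iS) sgUl // disjoints1 !inE eqxx. Qed.

Lemma sg_D1r i S T : i \in T -> sg S T = sg S [set i] * sg S (T :\ i).
Proof. by move=> iT; rewrite -{1}(setD1K iT) sgUr // disjoints1 !inE eqxx. Qed.

(** A tight generator of x lies in the rest or in the atom, is tight there, and can be deleted
    without disturbing the other piece. What remains is a comparison of signs. *)
Lemma D0_split m x (F : X -> X -> K) : lvalid x -> carries m x ->
  lin (ldel K tight x) (fun x' => eps m x' * F (rest m x') (atom m x')) =
  - (eps m x * (lin (ldel K tight (rest m x)) (fun r => F r (atom m x))
                + lpar (rest m x) * lin (ldel K tight (atom m x)) (fun a => F (rest m x) a))).
Proof.
move=> vx h; set r := rest m x; set a := atom m x.
have d : [disjoint r.2 & a.2] by apply/coprime_disjoint/cop_rest.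
have xE : x.2 = r.2 :|: a.2 by exact: mS_split.
have rx i : i \in r.2 -> i \in x.2 by rewrite xE in_setU => ->.
have ax i : i \in a.2 -> i \in x.2 by rewrite xE in_setU orbC => ->.
have cra := cop_rest h; have car : mcoprime (mS a.2) (mS r.2) by rewrite mcoprimeC.
have tr i : i \in r.2 -> tight x.2 i = tight r.2 i by move=> ir; rewrite xE tightU.
have ta i : i \in a.2 -> tight x.2 i = tight a.2 i by move=> ia; rewrite xE setUC tightU.
have rE : r = rest m x by [].
have aE : a = atom m x by [].
rewrite /eps -rE -aE; move: (h); clearbody r a => h'.
have nr i : i \in a.2 -> i \notin r.2 by move=> ia; rewrite (disjointFl d ia).
have na i : i \in r.2 -> i \notin a.2 by move=> ir; rewrite (disjointFr d ir).
have sumU (A B : {set 'I_N}) (G : 'I_N -> K) : [disjoint A & B] ->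
    \sum_(i in A :|: B) G i = \sum_(i in A) G i + \sum_(i in B) G i by exact: big_disjointU.
rewrite !lin_tight big_mkcondr xE sumU // -xE.
rewrite mulrDr opprD; congr (_ + _).
  rewrite [in RHS]big_mkcondr mulr_sumr -sumrN; apply: eq_bigr => i ir.
  rewrite tr //; case: ifP => ti; last by rewrite mulr0 oppr0.
  have ir' : i \in (rest m x).2 by rewrite -rE.
  have [-> ->] := del_in_rest (rx i ir) (etrans (tr i ir) ti) h ir'.
  rewrite -rE -aE (del_lpar ir) (sg_D1l a.2 ir).
  have -> : sg [set i] (x.2 :\ i) = sg [set i] (r.2 :\ i) * sg [set i] a.2.
    rewrite xE setDUl (setDidPl _ : a.2 :\ i = a.2); last by rewrite disjoint_sym disjoints1 na.
    by rewrite sgUr //; apply: disjointWl d; rewrite subsetDl.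
  by rewrite /=; ring.
rewrite [in RHS]big_mkcondr !mulr_sumr -sumrN; apply: eq_bigr => i ia.
rewrite ta //; case: ifP => ti; last by rewrite !mulr0 oppr0.
have ia' : i \in (atom m x).2 by rewrite -aE.
have [-> ->] := del_in_atom (ax i ia) (etrans (ta i ia) ti) h ia'.
rewrite -rE -aE (sg_D1r r.2 ia).
have -> : sg [set i] (x.2 :\ i) = sg [set i] (a.2 :\ i) * sg [set i] r.2.
  rewrite xE setUC setDUl (setDidPl _ : r.2 :\ i = r.2); last by rewrite disjoint_sym disjoints1 nr.
  by rewrite sgUr // disjoint_sym; apply: disjointWr d; rewrite subsetDl.
have s1 := sg1_comm K (nr i ia); have s2 := sg_sq K r.2 [set i].
have -> : sg [set i] r.2 = - lpar r * sg r.2 [set i].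
  rewrite /lpar /par exprS mulN1r opprK -s1 -mulrA s2 mulr1 //.
by rewrite /=; ring.
Qed.

(** A tight deletion keeps the lcms, hence the position of the located letter and whether it is an
    atom, so it respects the branches of [spf]; [D0_split] treats the letter that is split. *)
Lemma spf_D0 m f w : all lvalid w -> spf m (D0 f) w + D0 (spf m f) w = 0.
Proof.
elim: w f => [|x w IHw] f vxw; first by rewrite /D0 /= addr0.
have /andP[vx vw] := vxw; rewrite [D0 (spf m f) _]D0_cons.
have [hx|nx] := boolP (here m x w); last first.
  rewrite spf_nhere // (eq_spf m (g := fun w' => -1 * lin (ldel K tight x) (fun x' => f (x' :: w'))
     + lpar x * D0 (fun w1 => f (x :: w1)) w')); last by move=> w'; rewrite D0_cons mulN1r.
  rewrite spfD !spfZ spf_lin.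
  rewrite (eq_lin_tight (g := fun x' => spf m f (x' :: w)) (g' := fun x' => - lpar x * spf m (fun w1 => f (x' :: w1)) w)); last first.
    move=> i ix ti. rewrite spf_nhere ?(del_here ix ti) //.
    by rewrite (del_lpar ix).
  rewrite linZ (D0_local (f := fun w' => spf m f (x :: w')) (g := fun w' => lpar x * spf m (fun w1 => f (x :: w1)) w')) //; last first.
    move=> w' /(_ vw)[_ _ _ _ [_ sl _]]; rewrite spf_nhere // (same_loc_here _ _ sl) //.
  rewrite [D0 (fun w' => lpar x * _) _]bardZ -/(D0 _ _).
  have := IHw (fun w1 => f (x :: w1)) vw.
  move: (spf _ _ _) (D0 _ _) (lin _ _) => a b c /eqP; rewrite addr_eq0 => /eqP ->; ring.
have h := here_carries hx.
have [al|nal] := boolP (alone m x).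
  rewrite spf_alone // (eq_lin_tight (g := fun x' => spf m f (x' :: w)) (g' := fun=> 0)) ?lin0 ?oppr0 ?add0r //; last first.
    move=> i ix ti; rewrite spf_alone ?(del_here ix ti) //.
    by rewrite (del_alone ix ti).
  rewrite (D0_local (f := fun w' => spf m f (x :: w')) (g := fun=> 0)) ?[D0 (fun=> 0) _]bard0 ?mulr0 // => w' /(_ vw)[_ _ _ _ [_ sl _]].
  by rewrite spf_alone // (same_loc_here _ _ sl).
rewrite spf_here // !D0_cons.
rewrite (eq_lin_tight (g := fun x' => spf m f (x' :: w)) (g' := fun x' => eps m x' * f [:: rest m x', atom m x' & w])); last first.
  move=> i ix ti; rewrite spf_here ?(del_here ix ti) //.
  by rewrite (del_alone ix ti).
rewrite (D0_split (fun r a => f [:: r, a & w]) vx h).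
rewrite (D0_local (f := fun w' => spf m f (x :: w')) (g := fun w' => eps m x * f [:: rest m x, atom m x & w'])) //; last first.
  by move=> w' /(_ vw)[_ _ _ _ [_ sl _]]; rewrite spf_here // (same_loc_here _ _ sl).
rewrite [D0 (fun w' => eps m x * _) _]bardZ -/(D0 _ _) (lpar_split h).
by move: (lin _ _) (lin _ _) (D0 _ _) => a b c; ring.
Qed.

Lemma sf_D0 f w : all lvalid w -> sf (D0 f) w + D0 (sf f) w = 0.
Proof.
elim: w f => [|x w IHw] f vxw; first by rewrite /D0 /= addr0.
have /andP[vx vw] := vxw; have [m em] := mode_some w vx.
have [fa|nfa] := boolP (front_alone m (x :: w)); last first.
  rewrite (sf_spf _ em) // (D0_local (g := spf m f)) ?spf_D0 // => w' /(_ vxw)[_ _ _ _ [_ sl fr]].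
  by rewrite (sf_spf _ (etrans (same_loc_mode sl) em)) // fr.
have [hx ax] := andP fa.
rewrite [D0 (sf f) _]D0_cons (sf_front _ em fa).
rewrite (eq_sf (g := fun w' => -1 * lin (ldel K tight x) (fun x' => f (x' :: w'))
   + lpar x * D0 (fun w1 => f (x :: w1)) w')); last by move=> w'; rewrite D0_cons mulN1r.
rewrite sfD !sfZ sf_lin.
rewrite (eq_lin_tight (g := fun x' => sf f (x' :: w)) (g' := fun x' => - lpar x * sf (fun w1 => f (x' :: w1)) w)); last first.
  move=> i ix ti; rewrite -(del_lpar ix) (sf_front (m := m)) //.
    by rewrite (same_loc_mode (del_same_loc ix ti w)).
  by rewrite /front_alone (del_here ix ti) hx (del_alone ix ti) // (here_carries hx).
rewrite linZ (D0_local (f := fun w' => sf f (x :: w')) (g := fun w' => lpar x * sf (fun w1 => f (x :: w1)) w')) //; last first.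
  move=> w' /(_ vw)[_ _ _ _ [_ sl _]]; rewrite (sf_front (m := m)) //.
    by rewrite (same_loc_mode (same_loc_cons x sl)).
  by rewrite /front_alone (same_loc_here _ _ sl) hx.
rewrite [D0 (fun w' => lpar x * _) _]bardZ -/(D0 _ _).
have := IHw (fun w1 => f (x :: w1)) vw.
by move: (sf _ _) (D0 _ _) (lin _ _) => a b c /eqP; rewrite addr_eq0 => /eqP ->; ring.
Qed.

End TightDifferential.

(** * The full differential and the level *)

Section FullDifferential.
Variables (K : fieldType) (n N : nat) (gens : 'I_N -> mon n).
Hypothesis gens2 : forall i, (2 <= mdeg (gens i))%N.
Local Notation X := (mon n * {set 'I_N})%type.
Local Notation lpar := (@lpar K n N).
Local Notation lvalid := (lvalid gens).
Local Notation cop := (cop gens).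
Local Notation wgt := (wgt gens).
Local Notation rk := (rk gens).
Implicit Types (x y z : X) (w : seq X) (S T : {set 'I_N}) (v : 'I_n) (m : mode n).
Implicit Type f : seq X -> K.

Local Notation eqv := (eqv gens).
Local Notation Dcop := (@Dcop K n N gens).

Local Notation tight := (tight gens).
Local Notation sf := (@sf K n N gens).

Local Notation D0 := (@D0 K n N gens).
Local Notation phi := (phi gens).

Definition Dall f w : K := bard (ldel K (fun _ _ => true)) (lmul K (@ldisj n N)) lpar f w.

(** The homological degree: the exterior degrees plus one for every letter. *)
Definition hgt w : nat := (wsum (@lcard n N) w + size w)%N.

Lemma Dall_sq f w : Dall (Dall f) w = 0.
Proof.
apply: bard_square.
- by move=> x p /mem_ldel[i [ix _ ->]]; apply: par_D1.
- by move=> x y p /mem_lmul[d ->]; apply: parU.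
- by move=> x g; apply: ldel_sq.
- by move=> x y g; rewrite ldel_leibniz.
- by move=> x y z g; apply: lmul_assoc => // *; apply: ldisjA.
Qed.

Lemma D0_sq f w : D0 (D0 f) w = 0.
Proof.
apply: bard_square => //.
- by move=> x p /mem_ldel[i [ix _ ->]]; apply: par_D1.
- by move=> x g; apply: ldel_sq => S i k; apply: tight_comm.
by move=> x y g; rewrite !lin_nil !lin0 ?mulr0 ?subr0 // => *; rewrite lin_nil.
Qed.

Lemma wgt_ldel x i : lvalid x -> (wgt x <= wgt (x.1, x.2 :\ i))%N.
Proof. by move=> vx; apply: leq_sub2l; apply/rk_sub/subsetDl. Qed.

Lemma lvalid_ldel x i : lvalid x -> lvalid (x.1, x.2 :\ i).
Proof.
move=> /andP[x0 hx]; rewrite /lvalid x0 /=.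
by apply: mdiv_trans hx; apply/mS_sub/subsetDl.
Qed.

Lemma lcard_prodl x y : ldisj x y -> lcard (prodl x y) = (lcard x + lcard y)%N.
Proof. by move=> d; rewrite /lcard /= cardsU (disjoint_setI0 d) cards0 subn0. Qed.

Definition Drel w w' : Prop := all lvalid w ->
  [/\ all lvalid w', wdeg w' = wdeg w, hgt w = (hgt w').+1 &
      (wsum wgt w + size w' <= wsum wgt w' + size w)%N].

Lemma Drel_ldel x w i : i \in x.2 -> Drel (x :: w) ((x.1, x.2 :\ i) :: w).
Proof.
move=> ix /andP[vx vw]; split=> //=; first by rewrite lvalid_ldel.
  by rewrite /hgt !wsum_cons /lcard /= (cardsD1 i x.2) ix !addSn.
by rewrite !wsum_cons leq_add2r leq_add2r wgt_ldel.
Qed.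

Lemma Drel_lmul x y w : ldisj x y -> Drel [:: x, y & w] (prodl x y :: w).
Proof.
move=> d /and3P[vx vy vw]; split=> //=; first by rewrite lvalid_prodl.
- by rewrite mplusA.
- by rewrite /hgt !wsum_cons lcard_prodl // addnA !addnS.
by rewrite !wsum_cons addnA leq_add ?leq_add2r ?wgt_prodl_ge //=.
Qed.

Lemma Drel_cons x w w' : Drel w w' -> Drel (x :: w) (x :: w').
Proof.
move=> h /andP[vx /h[v' d' h' le]]; split=> //=; rewrite ?vx ?d' //.
  by move: h'; rewrite /hgt !wsum_cons /= !addnS -!addnA => ->; rewrite addnS.
by rewrite !wsum_cons !addnS ltnS -!addnA leq_add2l.
Qed.

Lemma Dall_local w f g : (forall w', Drel w w' -> f w' = g w') -> Dall f w = Dall g w.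
Proof.
apply: (bard_local lpar (R := Drel)).
- by move=> x w' p /mem_ldel[i [ix _ ->]]; apply: Drel_ldel.
- by move=> x y w' p /mem_lmul[d ->]; apply: Drel_lmul.
- exact: Drel_cons.
Qed.

Lemma wgt_not_tight x i : lvalid x -> ~~ tight x.2 i -> (wgt x < wgt (x.1, x.2 :\ i))%N.
Proof.
move=> vx nt; have lt : (rk (x.2 :\ i) < rk x.2)%N.
  by rewrite ltn_neqAle nt rk_sub ?subsetDl.
by apply: ltn_sub2l => //; apply: leq_trans lt (rk_le_mdeg gens2 vx).
Qed.

(** Every other term strictly raises the level: a deletion that is not tight lowers the rank, and a
    product removes a letter without losing weight. *)
Lemma Dall_D0 w f : all lvalid w ->
  (forall w', all lvalid w' -> wdeg w' = wdeg w -> hgt w = (hgt w').+1 ->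
     (wsum wgt w + size w' < wsum wgt w' + size w)%N -> f w' = 0) ->
  Dall f w = D0 f w.
Proof.
move=> vw f0; pose nt (S : {set 'I_N}) i := ~~ tight S i.
have -> : Dall f w = D0 f w + bard (ldel K nt) (lmul K (@ldisj n N)) lpar f w.
  rewrite -bard_split; apply: bard_eq_lin => //= x g.
  rewrite lin_cat !lin_ldel [LHS](bigID (tight x.2)) /=.
  by congr (_ + _); apply: eq_bigl => i; rewrite andbT.
rewrite -[RHS]addr0; congr (_ + _); rewrite -[RHS](bard0 (ldel K nt) (lmul K (@ldisj n N)) lpar w).
pose R w w' := Drel w w' /\ (all lvalid w -> wsum wgt w + size w' < wsum wgt w' + size w)%N.
apply: (bard_local lpar (R := R)).
- move=> x w' p /mem_ldel[i [ix nti ->]]; split; first exact: Drel_ldel.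
  move=> /andP[vx _] /=; rewrite !wsum_cons ltn_add2r ltn_add2r.
  exact: wgt_not_tight.
- move=> x y w' p /mem_lmul[d ->]; split; first exact: Drel_lmul.
  move=> /and3P[vx vy _] /=; rewrite !wsum_cons addnA [X in (_ < X)%N]addnS ltnS.
  by rewrite leq_add ?leq_add2r ?wgt_prodl_ge.
- move=> x w1 w2 [d h]; split; first exact: Drel_cons.
  by move=> /andP[vx /h lt]; rewrite !wsum_cons /= !addnS ltnS -!addnA ltn_add2l.
by move=> w' [/(_ vw)[v' d' h' _] /(_ vw)]; apply: f0.
Qed.

Definition Drest f w : K :=
  bard (ldel K (fun _ _ => true)) (lmul K (fun x y => ldisj x y && ~~ cop x y)) lpar f w.

Lemma Dall_split f w : Dall f w = Dcop f w + Drest f w.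
Proof.
rewrite /Dcop /Drest -bard_split; apply: bard_eq_lin => //= x y g.
rewrite lin_cat !lin_lmul.
case: (boolP (cop x y)) => [/[dup] c /(cop_disj gens2) ->|_]; rewrite ?andbF ?andbT ?addr0 ?add0r //.
Qed.

(** The terms outside [Dcop] keep the number of letters, or merge two letters with a common
    variable, which loses degree in the lcms. *)
Definition lowers w w' : Prop :=
  (size w' = size w) \/ (size w = (size w').+1 /\ (wsum (lexp gens) w' < wsum (lexp gens) w)%N).

Lemma lowers_cons x w w' : lowers w w' -> lowers (x :: w) (x :: w').
Proof.
rewrite /lowers !wsum_cons /=; case=> [->|[-> lt]]; first by left.
by right; rewrite ltn_add2l.
Qed.

Lemma Drest_local w f g : (forall w', Drel w w' -> lowers w w' -> f w' = g w') ->
  Drest f w = Drest g w.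
Proof.
move=> fg; apply: (bard_local lpar (R := fun w w' => Drel w w' /\ lowers w w')).
- by move=> x w' p /mem_ldel[i [ix _ ->]]; split; [exact: Drel_ldel | left].
- move=> x y w' p /mem_lmul[/andP[d nc] ->]; split; first exact: Drel_lmul.
  by right; rewrite !wsum_cons addnA ltn_add2r /lexp mdeg_mSU_lt.
- by move=> x w1 w2 [d l]; split; [exact: Drel_cons | exact: lowers_cons].
by move=> w' [d l]; apply: fg.
Qed.

Lemma Drest0 w f : (forall w', Drel w w' -> lowers w w' -> f w' = 0) -> Drest f w = 0.
Proof. by move=> h; rewrite (Drest_local (g := fun=> 0)) //; apply: bard0. Qed.

Lemma eqv_deg w w' : eqv w w' -> wdeg w' = wdeg w. Proof. by case. Qed.
Lemma eqv_wgt w w' : eqv w w' -> wsum wgt w' = wsum wgt w. Proof. by case. Qed.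
Lemma eqv_lexp w w' : eqv w w' -> wsum (lexp gens) w' = wsum (lexp gens) w. Proof. by case. Qed.

(* Higher words: more letters, or the same number and a smaller sum of deg m_S, or both
   equal and a larger [phi]. *)
Definition higher w w' : bool :=
  [|| (size w < size w')%N,
      (size w' == size w) && (wsum (lexp gens) w' < wsum (lexp gens) w)%N |
      [&& size w' == size w, wsum (lexp gens) w' == wsum (lexp gens) w & (phi w < phi w')%N]].

(** [Drest] combined with splitting, in either order, gains a letter, or keeps the number of letters
    and loses degree in the lcms; both lead to higher words. The rest is [contract_all]. *)
Lemma contract_top w f : all lvalid w -> (size w < wsum wgt w)%N ->
  (forall w', all lvalid w' -> wdeg w' = wdeg w -> higher w w' -> f w' = 0) ->
  sf (Dall f) w + Dall (sf f) w = f w.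
Proof.
move=> vw sw f0.
rewrite (eq_sf gens w (Dall_split f)) sfD Dall_split [sf (Drest f) w]sf0 //; last first.
  move=> w1 v1 e1 s1; apply: Drest0 => w2 /(_ v1)[v2 d2 _ _] l2; apply: f0 => //.
    by rewrite d2 (eqv_deg e1).
  rewrite /higher; case: l2 => [->|[]]; first by rewrite s1 ltnSn.
  by rewrite s1 (eqv_lexp e1) => -[->] ->; rewrite eqxx orbT.
rewrite [Drest _ _]Drest0 ?addr0 //; last first.
  move=> w1 /(_ vw)[v1 d1 _ _] l1; apply: sf0 => // w2 v2 e2 s2; apply: f0 => //.
    by rewrite (eqv_deg e2).
  rewrite /higher s2; case: l1 => [->|[-> lt]]; first by rewrite ltnSn.
  by rewrite (eqv_lexp e2) lt eqxx orbT.
apply: contract_all => // w' v' e' s' lt; apply: f0 => //; first exact: eqv_deg.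
by rewrite /higher s' (eqv_lexp e') lt !eqxx !orbT.
Qed.

(** [sf] lowers the level by one and the differential keeps the level only through [D0]. So below
    the level of w only the anticommutator of [sf] and [D0] is visible, and it vanishes by
    [sf_D0]. *)
Lemma contract_low w f : all lvalid w ->
  (forall w', all lvalid w' -> wdeg w' = wdeg w ->
     (wsum wgt w + size w' <= wsum wgt w' + size w)%N -> f w' = 0) ->
  sf (Dall f) w + Dall (sf f) w = 0.
Proof.
move=> vw f0; rewrite (sf_local gens2 (g := D0 f)) //; last first.
  move=> w1 v1 e1 s1; apply: Dall_D0 => // w2 v2 d2 _; rewrite s1 (eqv_wgt e1) addnS ltnS => le.
  by apply: f0 => //; rewrite d2 (eqv_deg e1).
rewrite Dall_D0 ?sf_D0 // => w1 v1 d1 _ lt; apply: sf0 => // w2 v2 e2 s2; apply: f0 => //.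
  by rewrite (eqv_deg e2).
by rewrite (eqv_wgt e2) s2 addnS.
Qed.

End FullDifferential.

(** * Enumeration of words of given multidegree *)

Section WordList.
Variables (n : nat) (X : eqType) (dg : X -> mon n) (P : pred X) (Ls : mon n -> seq X).
Hypotheses (uLs : forall j, uniq (Ls j))
  (mLs : forall j x, (x \in Ls j) = P x && mdiv (dg x) j)
  (P0 : forall x, P x -> dg x != mzero n).

Fixpoint wordlist (r : nat) (j : mon n) : seq (seq X) :=
  if r is r'.+1 then
    flatten [seq [seq x :: s | s <- wordlist r' (msub j (dg x))] | x <- Ls j]
  else if j == mzero n then [:: [::]] else [::].

Definition wdg (w : seq X) : mon n := foldr (fun x a => mplus (dg x) a) (mzero n) w.

Lemma mem_wordlist r j w :
  (w \in wordlist r j) = [&& size w == r, all P w & wdg w == j].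
Proof.
elim: r j w => [|r IHr] j w /=.
  case: (eqVneq j (mzero n)) => [->|jn]; case: w => [|x w] //=; first by rewrite eqxx.
  by rewrite eq_sym (negPf jn).
apply/allpairsPdep/idP => [[x [s [xL sL ->]]]|].
  move: sL; rewrite IHr /= => /and3P[/eqP -> -> /eqP sd].
  move: xL; rewrite mLs => /andP[-> dx]; rewrite eqxx /= sd.
  by apply/eqP/mplus_sub.
case: w => [|x w] //= /and3P[sw /andP[Px aw] /eqP wd].
exists x, w; split=> //; first by rewrite mLs Px -wd mdiv_plusr.
by rewrite IHr aw -wd msub_plus eqxx !andbT -eqSS.
Qed.

Lemma uniq_wordlist r j : uniq (wordlist r j).
Proof.
elim: r j => [|r IHr] j /=; first by case: ifP.
by apply: allpairs_uniq_dep => // [[x s] [y t]] _ _ /= [-> ->].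
Qed.

Lemma size_wdg w : all P w -> (size w <= mdeg (wdg w))%N.
Proof.
elim: w => //= x w IHw /andP[/P0 Px /IHw le]; rewrite mdeg_plus.
by rewrite -add1n leq_add // lt0n mdeg_eq0.
Qed.

(** Every letter has nonzero degree, which bounds the length of a word by [mdeg j]. *)
Definition allwords j := flatten [seq wordlist r j | r <- iota 0 (mdeg j).+1].

Lemma mem_allwords j w : (w \in allwords j) = all P w && (wdg w == j).
Proof.
apply/flatten_mapP/andP => [[r _]|[aw /eqP wj]].
  by rewrite mem_wordlist => /and3P[].
exists (size w); last by rewrite mem_wordlist eqxx aw wj eqxx.
by rewrite mem_iota /= add0n ltnS -wj size_wdg.
Qed.

Lemma uniq_allwords j : uniq (allwords j).
Proof.
rewrite /allwords; elim: (mdeg j).+1 0%N => //= m IHm a; rewrite cat_uniq uniq_wordlist IHm andbT /=.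
apply/hasPn => w /flatten_mapP[r]; rewrite mem_iota => /andP[ar _].
by rewrite !mem_wordlist => /and3P[/eqP -> _ _]; rewrite gtn_eqF.
Qed.

End WordList.

Lemma bar_basisE n (G : seq (mon n)) i j :
  bar_basis G i j =
  wordlist id (fun j => [seq m <- mons_le j | (m != mzero n) && ~~ inI G m]) i j.
Proof.
elim: i j => //= i IHi j; congr flatten; apply: eq_map => m.
by rewrite IHi.
Qed.

Lemma mulmx_neq0 (K : fieldType) m n p (A : 'M[K]_(m, n)) (B : 'M[K]_(n, p)) i k :
  (A *m B) i k != 0 -> exists l, A i l != 0 /\ B l k != 0.
Proof.
rewrite mxE => h; case: (pickP (fun l => (A i l != 0) && (B l k != 0))) => [l /andP[]|none].
  by exists l.
case/eqP: h; apply: big1 => l _; have := none l.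
by case: eqVneq => [->|_] /=; rewrite ?mul0r // => /negbFE/eqP ->; rewrite mulr0.
Qed.

(** Base-B digits s, d - a, c turn the lexicographic order into the order of natural numbers that
    [cycle_boundary] asks for. *)
Lemma lex_arith (B s s' a a' c c' d : nat) :
  (a <= d -> a' <= d -> d < B -> c < B -> c' < B ->
   [|| s < s', (s' == s) && (a' < a) | [&& s' == s, a' == a & c < c']] ->
   (s * B + (d - a)) * B + c < (s' * B + (d - a')) * B + c')%N.
Proof.
move=> ad ad' dB cB cB' /or3P[lt|/andP[/eqP -> lt]|/and3P[/eqP -> /eqP -> lt]].
- have h : (s * B + (d - a) < s' * B + (d - a'))%N.
    apply: leq_trans (leq_addr _ _); apply: leq_trans (leq_mul lt (leqnn B)).
    by rewrite mulSn addnC ltn_add2r; apply: leq_ltn_trans dB; rewrite leq_subr.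
  apply: leq_trans (leq_addr _ _); apply: leq_trans (leq_mul h (leqnn B)).
  by rewrite mulSn addnC ltn_add2r.
- have h : (s * B + (d - a) < s * B + (d - a'))%N by rewrite ltn_add2l ltn_sub2l // (leq_trans lt).
  apply: leq_trans (leq_addr _ _); apply: leq_trans (leq_mul h (leqnn B)).
  by rewrite mulSn addnC ltn_add2r.
- by rewrite ltn_add2l.
Qed.

(** * Level filtration of the Taylor bar complex *)

Section Slices.
Variables (K : fieldType) (n N : nat) (gens : 'I_N -> mon n).
Hypothesis gens2 : forall i, (2 <= mdeg (gens i))%N.
Local Notation X := (mon n * {set 'I_N})%type.
Local Notation lvalid := (lvalid gens).
Local Notation wgt := (wgt gens).
Implicit Types (x y z : X) (w : seq X) (S T : {set 'I_N}) (v : 'I_n) (m : mode n).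
Implicit Type f : seq X -> K.

Local Notation sf := (@sf K n N gens).

Local Notation D0 := (@D0 K n N gens).
Local Notation phi := (phi gens).

Local Notation Dall := (@Dall K n N).
Local Notation hgt := (@hgt n N).
Local Notation lexp := (lexp gens).
Variable j : mon n.

Definition letters (u : mon n) : seq X :=
  [seq x <- [seq (a, T) | a <- mons_le u, T <- enum {set 'I_N}] | lvalid x].

Lemma mem_letters u x : (x \in letters u) = lvalid x && mdiv x.1 u.
Proof.
rewrite mem_filter; congr (_ && _); apply/allpairsP/idP => [[[a S] /= [h _ ->]]|h].
  by rewrite mem_mons_le in h.
by exists x; rewrite mem_mons_le mem_enum -surjective_pairing.
Qed.

Lemma uniq_letters u : uniq (letters u).
Proof.
apply: filter_uniq; apply: allpairs_uniq; rewrite ?uniq_mons_le ?enum_uniq //.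
by move=> [a S] [b T] _ _ /= [-> ->].
Qed.

Lemma lvalid_deg x : lvalid x -> x.1 != mzero n. Proof. by case/andP. Qed.

Definition barwords : seq (seq X) := allwords fst letters j.

Lemma mem_barwords w : (w \in barwords) = all lvalid w && (wdeg w == j).
Proof. exact: (mem_allwords mem_letters lvalid_deg). Qed.

Lemma uniq_barwords : uniq barwords.
Proof. exact: (uniq_allwords uniq_letters mem_letters). Qed.

(** By [size_wgt] the subtraction is never truncated on valid words. *)
Definition dlt w : nat := (wsum wgt w - size w)%N.

Lemma size_wgt w : all lvalid w -> (size w <= wsum wgt w)%N.
Proof.
elim: w => //= x w IHw /andP[vx /IHw le]; rewrite wsum_cons -add1n leq_add //.
exact: wgt_ge1.
Qed.

Lemma wgt_mdeg w : (wsum wgt w <= mdeg (wdeg w))%N.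
Proof.
elim: w => [//|x w IHw]; rewrite wsum_cons /= mdeg_plus leq_add //.
exact: leq_subr.
Qed.

Lemma lexp_mdeg w : all lvalid w -> (wsum lexp w <= mdeg (wdeg w))%N.
Proof.
elim: w => [//|x w IHw] /andP[/andP[_ /mdeg_le hx] vw]; rewrite wsum_cons /= mdeg_plus leq_add //.
exact: IHw.
Qed.

Lemma dlt_le w w' : all lvalid w -> all lvalid w' ->
  (wsum wgt w + size w' <= wsum wgt w' + size w)%N = (dlt w <= dlt w')%N.
Proof.
move=> /size_wgt h /size_wgt h'; rewrite /dlt leq_subLR addnBA // leq_subRL.
  by rewrite addnC [(size w + _)%N]addnC.
by apply: leq_trans h' (leq_addl _ _).
Qed.

Local Notation wd := (@wd _ barwords).
Local Notation Nw := (size barwords).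

Lemma wdv i : all lvalid (wd i).
Proof. by have := mem_wd i; rewrite mem_barwords => /andP[]. Qed.

Lemma wdj i : wdeg (wd i) = j.
Proof. by have := mem_wd i; rewrite mem_barwords => /andP[_ /eqP]. Qed.

Lemma bar_local O : 
  (forall w f g, all lvalid w -> (forall w', all lvalid w' -> wdeg w' = wdeg w -> f w' = g w') ->
     O f w = O g w) ->
  forall w f g, w \in barwords -> {in barwords, f =1 g} -> (O f w : K) = O g w.
Proof.
move=> loc w f g; rewrite mem_barwords => /andP[vw /eqP wj] fg.
by apply: loc => // w' v' d'; apply: fg; rewrite mem_barwords v' d' wj eqxx.
Qed.

Lemma Dall_operates : operates barwords Dall.
Proof.
split=> [*|]; first exact: bard_sum.
apply: bar_local => w f g vw fg; apply: (Dall_local gens2) => w' /(_ vw)[v' d' _ _]; exact: fg.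
Qed.

Lemma D0_operates : operates barwords D0.
Proof.
split=> [*|]; first exact: bard_sum.
apply: bar_local => w f g vw fg; apply: (D0_local gens2) => // w' /(_ vw)[v' d' _ _ _]; exact: fg.
Qed.

Lemma sf_operates : operates barwords sf.
Proof.
split=> [r c F w|].
  have := sf_lin gens [seq (c l, l) | l <- r] F w.
  by rewrite /lin !big_map => <-; apply: eq_sf => w'; rewrite big_map.
by apply: bar_local => w f g vw fg; apply: (sf_local gens2) => // w' v' [d' _ _ _ _] _; apply: fg.
Qed.

Definition MD : 'M[K]_Nw := mxo barwords Dall.
Definition M0 : 'M[K]_Nw := mxo barwords D0.
Definition MS : 'M[K]_Nw := mxo barwords sf.

Lemma MD_sq : MD *m MD = 0.
Proof.
rewrite -(@mxo_comp K _ _ uniq_barwords Dall Dall Dall_operates).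
by apply/matrixP=> i k; rewrite !mxE Dall_sq.
Qed.

Lemma M0_sq : M0 *m M0 = 0.
Proof.
rewrite -(@mxo_comp K _ _ uniq_barwords D0 D0 D0_operates).
by apply/matrixP=> i k; rewrite !mxE D0_sq.
Qed.

Lemma MD_supp i k : MD i k != 0 -> hgt (wd i) = (hgt (wd k)).+1 /\ (dlt (wd i) <= dlt (wd k))%N.
Proof.
move=> ne; pose Q w w' := [&& all lvalid w', hgt w == (hgt w').+1 & (dlt w <= dlt w')%N].
suff /and3P[_ /eqP -> ->] : Q (wd i) (wd k) by [].
apply: (mxo_supp ne) => f h.
rewrite (Dall_local gens2 (g := fun=> 0)) ?[LHS]bard0 // => w' /(_ (wdv i))[v' d' /eqP hh le].
by apply: h; rewrite /Q v' hh -dlt_le // wdv.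
Qed.

Lemma MS_supp i k : MS i k != 0 -> hgt (wd k) = (hgt (wd i)).+1 /\ dlt (wd i) = (dlt (wd k)).+1.
Proof.
move=> ne; pose Q w w' := (hgt w' == (hgt w).+1) && (dlt w == (dlt w').+1).
suff /andP[/eqP -> /eqP ->] : Q (wd i) (wd k) by [].
apply: (mxo_supp ne) => f h; apply: (sf0 gens2 (wdv i)) => // w' v' [_ g' _ c' _] s'.
apply: h; rewrite /Q /hgt c' s' addnS eqxx /dlt g' s' /=.
by rewrite subnS prednK // subn_gt0 -s' -g' size_wgt.
Qed.

Lemma MU_E : MS *m MD + MD *m MS = mxo barwords (fun f w => sf (Dall f) w + Dall (sf f) w).
Proof.
rewrite /MS /MD -(@mxo_comp K _ _ uniq_barwords sf Dall sf_operates).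
rewrite -(@mxo_comp K _ _ uniq_barwords Dall sf Dall_operates).
by apply/matrixP => i k; rewrite !mxE.
Qed.

Definition ge_slice p h : pred 'I_Nw := fun i => (p <= dlt (wd i))%N && (hgt (wd i) == h).
Definition eq_slice p h : pred 'I_Nw := fun i => (dlt (wd i) == p) && (hgt (wd i) == h).

(** [contract_top] asks for positive level, and splitting loses one level, so the chain that the
    cycle bounds is found one filtration stage below. *)
Lemma MD_acyclic p h (z : 'rV[K]_Nw) : (z <= sel K (ge_slice p.+1 h))%MS -> z *m MD = 0 ->
  (z <= sel K (ge_slice p h.+1) *m MD)%MS.
Proof.
(* Exceeds both lower digits: weights are at most [mdeg j], so [phi] is below the first summand, and
   the middle digit is at most [mdeg j]. *)
pose B := (4 * ((mdeg j).+1 * (mdeg j).+1) + (mdeg j).+1)%N.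
pose mt i := ((size (wd i) * B + (mdeg j - wsum lexp (wd i))) * B + phi (wd i))%N.
apply: (cycle_boundary (S := MS) (phi := mt)) MD_sq _ _ _ _.
- move=> i k /andP[pd /eqP hh] /MS_supp[hk dk].
  by rewrite /ge_slice hk hh eqxx -ltnS -dk pd.
- move=> i k /andP[pd /eqP hh] Uik; apply/andP; split.
    apply: leq_trans pd _; move: Uik; rewrite MU_E => ne.
    pose Q w w' := all lvalid w' && (dlt w <= dlt w')%N.
    suff /andP[] : Q (wd i) (wd k) by [].
    apply: (mxo_supp ne) => f f0; apply: (contract_low gens2) => // [|w' v' d' le]; first exact: wdv.
    by apply: f0; rewrite /Q v' -dlt_le // wdv.
  have : ((MS *m MD) i k != 0) || ((MD *m MS) i k != 0).
    by apply: contraNT Uik; rewrite negb_or !negbK => /andP[/eqP a /eqP b]; rewrite mxE a b addr0.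
  by case/orP => /mulmx_neq0[l [/[dup] a]] => [/MS_supp[e _] /MD_supp[e' _]|/MD_supp[e _] /MS_supp[e' _]];
     apply/eqP; lia.
- move=> i k /andP[pd /eqP hh] le; rewrite MU_E mxE (contract_top gens2) ?wdv //.
  + by rewrite /dirac (inj_eq (wd_inj uniq_barwords)).
  + by rewrite -subn_gt0; apply: leq_trans pd.
  move=> w' v' d' hi; rewrite /dirac; case: eqP => // e; move: le; rewrite leqNgt => /negP[].
  have pB w : all lvalid w -> wdeg w = j -> (phi w < B)%N.
    move=> vw wj; apply: leq_trans (phi_lt gens w) _; apply: leq_trans (leq_addr _ _).
    by rewrite leq_pmul2l // leq_mul // ltnS -wj wgt_mdeg.
  apply: lex_arith; rewrite ?pB ?wdv ?wdj //.
  + by rewrite -(wdj i) lexp_mdeg ?wdv.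
  + by rewrite -(wdj k) lexp_mdeg ?wdv.
  + by rewrite /B ltn_addl.
  + by move: hi; rewrite e.
Qed.

Lemma M0_supp i k : M0 i k != 0 -> hgt (wd i) = (hgt (wd k)).+1 /\ dlt (wd i) = dlt (wd k).
Proof.
move=> ne; pose Q w w' := (hgt w == (hgt w').+1) && (dlt w == dlt w').
suff /andP[/eqP -> /eqP ->] : Q (wd i) (wd k) by [].
apply: (mxo_supp ne) => f h.
rewrite (D0_local gens2 (g := fun=> 0)) ?[LHS]bard0 ?wdv // => w' /(_ (wdv i))[_ _ g' s' [c' _ _]].
by apply: h; rewrite /Q /hgt /dlt c' g' s' addSn !eqxx.
Qed.

Lemma MD_M0 i k : dlt (wd i) = dlt (wd k) -> MD i k = M0 i k.
Proof.
move=> e; rewrite !mxE; apply: (Dall_D0 gens2); first exact: wdv.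
move=> w' v' d' _ lt; rewrite /dirac; case: eqP => // ew.
by move: lt; rewrite ltnNge ew dlt_le ?wdv // e leqnn.
Qed.

Lemma M0_slice p h : sel K (eq_slice p h) *m MD *m sel K (fun i => dlt (wd i) == p)
  = sel K (eq_slice p h) *m M0.
Proof.
apply/matrixP => i k; rewrite mul_selE !sel_mulE /eq_slice.
case: (eqVneq (dlt (wd i)) p) => [ip|_]; last by rewrite !mul0r.
case: (eqVneq (dlt (wd k)) p) => [kp|nk]; first by rewrite mulr1 MD_M0 // ip.
rewrite mulr0; case: (eqVneq (M0 i k) 0) => [->|/M0_supp[_ e]]; first by rewrite mulr0.
by rewrite -e ip eqxx in nk.
Qed.

(** [graded_rank] for level above p inside level at least p; between words of equal level the
    differential is [M0]. *)
Lemma slice_rank p h :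
  (\rank (sel K (eq_slice p h.+1) *m M0) + #|ge_slice p.+1 h| =
   \rank (sel K (ge_slice p h.+1) *m MD) + \rank (sel K (ge_slice p.+1 h) *m MD))%N.
Proof.
rewrite -M0_slice; apply: graded_rank MD_sq _ _ _ _ _.
- by move=> i; rewrite /ge_slice /eq_slice; case: (eqVneq (dlt (wd i)) p) => [->|]; rewrite ?leqnn ?andbF ?andbT.
- move=> i k /andP[pd /eqP hh] /MD_supp[e le]; rewrite /ge_slice.
  have -> : hgt (wd k) = h by apply: succn_inj; rewrite -e.
  by rewrite eqxx andbT eq_sym -leq_eqVlt (leq_trans pd le).
- move=> i k /andP[pd _] nd /MD_supp[_ le]; apply: contraNneq nd => e.
  by rewrite eqn_leq pd -{1}e le.
- by move=> k /andP[pd _]; rewrite neq_ltn pd orbT.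
- by move=> z; apply: MD_acyclic.
Qed.

End Slices.

(** * Homology of tight deletions *)

Section Elimination.
Variables (K : fieldType) (m : nat) (T : eqType) (kap : 'I_m -> T) (q : 'I_m -> nat).
Implicit Types (M d : 'M[K]_m) (A H : {set 'I_m}).
Local Notation selA A := (sel K (fun i => i \in A)).

(* Entries of M preserve kap and shift the degree q by b - a. *)
Definition homog (a b : nat) M :=
  forall x y, M x y != 0 -> kap x = kap y /\ (q x + a = q y + b)%N.

Lemma homog_mul a b a' b' M M' : homog a b M -> homog a' b' M' ->
  homog (a + a') (b + b') (M *m M').
Proof.
move=> h h' x y; rewrite mxE => nz.
have [z /andP[/h[kz qz] /h'[kz' qz']]] : exists z, (M x z != 0) && (M' z y != 0).
  apply/existsP; apply: contraNT nz; rewrite negb_exists => /forallP none.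
  apply/eqP; apply: big1 => z _; have := none z; rewrite negb_and !negbK.
  by case/orP => /eqP ->; rewrite ?mul0r ?mulr0.
by split; [rewrite kz | lia].
Qed.

Lemma homog_add a b M M' : homog a b M -> homog a b M' -> homog a b (M + M').
Proof.
move=> h h' x y; rewrite mxE; case: (eqVneq (M x y) 0) => [->|/h//].
by rewrite add0r => /h'.
Qed.

Lemma homog_opp a b M : homog a b M -> homog a b (- M).
Proof. by move=> h x y; rewrite mxE oppr_eq0 => /h. Qed.

Lemma homog_cancel a b c M : homog (a + c) (b + c) M -> homog a b M.
Proof. by move=> h x y /h[-> e]; split=> //; lia. Qed.

Lemma homog_sel (B : pred 'I_m) : homog 0 0 (sel K B).
Proof.
move=> x y; rewrite /sel !mxE; case: (eqVneq x y) => [->|_]; first by [].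
by rewrite mulr0n eqxx.
Qed.

Lemma sel_sel A : selA A *m selA A = selA A.
Proof.
apply/matrixP=> i k; rewrite sel_mulE /sel !mxE; case: eqP => [->|_]; rewrite ?mulr0 // !mulr1n.
by rewrite -natrM mulnb andbb.
Qed.

Lemma sel_delta_l A (i k : 'I_m) : i \notin A -> selA A *m delta_mx i k = 0 :> 'M[K]_m.
Proof.
move=> ni; apply/matrixP=> x y; rewrite sel_mulE !mxE.
by case: eqVneq => [->|_]; rewrite ?(negPf ni) ?mul0r // mulr0.
Qed.

Lemma sel_delta_r A (i k : 'I_m) : k \notin A -> delta_mx i k *m selA A = 0 :> 'M[K]_m.
Proof.
move=> nk; apply/matrixP=> x y; rewrite mul_selE !mxE.
by case: (eqVneq y k) => [->|_]; rewrite ?(negPf nk) ?mulr0 // andbF mul0r.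
Qed.

Lemma delta_mul_delta (i k : 'I_m) d (k' i' : 'I_m) : delta_mx i k *m d *m delta_mx k' i' = d k k' *: delta_mx i i'.
Proof.
apply/matrixP=> x y; rewrite !mxE (bigD1 k') //= big1 => [|z nz]; last first.
  by rewrite !mxE (negPf nz) mulr0.
rewrite !mxE eqxx addr0 (bigD1 k) //= big1 => [|z nz]; last first.
  by rewrite !mxE (negPf nz) andbF mul0r.
rewrite !mxE eqxx addr0 andbT; case: (x == i); case: (y == i') => /=;
by rewrite ?mulr0n ?mulr1n ?mul0r ?mulr0 ?mul1r ?mulr1.
Qed.

(** Gaussian elimination of a complex: a nonzero entry d i j cancels i against j and perturbs the
    differential on the other indices. Survivors are original indices rather than new combinations,
    so the homology is indexed by a subset H whose elements keep their labels and degrees. *)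
Lemma elimination A d :
  d *m d = 0 -> selA A *m d = d -> d *m selA A = d -> homog 0 1 d ->
  exists (H : {set 'I_m}) (inc pr s : 'M[K]_m),
    [/\ [/\ inc *m pr = selA H, inc *m d = 0, d *m pr = 0 &
            pr *m inc + d *m s + s *m d = selA A],
        [/\ selA H *m inc = inc, inc *m selA A = inc, selA A *m pr = pr & pr *m selA H = pr] &
        [/\ homog 0 0 inc, homog 0 0 pr & homog 1 0 s]].
Proof.
elim: {A}_.+1 {-2}A (ltnSn #|A|) d => // N IHN A leA d dd Ad dA hd.
case: (pickP (fun p : 'I_m * 'I_m => d p.1 p.2 != 0)) => [[i j] /= dij|d0]; last first.
  have {d0} d0 : d = 0 by apply/matrixP=> x y; have := d0 (x, y) => /negbFE/eqP /= ->; rewrite mxE.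
  exists A, (selA A), (selA A), 0; rewrite d0 !mulmx0 !mul0mx !addr0 sel_sel; split; split=> //.
  - exact: homog_sel.
  - exact: homog_sel.
  - by move=> x y; rewrite mxE eqxx.
have [kij qij] := hd _ _ dij.
have nij : i != j by apply/eqP => e; rewrite e in qij; lia.
have iA : i \in A by apply: contraNT dij => ni; rewrite -Ad sel_mulE (negPf ni) mul0r.
have jA : j \in A by apply: contraNT dij => ni; rewrite -dA mul_selE (negPf ni) mulr0.
have dii : d i i = 0 by apply/eqP; apply: contraT => /hd[_]; lia.
(* The homotopy inverting the single entry of d at the pivot. *)
pose s1 := (d i j)^-1 *: delta_mx j i : 'M[K]_m.
pose A' := A :\ i :\ j; pose P := selA A'.
have iA' : i \notin A' by rewrite !inE eqxx andbF.
have jA' : j \notin A' by rewrite !inE eqxx.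
have Ps1 : P *m s1 = 0 by rewrite -scalemxAr sel_delta_l ?scaler0.
have s1P : s1 *m P = 0 by rewrite -scalemxAl sel_delta_r ?scaler0.
have s1ds1 : s1 *m d *m s1 = s1.
  by rewrite /s1 -scalemxAl -!scalemxAr -scalemxAl delta_mul_delta !scalerA mulrAC mulVf ?mul1r.
have s1s1 : s1 *m s1 = 0.
  by rewrite /s1 -scalemxAl -scalemxAr mul_delta_mx_cond (negPf nij) mulr0n !scaler0.
have PP : P *m P = P by exact: sel_sel.
have As1 : selA A *m s1 = s1.
  apply/matrixP=> x y; rewrite sel_mulE !mxE; case: (eqVneq x j) => [->|_].
    by rewrite jA mul1r.
  by rewrite !mulr0.
have s1A : s1 *m selA A = s1.
  apply/matrixP=> x y; rewrite mul_selE !mxE; case: (eqVneq y i) => [->|_].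
    by rewrite iA mulr1.
  by rewrite andbF mulr0 mul0r.
have AP : selA A = P + delta_mx i i + delta_mx j j.
  apply/matrixP=> x y; rewrite /P /sel !mxE !inE.
  case: (eqVneq x y) => [->|nxy]; rewrite ?mulr1n ?mulr0n.
    case: (eqVneq y j) => [->|nj] /=.
      by rewrite jA eq_sym (negPf nij) andbF mulr0n !add0r.
    by case: (eqVneq y i) => [->|_]; rewrite ?iA /= ?add0r ?addr0.
  by case: (eqVneq x i) => [xi|_]; case: (eqVneq x j) => [xj|_]; case: (eqVneq y i) => [yi|_];
     case: (eqVneq y j) => [yj|_] //=; rewrite ?addr0 //; case/eqP: nxy; congruence.
(* a and b are orthogonal idempotents; removing both from the projector onto A leaves the part of
   the complex complementary to the cancelled pair. *)
pose a := d *m s1; pose b := s1 *m d.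
have aP : a *m P = 0 by rewrite /a -mulmxA s1P mulmx0.
have Pb : P *m b = 0 by rewrite /b mulmxA Ps1 mul0mx.
have ab : a *m b = 0 by rewrite /a /b mulmxA -(mulmxA d) s1s1 mulmx0 mul0mx.
have ba : b *m a = 0 by rewrite /a /b mulmxA -(mulmxA s1) dd mulmx0 mul0mx.
have Aa : selA A *m a = a by rewrite /a mulmxA Ad.
have aA : a *m selA A = a by rewrite /a -mulmxA s1A.
have Ab : selA A *m b = b by rewrite /b mulmxA As1.
have bA : b *m selA A = b by rewrite /b -mulmxA dA.
have da : d *m a = 0 by rewrite /a mulmxA dd mul0mx.
have bd : b *m d = 0 by rewrite /b -mulmxA dd mulmx0.
have adb : a *m d = d *m b by rewrite /a /b -mulmxA.
have aa : a *m a = a by rewrite /a -mulmxA (mulmxA s1) s1ds1.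
have bb : b *m b = b by rewrite /b mulmxA s1ds1.
have c0 : (d i j)^-1 * d i j = 1 by rewrite mulVf.
have bEi : b *m delta_mx i i = 0.
  by rewrite /b /s1 -!scalemxAl delta_mul_delta dii scale0r scaler0.
have bEj : b *m delta_mx j j = delta_mx j j.
  by rewrite /b /s1 -!scalemxAl delta_mul_delta scalerA c0 scale1r.
have Eia : delta_mx i i *m a = delta_mx i i.
  by rewrite /a /s1 -!scalemxAr mulmxA delta_mul_delta scalerA c0 scale1r.
have aE : a = d *m s1 by [].
have bE : b = s1 *m d by [].
clearbody a b.
pose inc1 := P - P *m a; pose pr1 := P - b *m P.
have F1 : inc1 *m pr1 = P.
  rewrite /inc1 /pr1 mulmxBl !mulmxBr PP mulmxA Pb mul0mx subr0.
  by rewrite -(mulmxA P a P) aP mulmx0 sub0r opprK mulmxA -(mulmxA P a b) ab mulmx0 mul0mx addr0.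
have PE : P = selA A - delta_mx i i - delta_mx j j by rewrite AP addrAC addrK addrK.
have PA : P *m selA A = P.
  apply/matrixP => x y; rewrite mul_selE /P /sel !mxE !inE; case: (eqVneq x y) => [->|_]; last by rewrite mulr0n mul0r.
  by case: (y \in A); rewrite ?mulr1 // !andbF mulr1n mul0r.
have AP' : selA A *m P = P.
  apply/matrixP => x y; rewrite sel_mulE /P /sel !mxE !inE; case: (eqVneq x y) => [->|_]; last by rewrite mulr0n mulr0.
  by case: (y \in A); rewrite ?mul1r // !andbF mulr1n mulr0.
have F2 : pr1 *m inc1 = selA A - a - b.
  rewrite /inc1 /pr1 mulmxBl !mulmxBr !mulmxA PP -!(mulmxA _ P P) PP.
  have Pa : P *m a = a - delta_mx i i - delta_mx j j *m a by rewrite PE !mulmxBl Aa Eia.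
  have bP : b *m P = b - delta_mx j j by rewrite PE !mulmxBr bA bEi bEj subr0.
  rewrite Pa bP mulmxBl ba sub0r {1}PE.
  move: (delta_mx j j *m a) (delta_mx i i) (delta_mx j j) (selA A) => u v w z.
  by apply/matrixP => x y; rewrite !mxE; ring.
have d_s1d : d *m b *m pr1 = 0.
  by rewrite /pr1 mulmxBr mulmxA -(mulmxA d b b) bb subrr.
have s1_ds : inc1 *m (a *m d) = 0.
  by rewrite /inc1 mulmxBl -!mulmxA (mulmxA a a d) aa subrr.
have inc1E : inc1 = P - P *m a by [].
have pr1E : pr1 = P - b *m P by [].
clearbody inc1 pr1.
pose d' := inc1 *m d *m pr1.
have dpr : d *m pr1 = pr1 *m d'.
  rewrite /d' !mulmxA F2 !mulmxBl Ad bd mul0mx subr0 adb d_s1d subr0 //.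
have incd : inc1 *m d = d' *m inc1.
  rewrite /d' -(mulmxA _ pr1) F2 -mulmxA !mulmxBr dA da mulmx0 subr0 -adb s1_ds subr0 //.
have d'd' : d' *m d' = 0.
  by rewrite {1}/d' -(mulmxA _ pr1) -dpr !mulmxA -(mulmxA inc1) dd mulmx0 mul0mx.
have Pinc : P *m inc1 = inc1 by rewrite inc1E mulmxBr mulmxA PP.
have prP : pr1 *m P = pr1 by rewrite pr1E mulmxBl -mulmxA PP.
have Pd' : P *m d' = d' by rewrite /d' !mulmxA Pinc.
have d'P : d' *m P = d' by rewrite /d' -mulmxA prP.
have d'E : d' = inc1 *m d *m pr1 by [].
clearbody d'.
have hs1 : homog 1 0 s1.
  move=> x y; rewrite !mxE; case: (eqVneq x j) => [->|_]; last by rewrite mulr0 eqxx.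
  by case: (eqVneq y i) => [->|_]; rewrite ?mulr0 ?eqxx // kij => _; split=> //; lia.
have ha : homog 0 0 a by rewrite aE; apply: (@homog_cancel _ _ 1); apply: homog_mul hd hs1.
have hb : homog 0 0 b by rewrite bE; apply: (@homog_cancel _ _ 1); apply: homog_mul hs1 hd.
have hP : homog 0 0 P by apply: homog_sel.
have hinc1 : homog 0 0 inc1 by rewrite inc1E; apply: homog_add hP (homog_opp (homog_mul hP ha)).
have hpr1 : homog 0 0 pr1 by rewrite pr1E; apply: homog_add hP (homog_opp (homog_mul hb hP)).
have hd' : homog 0 1 d' by rewrite d'E; apply: homog_mul (homog_mul hinc1 hd) hpr1.
have ltA' : (#|A'| < N)%N.
  have jAi : j \in A :\ i by rewrite !inE eq_sym nij.
  by move: leA; rewrite (cardsD1 i A) iA (cardsD1 j (A :\ i)) jAi -/A' !add1n ltnS; apply: leq_trans.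
have [H [inc [pr [s [[ip id' dp' one] [Hi iP Pp pH] [hi hp hs]]]]]] := IHN A' ltA' d' d'd' Pd' d'P hd'.
exists H, (inc *m inc1), (pr1 *m pr), (s1 + pr1 *m s *m inc1); split; split.
- by rewrite mulmxA -(mulmxA inc) F1 iP ip.
- by rewrite -mulmxA incd mulmxA id' mul0mx.
- by rewrite mulmxA dpr -mulmxA dp' mulmx0.
- rewrite mulmxDl mulmxDr -aE -bE.
  have -> : pr1 *m pr *m (inc *m inc1) = pr1 *m (pr *m inc) *m inc1 by rewrite !mulmxA.
  have -> : d *m (pr1 *m s *m inc1) = pr1 *m (d' *m s) *m inc1 by rewrite !mulmxA dpr.
  have -> : pr1 *m s *m inc1 *m d = pr1 *m (s *m d') *m inc1 by rewrite -!mulmxA incd.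
  transitivity (pr1 *m (pr *m inc + d' *m s + s *m d') *m inc1 + a + b).
    rewrite !mulmxDr !mulmxDl.
    move: (pr1 *m (pr *m inc) *m inc1) (pr1 *m (d' *m s) *m inc1) (pr1 *m (s *m d') *m inc1) => u v w.
    by rewrite !addrA (addrAC _ b w) (addrAC _ a v) (addrAC _ a w).
  rewrite one -/P prP.
  by rewrite F2 addrAC !subrK.
- by rewrite mulmxA Hi.
- by rewrite -mulmxA inc1E mulmxBl -mulmxA aA PA.
- by rewrite mulmxA pr1E mulmxBr mulmxA Ab AP'.
- by rewrite -mulmxA pH.
- exact: homog_mul hi hinc1.
- exact: homog_mul hpr1 hp.
- apply: homog_add hs1 _; exact: homog_mul (homog_mul hpr1 hs) hinc1.
Qed.

End Elimination.

(** * Tensor powers of a contraction *)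

Section Letterwise.
Variables (K : fieldType) (n N : nat).
Local Notation X := (mon n * {set 'I_N})%type.
Local Notation NS := #|{: {set 'I_N}}|.
Implicit Types (x y : X) (w : seq X) (S T : {set 'I_N}) (A B : 'M[K]_NS) (f : seq X -> K).

Definition lmx A x : seq (K * X) :=
  [seq (A (enum_rank x.2) (enum_rank T), (x.1, T)) | T <- enum {set 'I_N}].

Lemma lin_lmx A x g : lin (lmx A x) g = \sum_T A (enum_rank x.2) (enum_rank T) * g (x.1, T).
Proof. by rewrite /lin big_map big_enum. Qed.

Lemma lmxM A B x g : lin (lmx A x) (fun y => lin (lmx B y) g) = lin (lmx (A *m B) x) g.
Proof.
rewrite !lin_lmx; under eq_bigr do rewrite lin_lmx mulr_sumr.
rewrite exchange_big; apply: eq_bigr => T _; rewrite mxE mulr_suml /=.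
rewrite [RHS](reindex (@enum_rank {set 'I_N})) /=; last first.
  by exists enum_val => i _; rewrite ?enum_rankK ?enum_valK.
by apply: eq_bigr => S _; rewrite mulrA.
Qed.

Lemma lmxD A B x g : lin (lmx (A + B) x) g = lin (lmx A x) g + lin (lmx B x) g.
Proof.
by rewrite !lin_lmx -big_split; apply: eq_bigr => T _; rewrite mxE mulrDl.
Qed.

Lemma lmx1 x g : lin (lmx 1%:M x) g = g x.
Proof.
rewrite lin_lmx (bigD1 x.2) //= mxE eqxx mul1r big1 -?surjective_pairing ?addr0 // => T nT.
by rewrite mxE (inj_eq enum_rank_inj) eq_sym (negPf nT) mul0r.
Qed.

Lemma lmx_sel (C : {set 'I_NS}) x g :
  lin (lmx (sel K (fun i => i \in C)) x) g = (enum_rank x.2 \in C)%:R * g x.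
Proof.
rewrite lin_lmx (bigD1 x.2) //= !mxE eqxx mulr1n big1 -?surjective_pairing ?addr0 // => T nT.
by rewrite !mxE (inj_eq enum_rank_inj) eq_sym (negPf nT) mulr0n mul0r.
Qed.

Lemma eq_lmx A x g g' :
  (forall T, A (enum_rank x.2) (enum_rank T) != 0 -> g (x.1, T) = g' (x.1, T)) ->
  lin (lmx A x) g = lin (lmx A x) g'.
Proof.
move=> e; rewrite !lin_lmx; apply: eq_bigr => T _.
by case: (eqVneq (A (enum_rank x.2) (enum_rank T)) 0) => [->|/e ->] //; rewrite !mul0r.
Qed.

Fixpoint tens A f w : K :=
  if w is x :: w' then lin (lmx A x) (fun x' => tens A (fun w1 => f (x' :: w1)) w')
  else f [::].

Lemma eq_tens A f g w : f =1 g -> tens A f w = tens A g w.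
Proof.
elim: w f g => [|x w IHw] f g e /=; first exact: e.
apply: eq_lmx => T _.
by apply: IHw => w1; rewrite e.
Qed.

Lemma tensZ A c f w : tens A (fun w => c * f w) w = c * tens A f w.
Proof.
elim: w f => //= x w IHw f; rewrite -linZ; apply: eq_lmx => T _; exact: IHw.
Qed.

Lemma tensD A f g w : tens A (fun w => f w + g w) w = tens A f w + tens A g w.
Proof.
elim: w f g => //= x w IHw f g; rewrite -linD; apply: eq_lmx => T _; exact: IHw.
Qed.

Lemma tens_sum A (J : Type) (r : seq J) (c : J -> K) (F : J -> seq X -> K) w :
  tens A (fun w => \sum_(j <- r) c j * F j w) w = \sum_(j <- r) c j * tens A (F j) w.
Proof.
elim: r => [|j r IHr].
  rewrite big_nil -[RHS](mul0r (tens A (fun=> 0) w)) -tensZ.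
  by apply: eq_tens => w'; rewrite big_nil mul0r.
rewrite big_cons -IHr -tensZ -tensD; apply: eq_tens => w'.
by rewrite big_cons.
Qed.

Lemma tens_lin A (Y : Type) (l : seq (K * Y)) (F : Y -> seq X -> K) w :
  tens A (fun w => lin l (fun t => F t w)) w = lin l (fun t => tens A (F t) w).
Proof. exact: tens_sum. Qed.

Lemma tensM A B f w : tens A (tens B f) w = tens (A *m B) f w.
Proof.
elim: w f => //= x w IHw f; rewrite -lmxM; apply: eq_lmx => T _.
rewrite tens_lin; apply: eq_lmx => T' _; exact: IHw.
Qed.

Lemma tens_sel (C : {set 'I_NS}) f w :
  tens (sel K (fun i => i \in C)) f w = (all (fun x => enum_rank x.2 \in C) w)%:R * f w.
Proof.
elim: w f => [|x w IHw] f /=; first by rewrite mul1r.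
by rewrite lmx_sel IHw mulrA -natrM mulnb.
Qed.

Lemma tens_local A (r : rel {set 'I_N}) :
  (forall S T, A (enum_rank S) (enum_rank T) != 0 -> r S T) ->
  forall f g w, (forall w', all2 (fun x x' => (x.1 == x'.1) && r x.2 x'.2) w w' -> f w' = g w') ->
  tens A f w = tens A g w.
Proof.
move=> Ar f g w; elim: w f g => [|x w IHw] f g fg /=; first exact: fg.
apply: eq_lmx => T /Ar rT; apply: IHw => w' h; apply: fg => /=.
by rewrite eqxx rT.
Qed.

Section Homotopy.
Variables (d inc pr s : 'M[K]_NS).
Local Notation e := (pr *m inc).
Hypotheses (id0 : inc *m d = 0) (dp0 : d *m pr = 0) (one : e + d *m s + s *m d = 1%:M).

Local Notation lpar := (@lpar K n N).
Hypothesis d_odd : forall S T, d (enum_rank S) (enum_rank T) != 0 -> par K T = - par K S.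
Hypothesis s_odd : forall S T, s (enum_rank S) (enum_rank T) != 0 -> par K T = - par K S.
Hypothesis e_even : forall S T, e (enum_rank S) (enum_rank T) != 0 -> par K T = par K S.
Hypothesis inc_even : forall S T, inc (enum_rank S) (enum_rank T) != 0 -> par K T = par K S.

Definition Dl f w : K := bard (lmx d) (fun _ _ => [::]) lpar f w.
Arguments Dl : simpl never.

Lemma Dl_cons f x w :
  Dl f (x :: w) = - lin (lmx d x) (fun x' => f (x' :: w)) + lpar x * Dl (fun w1 => f (x :: w1)) w.
Proof. by rewrite /Dl /=; case: w => [|y w]; rewrite ?[lin [::] _]/lin ?big_nil ?add0r. Qed.

(** The tensor-power homotopy: s on one letter, the projection e on the letters before it, the
    identity on those after it. *)
Fixpoint Sw f w : K :=
  if w is x :: w' then - lin (lmx s x) (fun x' => f (x' :: w'))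
    + lpar x * lin (lmx e x) (fun x' => Sw (fun w1 => f (x' :: w1)) w')
  else 0.

Lemma eq_Sw f g w : f =1 g -> Sw f w = Sw g w.
Proof.
elim: w f g => [//|x w IHw] f g h /=; congr (- _ + _ * _); apply: eq_lmx => T _ //.
by apply: IHw => w1; rewrite h.
Qed.

Lemma SwZ c f w : Sw (fun w => c * f w) w = c * Sw f w.
Proof.
elim: w f => [|x w IHw] f /=; first by rewrite mulr0.
rewrite linZ [X in _ + _ * X](_ : _ = c * lin (lmx e x) (fun x' => Sw (fun w1 => f (x' :: w1)) w)); first ring.
by rewrite -linZ; apply: eq_lmx => T _; apply: IHw.
Qed.

Lemma SwD f g w : Sw (fun w => f w + g w) w = Sw f w + Sw g w.
Proof.
elim: w f g => [|x w IHw] f g /=; first by rewrite addr0.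
rewrite linD [X in _ + _ * X](_ : _ = lin (lmx e x) (fun x' => Sw (fun w1 => f (x' :: w1)) w)
  + lin (lmx e x) (fun x' => Sw (fun w1 => g (x' :: w1)) w)); first ring.
by rewrite -linD; apply: eq_lmx => T _; apply: IHw.
Qed.

Lemma Sw_sum (J : Type) (r : seq J) (c : J -> K) (F : J -> seq X -> K) w :
  Sw (fun w => \sum_(j <- r) c j * F j w) w = \sum_(j <- r) c j * Sw (F j) w.
Proof.
elim: r => [|j r IHr].
  rewrite big_nil -[RHS](mul0r (Sw (fun=> 0) w)) -SwZ.
  by apply: eq_Sw => w'; rewrite big_nil mul0r.
rewrite big_cons -IHr -SwZ -SwD; apply: eq_Sw => w'.
by rewrite big_cons.
Qed.

Lemma Sw_lin (Y : Type) (l : seq (K * Y)) (F : Y -> seq X -> K) w :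
  Sw (fun w => lin l (fun t => F t w)) w = lin l (fun t => Sw (F t) w).
Proof. exact: Sw_sum. Qed.

Lemma lmx0 x g : lin (lmx 0 x) g = 0.
Proof. by rewrite lin_lmx big1 // => T _; rewrite mxE mul0r. Qed.

Lemma Dl_lin (Y : Type) (l : seq (K * Y)) (F : Y -> seq X -> K) w :
  Dl (fun w => lin l (fun t => F t w)) w = lin l (fun t => Dl (F t) w).
Proof. exact: bard_lin. Qed.

Lemma Dl_tens f w : Dl (tens pr f) w = 0.
Proof.
elim: w f => [//|x w IHw] f; rewrite Dl_cons /= lmxM dp0 lmx0 oppr0 add0r.
rewrite Dl_lin lin0 ?mulr0 // => p _; exact: IHw.
Qed.

Lemma tens_Dl f w : tens inc (Dl f) w = 0.
Proof.
elim: w f => [//|x w IHw] f /=.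
rewrite (eq_lmx (g' := fun x' => -1 * lin (lmx d x') (fun x2 => tens inc (fun w1 => f (x2 :: w1)) w))).
  by rewrite linZ lmxM id0 lmx0 mulr0.
move=> T _; rewrite (eq_tens inc (g := fun w1 => -1 * lin (lmx d (x.1, T)) (fun x' => f (x' :: w1))
   + lpar (x.1, T) * Dl (fun w2 => f ((x.1, T) :: w2)) w1)) => [|w1].
  by rewrite tensD !tensZ IHw mulr0 addr0 tens_lin.
by rewrite [LHS]Dl_cons mulN1r.
Qed.

(** Terms in which d meets e vanish, and the mixed terms with s on the first letter and d on a later
    one cancel by parity. The induction hypothesis and the identity [one] on the first letter give
    the rest. *)
Lemma tens_homotopy f w : tens pr (tens inc f) w + Dl (Sw f) w + Sw (Dl f) w = f w.
Proof.
elim: w f => [|x w IHw] f; first by rewrite /Dl /= !addr0.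
pose L A (F : X -> K) := lin (lmx A x) F.
have -> : tens pr (tens inc f) (x :: w) =
    L e (fun y => tens pr (tens inc (fun w1 => f (y :: w1))) w).
  by rewrite /= /L -lmxM; apply: eq_lmx => T _; rewrite -tens_lin.
have -> : Dl (Sw f) (x :: w) = L (d *m s) (fun y => f (y :: w))
    - lpar x * L s (fun y => Dl (fun w1 => f (y :: w1)) w)
    + L e (fun y => Dl (Sw (fun w1 => f (y :: w1))) w).
  rewrite Dl_cons.
  rewrite (eq_lmx (g' := fun y => -1 * lin (lmx s y) (fun z => f (z :: w))
      - lpar x * lin (lmx e y) (fun z => Sw (fun w1 => f (z :: w1)) w))); last first.
    by move=> T /d_odd o /=; rewrite /lpar o mulN1r mulNr.
  rewrite linD linN !linZ !lmxM mulmxA dp0 mul0mx lmx0 mulr0 subr0.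
  rewrite /Dl (eq_bard _ _ _ (g := fun w1 => -1 * lin (lmx s x) (fun y => f (y :: w1))
      + lpar x * lin (lmx e x) (fun y => Sw (fun w2 => f (y :: w2)) w1))); last first.
    by move=> w1 /=; rewrite mulN1r.
  rewrite bardD !bardZ !bard_lin -/(Dl _ _) /L.
  rewrite mulrDr [lpar x * (lpar x * _)]mulrA par_sq mul1r; ring.
have -> : Sw (Dl f) (x :: w) = L (s *m d) (fun y => f (y :: w))
    + lpar x * L s (fun y => Dl (fun w1 => f (y :: w1)) w)
    + L e (fun y => Sw (Dl (fun w1 => f (y :: w1))) w).
  rewrite /= (eq_lmx (A := s) (g' := fun y => -1 * lin (lmx d y) (fun z => f (z :: w))
      - lpar x * Dl (fun w1 => f (y :: w1)) w)); last first.
    by move=> T /s_odd o /=; rewrite Dl_cons /lpar o mulN1r mulNr.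
  rewrite linD linN !linZ !lmxM.
  rewrite (eq_lmx (A := e) (g' := fun y => -1 * lin (lmx d y) (fun z => Sw (fun w1 => f (z :: w1)) w)
     + lpar x * Sw (Dl (fun w1 => f (y :: w1))) w)); last first.
    move=> T /e_even ev.
    rewrite (eq_Sw (g := fun w1 => -1 * lin (lmx d (x.1, T)) (fun z => f (z :: w1))
      + lpar x * Dl (fun w2 => f ((x.1, T) :: w2)) w1)); last first.
      by move=> w1; rewrite Dl_cons mulN1r /lpar ev.
    by rewrite SwD !SwZ Sw_lin.
  rewrite linD !linZ lmxM -mulmxA id0 mulmx0 lmx0 mulr0 add0r /L.
  rewrite [lpar x * (lpar x * _)]mulrA par_sq mul1r; ring.
transitivity (L (d *m s) (fun y => f (y :: w)) + L (s *m d) (fun y => f (y :: w))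
   + L e (fun y => f (y :: w))).
  rewrite -[L e (fun y => f (y :: w))](eq_lmx (g := fun y => tens pr (tens inc (fun w1 => f (y :: w1))) w
    + Dl (Sw (fun w1 => f (y :: w1))) w + Sw (Dl (fun w1 => f (y :: w1))) w)); last by move=> T _; apply: IHw.
  rewrite !linD -!/(L _ _); ring.
by rewrite /L -!lmxD addrC addrA one lmx1.
Qed.

Lemma Sw_local (r : rel {set 'I_N}) :
  (forall S T, s (enum_rank S) (enum_rank T) != 0 -> r S T /\ #|T| = #|S|.+1) ->
  (forall S T, e (enum_rank S) (enum_rank T) != 0 -> r S T /\ #|T| = #|S|) ->
  (forall S, r S S) ->
  forall f g w, (forall w', all2 (fun x x' => (x.1 == x'.1) && r x.2 x'.2) w w' ->
    wsum (@lcard n N) w' = (wsum (@lcard n N) w).+1 -> f w' = g w') ->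
  Sw f w = Sw g w.
Proof.
move=> Sr Er rr f g w; elim: w f g => [//|x w IHw] f g fg /=.
congr (- _ + _ * _).
  apply: eq_lmx => T /Sr[rT cT]; apply: fg; first rewrite /= eqxx rT /=.
    by elim: (w) => //= y v ->; rewrite eqxx rr.
  by rewrite !wsum_cons /lcard /= cT addSn.
apply: eq_lmx => T /Er[rT cT]; apply: IHw => w' h c; apply: fg => /=.
  by rewrite eqxx rT.
by rewrite !wsum_cons /lcard /= cT -addnS c.
Qed.

End Homotopy.
End Letterwise.

(** * Homology of the level slices *)

Section TightHomology.
Variables (K : fieldType) (n N : nat) (gens : 'I_N -> mon n).
Hypothesis gens2 : forall i, (2 <= mdeg (gens i))%N.
Local Notation X := (mon n * {set 'I_N})%type.
Local Notation NS := #|{: {set 'I_N}}|.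
Local Notation mS := (mS gens).
Local Notation rk := (rk gens).
Local Notation lvalid := (lvalid gens).
Local Notation wgt := (wgt gens).
Local Notation tight := (tight gens).
Local Notation hgt := (@hgt n N).
Local Notation lcard := (@lcard n N).
Local Notation sg := (@sg K N).
Implicit Types (x y : X) (w : seq X) (S T : {set 'I_N}).

(** The label preserved by tight deletions. It determines validity and weight of a letter of given
    degree, so maps homogeneous for it preserve the level of words. *)
Definition kappa (i : 'I_NS) : mon n * nat := (mS (enum_val i), rk (enum_val i)).

Definition lsize (i : 'I_NS) : nat := #|enum_val i|.

(** The degree [mzero n] is a placeholder that [ldel] passes along. *)
Definition tight_mx : 'M[K]_NS := \matrix_(i, k)
  lin (ldel K tight (mzero n, enum_val i)) (fun y => (y.2 == enum_val k)%:R).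

Lemma lin_tight_mx x g : lin (lmx tight_mx x) g = lin (ldel K tight x) g.
Proof.
rewrite lin_lmx lin_ldel.
transitivity (\sum_T \sum_(i in x.2 | tight x.2 i) sg [set i] (x.2 :\ i) * ((x.2 :\ i == T)%:R * g (x.1, T))).
  apply: eq_bigr => T _; rewrite mxE !enum_rankK lin_ldel mulr_suml.
  by apply: eq_bigr => i _; rewrite mulrA.
rewrite exchange_big; apply: eq_bigr => i _; rewrite -mulr_sumr; congr (_ * _).
rewrite (bigD1 (x.2 :\ i)) //= eqxx mul1r big1 ?addr0 // => T nT.
by rewrite eq_sym (negPf nT) mul0r.
Qed.

Lemma tight_mx_sq : tight_mx *m tight_mx = 0.
Proof.
apply/matrixP => i k; rewrite -[i]enum_valK -[k]enum_valK.
have := lin_tight_mx (mzero n, enum_val i)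
  (fun x => lin (lmx tight_mx x) (fun y => (y.2 == enum_val k)%:R)).
rewrite (lmxM tight_mx tight_mx (mzero n, enum_val i)) lin_lmx (bigD1 (enum_val k)) //= eqxx mulr1.
rewrite big1 ?addr0 => [->|T nT]; last by rewrite (negPf nT) mulr0.
rewrite (eq_lin (g' := fun x => lin (ldel K tight x) (fun y => (y.2 == enum_val k)%:R))).
  by rewrite ldel_sq ?mxE //; apply: tight_comm.
by move=> p _; rewrite lin_tight_mx.
Qed.

Lemma tight_mx_homog : homog kappa lsize 0 1 tight_mx.
Proof.
move=> i k; rewrite mxE lin_ldel => ne.
have [l [li tl e]] : exists l, [/\ l \in enum_val i, tight (enum_val i) l & enum_val i :\ l = enum_val k].
  case: (pickP (fun l => [&& l \in enum_val i, tight (enum_val i) l & enum_val i :\ l == enum_val k])).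
    by move=> l /and3P[? ? /eqP ?]; exists l.
  move=> none; case/eqP: ne; apply: big1 => l /andP[li tl]; have := none l.
  by rewrite /= li tl /= => ->; rewrite mulr0.
by rewrite /kappa /lsize -e tight_mS // (eqP tl) addn0 addn1 (cardsD1 l (enum_val i)) li add1n.
Qed.

Lemma D0_Dl f w : D0 gens f w = Dl tight_mx f w :> K.
Proof. by apply: bard_eq_lin => // x g; rewrite lin_tight_mx. Qed.

Definition same_kappa : rel {set 'I_N} := fun S T => (mS S == mS T) && (rk S == rk T).

Lemma same_kappa_word w w' :
  all2 (fun x x' => (x.1 == x'.1) && same_kappa x.2 x'.2) w w' ->
  [/\ all lvalid w' = all lvalid w, wdeg w' = wdeg w, wsum wgt w' = wsum wgt w & size w' = size w].
Proof.
elim: w w' => [|x w IHw] [|x' w'] //= /andP[/andP[/eqP e1 /andP[/eqP eS /eqP er]] /IHw[v d g ->]].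
by split=> //; rewrite ?v ?d ?wsum_cons ?g /lvalid /wgt e1 ?eS ?er.
Qed.

Variables (H : {set 'I_NS}) (inc pr s : 'M[K]_NS).
Local Notation selH := (sel K (fun i => i \in H)).
Hypotheses (ip : inc *m pr = selH) (id0 : inc *m tight_mx = 0) (dp0 : tight_mx *m pr = 0)
  (one : pr *m inc + tight_mx *m s + s *m tight_mx = 1%:M) (prH : pr *m selH = pr).
Hypotheses (hinc : homog kappa lsize 0 0 inc) (hpr : homog kappa lsize 0 0 pr)
  (hs : homog kappa lsize 1 0 s).

Definition hword w := all (fun x : X => enum_rank x.2 \in H) w.

Lemma homog_entry a b (M : 'M[K]_NS) S T : homog kappa lsize a b M ->
  M (enum_rank S) (enum_rank T) != 0 -> same_kappa S T /\ (#|S| + a = #|T| + b)%N.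
Proof.
move=> h /h; rewrite /kappa /lsize !enum_rankK => -[[e1 e2] ->].
by rewrite /same_kappa e1 e2 !eqxx.
Qed.

Lemma homog_even (M : 'M[K]_NS) S T : homog kappa lsize 0 0 M ->
  M (enum_rank S) (enum_rank T) != 0 -> par K T = par K S.
Proof. by move=> h /(homog_entry h)[_]; rewrite !addn0 /par => ->. Qed.

Lemma odd_entry S T : s (enum_rank S) (enum_rank T) != 0 -> par K T = - par K S.
Proof.
move=> /(homog_entry hs)[_]; rewrite addn0 addn1 /par => <-.
by rewrite [in LHS]exprS mulN1r.
Qed.

Lemma tight_entry S T : tight_mx (enum_rank S) (enum_rank T) != 0 -> par K T = - par K S.
Proof.
move=> /(homog_entry tight_mx_homog)[_]; rewrite addn0 addn1 /par => ->.
by rewrite [in RHS]exprS mulN1r opprK.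
Qed.

Lemma hpi : homog kappa lsize 0 0 (pr *m inc).
Proof. exact: homog_mul hpr hinc. Qed.

Variable j : mon n.
Local Notation barwords := (barwords gens j).
Local Notation wd := (@wd _ barwords).
Local Notation Nw := (size barwords).

Definition same_size : rel {set 'I_N} := fun S T => same_kappa S T && (#|S| == #|T|).

Lemma same_size_word w w' :
  all2 (fun x x' => (x.1 == x'.1) && same_size x.2 x'.2) w w' ->
  [/\ all lvalid w' = all lvalid w, wdeg w' = wdeg w, dlt gens w' = dlt gens w & hgt w' = hgt w].
Proof.
move=> h; have : all2 (fun x x' => (x.1 == x'.1) && same_kappa x.2 x'.2) w w'.
  elim: w w' h => [|x w IHw] [|x' w'] //= /andP[/andP[-> /andP[-> _]] /IHw ->] //.
case/same_kappa_word => v d g sz; split=> //; first by rewrite /dlt g sz.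
rewrite /hgt sz; congr (_ + _)%N.
elim: w w' h {v d g sz} => [|x w IHw] [|x' w'] //= /andP[/andP[_ /andP[_ /eqP c]] /IHw e].
by rewrite !wsum_cons e /lcard c.
Qed.

Lemma even_same (M : 'M[K]_NS) S T : homog kappa lsize 0 0 M ->
  M (enum_rank S) (enum_rank T) != 0 -> same_size S T.
Proof. by move=> h /(homog_entry h)[ks]; rewrite !addn0 /same_size ks => ->; rewrite eqxx. Qed.

Lemma tens_operates (M : 'M[K]_NS) : homog kappa lsize 0 0 M -> operates barwords (tens M).
Proof.
move=> h; split=> [*|]; first exact: tens_sum.
apply: bar_local => w f g vw fg; apply: (tens_local (r := same_size)) => [S T|w' /same_size_word[v d _ _]].
  exact: even_same.
by apply: fg; rewrite ?v.
Qed.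

Lemma Sw_local_kappa w f g :
  (forall w', all2 (fun x x' => (x.1 == x'.1) && same_kappa x.2 x'.2) w w' ->
    wsum lcard w' = (wsum lcard w).+1 -> f w' = g w') ->
  Sw inc pr s f w = Sw inc pr s g w.
Proof.
apply: Sw_local => [S T|S T|S].
- by move=> /(homog_entry hs)[ks]; rewrite addn0 addn1 => ->.
- by move=> /(homog_entry hpi)[ks]; rewrite !addn0 => ->.
- by rewrite /same_kappa !eqxx.
Qed.

Lemma Sw_operates : operates barwords (Sw inc pr s).
Proof.
split=> [*|]; first exact: Sw_sum.
apply: bar_local => w f g vw fg; apply: Sw_local_kappa => w' /same_kappa_word[v d _ _] _.
by apply: fg; rewrite ?v.
Qed.

Local Notation mI := (mxo barwords (tens inc)).
Local Notation mP := (mxo barwords (tens pr)).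
Local Notation mH := (mxo barwords (Sw inc pr s)).
Local Notation M0 := (M0 K gens j).
Local Notation ub := (uniq_barwords gens j).

Lemma tens_supp (M : 'M[K]_NS) i k : homog kappa lsize 0 0 M -> mxo barwords (tens M) i k != 0 ->
  dlt gens (wd k) = dlt gens (wd i) /\ hgt (wd k) = hgt (wd i).
Proof.
move=> h ne; pose Q w w' := (dlt gens w' == dlt gens w) && (hgt w' == hgt w).
suff /andP[/eqP-> /eqP->] : Q (wd i) (wd k) by [].
apply: (mxo_supp ne) => f f0.
rewrite (tens_local (r := same_size) _ (g := fun=> 0)) => [|S T|w' /same_size_word[_ _ d c]].
- by rewrite -[RHS](mul0r (tens M (fun=> 0) (wd i))) -tensZ; apply: eq_tens => w; rewrite mul0r.
- exact: even_same.
- by apply: f0; rewrite /Q d c !eqxx.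
Qed.

Lemma pr_supp i k : mP i k != 0 -> hword (wd k).
Proof.
move=> ne; pose Q (w w' : seq X) := hword w'; suff : Q (wd i) (wd k) by [].
apply: (mxo_supp ne) => f f0.
rewrite -prH -tensM.
rewrite -[RHS](mul0r (tens pr (fun=> 0) (wd i))) -tensZ; apply: eq_tens => w.
rewrite mul0r tens_sel -/(hword w); case: (boolP (hword w)) => [/f0->|_]; by rewrite ?mulr0 ?mul0r.
Qed.

Lemma Sw_supp i k : mH i k != 0 ->
  dlt gens (wd k) = dlt gens (wd i) /\ hgt (wd k) = (hgt (wd i)).+1.
Proof.
move=> ne; pose Q w w' := (dlt gens w' == dlt gens w) && (hgt w' == (hgt w).+1).
suff /andP[/eqP-> /eqP->] : Q (wd i) (wd k) by [].
apply: (mxo_supp ne) => f f0.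
rewrite (Sw_local_kappa (g := fun=> 0)) => [|w' /same_kappa_word[_ _ g sz] c].
  by rewrite -[RHS](mul0r (Sw inc pr s (fun=> 0) (wd i))) -SwZ; apply: eq_Sw => w; rewrite mul0r.
by apply: f0; rewrite /Q /dlt g sz /hgt sz c !eqxx.
Qed.

Definition h_slice p h : pred 'I_Nw := fun i => eq_slice p h i && hword (wd i).

(** The tensor powers of [inc] and [pr], with [Sw], retract a slice onto the words whose exterior
    parts all lie in H. *)
Lemma h_slice_rank p h :
  #|eq_slice (gens := gens) (j := j) p h| = (#|h_slice p h| + \rank (sel K (eq_slice p h) *m M0)
    + \rank (sel K (eq_slice p h.+1) *m M0))%N.
Proof.
apply: (contraction_rank (I := mI) (P := mP) (S := mH) (Hall := fun i => hword (wd i))).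
- exact: M0_sq.
- rewrite -(@mxo_comp K _ _ ub (tens inc) (tens pr) (tens_operates hinc)).
  apply/matrixP => i k; rewrite !mxE tensM ip tens_sel -/(hword _) /dirac (inj_eq (wd_inj ub)).
  by case: eqP => [->|_]; rewrite ?mulr1n ?mulr1 ?mulr0 ?mulr0n.
- rewrite -(@mxo_comp K _ _ ub (tens inc) (D0 gens) (tens_operates hinc)).
  apply/matrixP => i k; rewrite !mxE.
  rewrite (eq_tens inc (g := Dl tight_mx (dirac K k))); last by move=> w; rewrite D0_Dl.
  rewrite tens_Dl // => S T; exact: homog_even.
- rewrite -(@mxo_comp K _ _ ub (D0 gens) (tens pr) (D0_operates K gens2 j)).
  by apply/matrixP => i k; rewrite !mxE D0_Dl Dl_tens.
- rewrite -(@mxo_comp K _ _ ub (tens pr) (tens inc) (tens_operates hpr)).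
  rewrite -(@mxo_comp K _ _ ub (D0 gens) (Sw inc pr s) (D0_operates K gens2 j)).
  rewrite -(@mxo_comp K _ _ ub (Sw inc pr s) (D0 gens) Sw_operates).
  apply/matrixP => i k; rewrite !mxE D0_Dl.
  rewrite (eq_Sw _ _ _ (f := D0 gens (dirac K k)) (g := Dl tight_mx (dirac K k))); last by move=> w; rewrite D0_Dl.
  rewrite tens_homotopy //; first by rewrite /dirac (inj_eq (wd_inj ub)).
  + exact: tight_entry.
  + exact: odd_entry.
  + by move=> S T; apply: homog_even hpi.
- by move=> k /andP[].
- move=> i k /andP[/eqP dp /eqP dh] ne; have [d c] := tens_supp hpr ne.
  by rewrite /h_slice /eq_slice d c dp dh !eqxx (pr_supp ne).
- move=> i k /andP[/andP[/eqP dp /eqP dh] _] /(tens_supp hinc)[d c].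
  by rewrite /eq_slice d c dp dh !eqxx.
- move=> i k /andP[/eqP dp /eqP dh] /Sw_supp[d c].
  by rewrite /eq_slice d c dp dh !eqxx.
- move=> i k /andP[/eqP dp /eqP dh] /(M0_supp gens2)[c d].
  by rewrite /eq_slice -d dp eqxx -eqSS -c dh eqxx.
Qed.

End TightHomology.

(* b p h is the Betti number of the p-th filtration stage; the long exact sequences of the
   filtration degenerate into b p h.+1 = c p h.+1 - b p.+1 h. *)
Lemma slice_telescope (ge rD r0 e c : nat -> nat -> nat) :
  (forall p h, r0 p h.+1 + ge p.+1 h = rD p h.+1 + rD p.+1 h)%N ->
  (forall p h, e p h = c p h + r0 p h + r0 p h.+1)%N ->
  (forall p h, ge p h = e p h + ge p.+1 h)%N ->
  (forall p, r0 p 0 = 0)%N -> (forall p, rD p 0 = 0)%N ->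
  forall h p, (ge p h)%:Z - (rD p h)%:Z - (rD p h.+1)%:Z =
    \sum_(k < h.+1) (-1) ^+ k * (c (p + k)%N (h - k)%N)%:Z.
Proof.
move=> sl con geE r00 rD0; elim=> [|h IHh] p.
  rewrite big_ord1 expr0 mul1r addn0 subn0 rD0 subr0.
  by have := sl p 0%N; have := con p 0%N; have := geE p 0%N; rewrite r00 rD0; lia.
rewrite big_ord_recl expr0 mul1r addn0 subn0.
rewrite (eq_bigr (fun k : 'I_h.+1 => - ((-1) ^+ k * (c (p.+1 + k)%N (h - k)%N)%:Z))).
  rewrite sumrN -IHh.
  have := sl p h; have := sl p h.+1; have := con p h.+1; have := geE p h.+1; lia.
by move=> k _; rewrite /= /bump /= add1n exprS mulN1r mulNr addnS subSS.
Qed.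

(** * Betti numbers of the Taylor bar complex *)

Section BettiNumbers.
Variables (K : fieldType) (n N : nat) (gens : 'I_N -> mon n).
Hypothesis gens2 : forall i, (2 <= mdeg (gens i))%N.
Local Notation X := (mon n * {set 'I_N})%type.
Local Notation NS := #|{: {set 'I_N}}|.
Local Notation hgt := (@hgt n N).
Variables (H : {set 'I_NS}) (inc pr s : 'M[K]_NS).
Local Notation selH := (sel K (fun i => i \in H)).
Local Notation homog := (homog (kappa gens) (@lsize N)).
Local Notation tight_mx := (tight_mx K gens).
Hypotheses (ip : inc *m pr = selH) (id0 : inc *m tight_mx = 0) (dp0 : tight_mx *m pr = 0)
  (one : pr *m inc + tight_mx *m s + s *m tight_mx = 1%:M) (prH : pr *m selH = pr).
Hypotheses (hinc : homog 0 0 inc) (hpr : homog 0 0 pr) (hs : homog 1 0 s).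
Variable j : mon n.
Local Notation barwords := (barwords gens j).
Local Notation wd := (@wd _ barwords).
Local Notation MD := (MD K gens j).

Lemma rank_hgt0 (M : 'M[K]_(size barwords)) (A : pred 'I_(size barwords)) :
  (forall i k, M i k != 0 -> hgt (wd i) = (hgt (wd k)).+1) ->
  (forall i, A i -> hgt (wd i) = 0%N) -> \rank (sel K A *m M) = 0%N.
Proof.
move=> hM hA; apply/eqP; rewrite mxrank_eq0; apply/eqP/matrixP => i k.
rewrite sel_mulE [RHS]mxE; have [/hA e|] := boolP (A i); last by rewrite mul0r.
by case: (eqVneq (M i k) 0) => [->|/hM]; rewrite ?mulr0 // e.
Qed.

(** Each level up costs one homological degree and a sign, so a word of level k and height h - k
    contributes (-1)^k in degree h. The double sum of [slice_telescope] at p = 0 is regrouped by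
    words. *)
Lemma betti_taylor h :
  (#|ge_slice (gens := gens) (j := j) 0 h|)%:Z - (\rank (sel K (ge_slice 0 h) *m MD))%:Z
    - (\rank (sel K (ge_slice 0 h.+1) *m MD))%:Z =
  \sum_(w <- barwords | hword H w && (dlt gens w + hgt w == h)%N) (-1) ^+ dlt gens w.
Proof.
rewrite (slice_telescope
  (ge := fun p h => #|ge_slice (gens := gens) (j := j) p h|)
  (rD := fun p h => \rank (sel K (ge_slice p h) *m MD))
  (r0 := fun p h => \rank (sel K (eq_slice p h) *m M0 K gens j))
  (e := fun p h => #|eq_slice (gens := gens) (j := j) p h|)
  (c := fun p h => #|h_slice (gens := gens) H (j := j) p h|)).
- rewrite (big_nth [::]) big_mkord.
  transitivity (\sum_(k < h.+1) \sum_(i : 'I_(size barwords) | h_slice (gens := gens) H k (h - k)%N i) (-1) ^+ k : int).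
    by apply: eq_bigr => k _; rewrite sumr_const add0n -mulr_natr natz.
  rewrite (exchange_big_dep (fun i : 'I_(size barwords) => hword H (wd i) && (dlt gens (wd i) + hgt (wd i) == h)%N)) /=.
    apply: eq_big => [i|i]; first by rewrite /wd (tnth_nth [::]).
    case/andP => hw /eqP eh.
    have lth : (dlt gens (wd i) < h.+1)%N by rewrite ltnS -eh leq_addr.
    rewrite (bigD1 (Ordinal lth)) /=; last by rewrite /h_slice /eq_slice hw -eh addKn !eqxx.
    rewrite big1 ?addr0 => [|k /andP[/andP[/andP[/eqP e _] _] /eqP nk]].
      by rewrite /wd (tnth_nth [::]).
    by case: nk; apply: val_inj.
  move=> k i _ /andP[/andP[/eqP -> /eqP ->] ->]; rewrite andTb subnKC //.
  by rewrite -ltnS.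
- by move=> p q; exact: (slice_rank K gens2).
- by move=> p q; apply: (h_slice_rank gens2 ip id0 dp0 one prH).
- move=> p q; rewrite -cardUI [X in (_ + X)%N]eq_card0 ?addn0.
    by apply: eq_card => i; rewrite !inE /ge_slice /eq_slice -andb_orl eq_sym -leq_eqVlt.
  move=> i; rewrite [RHS]inE; apply/negP; rewrite inE => /andP[/andP[/eqP ep _] /andP[]].
  by rewrite ep ltnn.
- by move=> p; apply: rank_hgt0 => [i k /(M0_supp gens2)[]|i /andP[_ /eqP]].
- by move=> p; apply: rank_hgt0 => [i k /(MD_supp gens2)[]|i /andP[_ /eqP]].
Qed.

End BettiNumbers.

(** * Comparison with the bar complex of R *)

Section Cone.
Variables (K : fieldType) (n N : nat) (gens : 'I_N -> mon n).
Hypothesis gens2 : forall i, (2 <= mdeg (gens i))%N.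
Local Notation X := (mon n * {set 'I_N})%type.
Local Notation mS := (mS gens).
Local Notation lvalid := (lvalid gens).
Local Notation wgt := (wgt gens).
Local Notation hgt := (@hgt n N).
Local Notation lcard := (@lcard n N).
Local Notation lpar := (@lpar K n N).
Local Notation sg := (@sg K N).
Local Notation Dall := (@Dall K n N).
Implicit Types (x y : X) (w : seq X) (S T : {set 'I_N}) (f : seq X -> K).

Definition divisor (u : mon n) : option 'I_N := [pick i | mdiv (gens i) u].

(** Words with a killed letter span a subcomplex, and the quotient by it is the bar complex of R.
    The subcomplex is shown to be acyclic. *)
Definition killed x : bool := isSome (divisor x.1).

(* Multiplication of the first letter lying over I by the exterior generator of a minimal
   generator dividing it. *)
Fixpoint cone f w : K :=
  if w is x :: w' then
    if divisor x.1 is Some i then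
      if i \in x.2 then 0 else - sg [set i] x.2 * f ((x.1, i |: x.2) :: w')
    else lpar x * cone (fun w1 => f (x :: w1)) w'
  else 0.

Lemma divisorP u i : divisor u = Some i -> mdiv (gens i) u.
Proof. by rewrite /divisor; case: pickP => // k h [<-]. Qed.

Lemma killedE x : killed x = [exists i, mdiv (gens i) x.1].
Proof.
rewrite /killed /divisor; case: pickP => [i h|none] /=; first by apply/esym/existsP; exists i.
by apply/esym/existsP => -[i]; rewrite none.
Qed.

Lemma divisor_none x : lvalid x -> divisor x.1 = None -> x.2 = set0.
Proof.
case/andP=> _ dx; rewrite /divisor; case: pickP => // none _.
apply/eqP/set0Pn => -[i ix]; have := none i; rewrite (mdiv_trans _ dx) //.
exact: gens_le_mS.
Qed.

Lemma eq_cone f g w : f =1 g -> cone f w = cone g w.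
Proof.
elim: w f g => [//|x w IHw] f g e /=; case: divisor => [i|]; first by rewrite e.
by rewrite (IHw _ (fun w1 => g (x :: w1))).
Qed.

Lemma coneZ c f w : cone (fun w => c * f w) w = c * cone f w.
Proof.
elim: w f => [|x w IHw] f /=; first by rewrite mulr0.
by case: divisor => [i|]; [case: ifP => _; [rewrite mulr0 | ring] | rewrite IHw; ring].
Qed.

Lemma coneD f g w : cone (fun w => f w + g w) w = cone f w + cone g w.
Proof.
elim: w f g => [|x w IHw] f g /=; first by rewrite addr0.
by case: divisor => [i|]; [case: ifP => _; [rewrite addr0 | ring] | rewrite IHw; ring].
Qed.

Lemma cone_sum (J : Type) (r : seq J) (c : J -> K) (F : J -> seq X -> K) w :
  cone (fun w => \sum_(j <- r) c j * F j w) w = \sum_(j <- r) c j * cone (F j) w.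
Proof.
elim: r => [|j r IHr].
  rewrite big_nil -[RHS](mul0r (cone (fun=> 0) w)) -coneZ.
  by apply: eq_cone => w'; rewrite big_nil mul0r.
rewrite big_cons -IHr -coneZ -coneD; apply: eq_cone => w'.
by rewrite big_cons.
Qed.

Definition cone_rel w w' : Prop :=
  [/\ all lvalid w -> all lvalid w', wdeg w' = wdeg w, size w' = size w,
      wsum lcard w' = (wsum lcard w).+1 & has killed w'].

Lemma cone_local f g w : (forall w', cone_rel w w' -> f w' = g w') -> cone f w = cone g w.
Proof.
elim: w f g => [//|x w IHw] f g fg /=; case ex : divisor => [i|].
  case: ifP => // ni; rewrite fg //; split=> //=.
  - move=> /andP[/andP[x0 dx] ->]; rewrite andbT /lvalid /= x0.
    apply/mS_le => k; rewrite !inE => /orP[/eqP->|kx]; first exact: divisorP ex.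
    exact: mdiv_trans (gens_le_mS gens kx) dx.
  - by rewrite !wsum_cons /lcard /= cardsU1 ni add1n.
  - by rewrite /killed /= ex.
congr (_ * _); apply: IHw => w' [v d sz c k]; apply: fg; split=> /=.
- by case/andP=> -> /v.
- by rewrite d.
- by rewrite sz.
- by rewrite !wsum_cons c addnS.
- by rewrite k orbT.
Qed.

Definition Ddel f w : K := bard (ldel K (fun _ _ => true)) (fun _ _ => [::]) lpar f w.
Arguments Ddel : simpl never.

Lemma Ddel_cons f x w :
  Ddel f (x :: w) = - lin (ldel K (fun _ _ => true) x) (fun x' => f (x' :: w))
     + lpar x * Ddel (fun w1 => f (x :: w1)) w.
Proof. by rewrite /Ddel /=; case: w => [|y w]; rewrite ?[lin [::] _]/lin ?big_nil ?add0r. Qed.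

Lemma lin_del x g : lin (ldel K (fun _ _ => true) x) g =
  \sum_(i in x.2) sg [set i] (x.2 :\ i) * g (x.1, x.2 :\ i).
Proof. by rewrite lin_ldel; apply: eq_bigl => i; rewrite andbT. Qed.

Lemma sg_swap S i k : i \notin S -> k \in S ->
  sg [set i] S * sg [set k] (i |: S :\ k) + sg [set k] (S :\ k) * sg [set i] (S :\ k) = 0.
Proof.
move=> iS kS; have nki : k != i by apply: contraNneq iS => <-.
have iSk : i \notin S :\ k by rewrite !inE (negPf iS) andbF.
rewrite -{1}(setD1K kS) sgUr ?disjoints1 ?setD11 //.
rewrite (sgUr _ [set k]) ?disjoints1 //.
have := @sg1_comm K _ i [set k]; rewrite inE eq_sym nki => /(_ isT); rewrite cards1 expr1 => e.
transitivity ((sg [set i] [set k] * sg [set k] [set i] + 1) * (sg [set i] (S :\ k) * sg [set k] (S :\ k))); first ring.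
by rewrite e addNr mul0r.
Qed.

(** Letters before the first killed one have S empty by [divisor_none], so no deletion happens
    there. On the killed letter this is the contraction of an exterior algebra by multiplication
    with a generator. *)
Lemma cone_del f w : all lvalid w -> has killed w ->
  cone (Ddel f) w + Ddel (cone f) w = f w.
Proof.
elim: w f => [//|x w IHw] f; rewrite [all _ _]/= [has _ _]/= => /andP[vx vw]; rewrite Ddel_cons.
have DN : divisor x.1 = None ->
    Ddel (fun w1 => cone f (x :: w1)) w = lpar x * Ddel (cone (fun w2 => f (x :: w2))) w.
  by move=> ex; rewrite -bardZ; apply: eq_bard => w1 /=; rewrite ex.
have DS i : divisor x.1 = Some i -> Ddel (fun w1 => cone f (x :: w1)) w =
    if i \in x.2 then 0 else - sg [set i] x.2 * Ddel (fun w1 => f ((x.1, i |: x.2) :: w1)) w.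
  move=> ex; case: ifP => iS; last by rewrite -bardZ; apply: eq_bard => w1 /=; rewrite ex iS.
  rewrite -[RHS](bard0 (ldel K (fun _ _ => true)) (fun _ _ => [::]) lpar w).
  by apply: eq_bard => w1 /=; rewrite ex iS.
move: (Ddel (fun w1 => cone f (x :: w1)) w) DN DS => t DN DS; rewrite /killed /=.
case ex : (divisor x.1) => [i|] /=; last first.
  move=> kw; have x0 := divisor_none vx ex; rewrite (DN ex) {DN DS}.
  rewrite (eq_cone (g := fun w1 => lpar x * Ddel (fun w2 => f (x :: w2)) w1)) => [|w1]; last first.
    by rewrite Ddel_cons lin_del x0 big_set0 oppr0 add0r.
  rewrite lin_del x0 big_set0 oppr0 add0r coneZ.
  by rewrite !mulrA par_sq !mul1r IHw.
move=> _; rewrite (DS _ ex) {DN DS}; have [iS|niS] := boolP (i \in x.2).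
  rewrite mulr0 addr0 add0r lin_del (bigD1 i) //= big1 => [|k /andP[kS nk]].
    rewrite ex !inE eqxx /= setD1K // addr0 mulNr mulrN opprK mulrA sg_sq mul1r.
    by rewrite -surjective_pairing.
  by rewrite ex !inE eq_sym nk iS mulr0.
rewrite Ddel_cons !lin_del /=.
rewrite big_disjointU ?disjoints1 //= big_set1 setU1K // -surjective_pairing.
rewrite [in X in _ + X](eq_bigr (fun k => - (sg [set k] (x.2 :\ k) * sg [set i] (x.2 :\ k) * f ((x.1, i |: (x.2 :\ k)) :: w)))); last first.
  by move=> k kS; rewrite ex !inE (negPf niS) andbF; ring.
rewrite sumrN opprK.
set A := \sum_(k in _) _; set B := \sum_(k in _) _.
have AB : sg [set i] x.2 * A + B = 0.
  rewrite /A /B mulr_sumr -big_split big1 //= => k kS.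
  have nki : k != i by apply: contraNneq niS => <-.
  have -> : (i |: x.2) :\ k = i |: x.2 :\ k.
    by rewrite setDUl; congr (_ :|: _); apply/setDidPl; rewrite disjoints1 inE eq_sym.
  rewrite mulrA -mulrDl sg_swap ?mul0r //.
have -> : lpar (x.1, i |: x.2) = - lpar x.
  by rewrite /lpar /par /= cardsU1 niS add1n exprS mulN1r.
have := sg_sq K [set i] x.2; move: AB; move: (sg _ _) A B (Ddel _ _) (lpar x) (f _) => a A B c l b e1 e2.
transitivity (a * a * b + (a * A + B)); first ring.
by rewrite e1 e2 mul1r addr0.
Qed.

Definition Dmul f w : K := bard (fun _ => [::]) (lmul K (@ldisj n N)) lpar f w.

Lemma Dall_del_mul f w : Dall f w = Ddel f w + Dmul f w.
Proof.
rewrite /Ddel /Dmul -bard_split; apply: bard_eq_lin => // x g.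
by rewrite cats0.
Qed.

Lemma Dmul_local f g w : (forall w', (size w' < size w)%N -> f w' = g w') -> Dmul f w = Dmul g w.
Proof. by apply: (bard_local lpar (R := fun w w' => (size w' < size w)%N)). Qed.

Lemma killed_divisor x x' : mdiv x.1 x'.1 -> killed x -> killed x'.
Proof.
by move=> d; rewrite !killedE => /existsP[i h]; apply/existsP; exists i; apply: mdiv_trans d.
Qed.

Lemma Dall_killed f g w : has killed w -> (forall w', has killed w' -> f w' = g w') ->
  Dall f w = Dall g w.
Proof.
move=> kw fg; apply: (bard_local lpar (R := fun w w' => has killed w -> has killed w')).
- by move=> x v p /mem_ldel[i [_ _ ->]].
- move=> x y v p /mem_lmul[_ ->] /=.
  case/orP=> [kx|/orP[ky|->]]; last by rewrite orbT.
    by rewrite (killed_divisor _ kx) //= mdiv_plusr.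
  by rewrite (killed_divisor _ ky) //= mplusC mdiv_plusr.
- by move=> x v v' h /= /orP[->|/h ->]; rewrite ?orbT.
by move=> w' /(_ kw); apply: fg.
Qed.

Variable j : mon n.
Local Notation barwords := (barwords gens j).
Local Notation wd := (@wd _ barwords).
Local Notation Nw := (size barwords).
Local Notation MD := (MD K gens j).
Local Notation MC := (mxo barwords cone).
Local Notation ub := (uniq_barwords gens j).

Lemma cone_operates : operates barwords cone.
Proof.
split=> [*|]; first exact: cone_sum.
by apply: bar_local => w f g vw fg; apply: cone_local => w' [/(_ vw) v d _ _ _]; apply: fg.
Qed.

Lemma MC_supp i k : MC i k != 0 -> hgt (wd k) = (hgt (wd i)).+1 /\ has killed (wd k).
Proof.
move=> ne; pose Q w w' := (hgt w' == (hgt w).+1) && has killed w'.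
suff /andP[/eqP-> ->] : Q (wd i) (wd k) by [].
apply: (mxo_supp ne) => f f0.
rewrite (cone_local (g := fun=> 0)) => [|w' [_ _ sz c k']].
  by rewrite -[RHS](mul0r (cone (fun=> 0) (wd i))) -coneZ; apply: eq_cone => w; rewrite mul0r.
by apply: f0; rewrite /Q k' /hgt sz c addSn eqxx.
Qed.

Lemma MD_killed i k : MD i k != 0 -> has killed (wd i) -> has killed (wd k).
Proof.
move=> ne ki; pose Q (w w' : seq X) := has killed w'; suff : Q (wd i) (wd k) by [].
apply: (mxo_supp ne) => f f0.
by rewrite (Dall_killed (g := fun=> 0)) ?[LHS]bard0.
Qed.

Definition killed_slice h : pred 'I_Nw := fun i => has killed (wd i) && (hgt (wd i) == h).
Definition pure i := ~~ has killed (wd i).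
Definition pure_slice h : pred 'I_Nw := fun i => pure i && (hgt (wd i) == h).

Lemma size_le_mdeg i : (size (wd i) <= mdeg j)%N.
Proof.
have := leq_trans (size_wgt gens2 (wdv i)) (wgt_mdeg gens (wd i)).
by rewrite wdj.
Qed.

(** Products shorten the word while deletions and [cone] do not, so the exact homotopy for deletions
    is triangular for the full differential, ordered by length. *)
Lemma killed_acyclic h (z : 'rV[K]_Nw) : (z <= sel K (killed_slice h))%MS -> z *m MD = 0 ->
  (z <= sel K (killed_slice h.+1) *m MD)%MS.
Proof.
have UE : MC *m MD + MD *m MC = mxo barwords (fun f w => cone (Dall f) w + Dall (cone f) w).
  rewrite /MD -(@mxo_comp K _ _ ub cone Dall cone_operates).
  rewrite -(@mxo_comp K _ _ ub Dall cone (Dall_operates K gens2 j)).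
  by apply/matrixP => i k; rewrite !mxE.
apply: (cycle_boundary (S := MC) (phi := fun i => (mdeg j - size (wd i))%N)) (MD_sq K gens2 j) _ _ _ _.
- by move=> i k /andP[_ /eqP hi] /MC_supp[e kk]; rewrite /killed_slice kk e hi eqxx.
- move=> i k /andP[ki /eqP hi] ne.
  have : (MC *m MD) i k != 0 \/ (MD *m MC) i k != 0.
    by apply/orP; apply: contraNT ne; rewrite negb_or !negbK => /andP[/eqP a /eqP b]; rewrite mxE a b addr0.
  case=> /mulmx_neq0[l []].
    move=> /MC_supp[e kl] /[dup] /MD_killed /(_ kl) kk /(MD_supp gens2)[e' _].
    by rewrite /killed_slice kk -eqSS -e' e hi eqxx.
  move=> /(MD_supp gens2)[e' _] /MC_supp[e kl].
  by rewrite /killed_slice kl e -e' hi eqxx.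
move=> i k /andP[ki /eqP hi] le; rewrite UE mxE.
have lt : (size (wd i) <= size (wd k))%N.
  by move: le; rewrite leq_sub2lE // size_le_mdeg.
have small w' : (size w' < size (wd i))%N -> dirac K k w' = 0 :> K.
  by move=> lw; rewrite /dirac; case: eqP => // e; move: lw; rewrite e ltnNge lt.
rewrite (eq_cone (g := fun w => Ddel (dirac K k) w + Dmul (dirac K k) w)); last exact: Dall_del_mul.
rewrite coneD Dall_del_mul (cone_local (f := Dmul _) (g := fun=> 0)); last first.
  move=> w' [_ _ sz _ _]; rewrite (Dmul_local (g := fun=> 0)) => [|w2 l2]; first exact: bard0.
  by apply: small; rewrite -sz.
rewrite (Dmul_local (g := fun=> 0)); last first.
  move=> w' lw; rewrite (cone_local (g := fun=> 0)) => [|w2 [_ _ sz _ _]]; last by apply: small; rewrite sz.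
  by rewrite -[RHS](mul0r (cone (fun=> 0) w')) -coneZ; apply: eq_cone => w; rewrite mul0r.
rewrite [Dmul _ _]bard0 addr0.
have -> : cone (fun=> 0) (wd i) = 0.
  by rewrite -[RHS](mul0r (cone (fun=> 0) (wd i))) -coneZ; apply: eq_cone => w; rewrite mul0r.
by rewrite addr0 cone_del ?wdv // /dirac (inj_eq (wd_inj ub)).
Qed.

Lemma killed_rank h : (#|killed_slice h| =
  \rank (sel K (killed_slice h.+1) *m MD) + \rank (sel K (killed_slice h) *m MD))%N.
Proof.
(* With an empty quotient E, [graded_rank] says that the cycles of the killed subcomplex are its
   boundaries. *)
rewrite -(graded_rank (A := pred0) (E := pred0) (MD_sq K gens2 j)) => [||i k /andP[ki /eqP hi] ne|||z].
- suff /eqP -> : \rank (sel K (pred0 : pred 'I_Nw) *m MD *m sel K (pred0 : pred 'I_Nw)) == 0%N by rewrite add0n.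
  rewrite mxrank_eq0; apply/eqP/matrixP=> i k; by rewrite mul_selE mulr0 mxE.
- by move=> i; rewrite andbF.
- by rewrite /killed_slice (MD_killed ne ki) -eqSS -(MD_supp gens2 ne).1 hi eqxx.
- by [].
- by [].
- exact: killed_acyclic.
Qed.

(** Here [graded_rank] compares the whole complex, written as [ge_slice 0], with its quotient by the
    killed words. *)
Lemma pure_rank h :
  (\rank (sel K (pure_slice h.+1) *m MD *m sel K pure) + #|killed_slice h| =
   \rank (sel K (ge_slice 0 h.+1) *m MD) + \rank (sel K (killed_slice h) *m MD))%N.
Proof.
apply: graded_rank (MD_sq K gens2 j) _ _ _ _ _.
- by move=> i; rewrite /ge_slice /pure_slice andbC.
- move=> i k /andP[_ /eqP hi] /(MD_supp gens2)[e _].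
  have -> : killed_slice h k = ~~ pure k by rewrite /killed_slice /pure negbK -eqSS -e hi eqxx andbT.
  by case: (pure k).
- by move=> i k _; rewrite /pure !negbK => ki /MD_killed /(_ ki).
- by move=> k /andP[kk _]; rewrite /pure negbK.
- move=> z zF zM; apply: submx_trans (killed_acyclic zF zM) _.
  have -> : sel K (killed_slice h.+1) = sel K (killed_slice h.+1) *m sel K (ge_slice 0 h.+1).
    apply/matrixP=> i k; rewrite mul_selE /sel !mxE; case: (eqVneq i k) => [->|_]; last by rewrite mul0r.
    by rewrite mulr1n -natrM mulnb /killed_slice /ge_slice leq0n /=; case: (_ == _); rewrite ?andbT ?andbF.
  by rewrite -mulmxA submxMl.
Qed.

(** Dividing by an acyclic subcomplex keeps the Betti numbers. Degree 0 is separate because nothing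
    leaves it. *)
Lemma pure_betti h :
  (#|pure_slice h|)%:Z - (if h is h'.+1 then \rank (sel K (pure_slice h) *m MD *m sel K pure) else 0%N)%:Z
     - (\rank (sel K (pure_slice h.+1) *m MD *m sel K pure))%:Z =
  (#|ge_slice (gens := gens) (j := j) 0 h|)%:Z - (\rank (sel K (ge_slice 0 h) *m MD))%:Z
    - (\rank (sel K (ge_slice 0 h.+1) *m MD))%:Z.
Proof.
have cE : (#|ge_slice (gens := gens) (j := j) 0 h| = #|pure_slice h| + #|killed_slice h|)%N.
  rewrite -cardUI [X in (_ + X)%N]eq_card0 ?addn0.
    apply: eq_card => i; rewrite !inE /ge_slice /pure_slice /killed_slice /pure -andb_orl.
    by rewrite orNb.
  move=> i; rewrite [RHS]inE; apply/negP; rewrite inE => /andP[/andP[pi _] /andP[ki _]].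
  by rewrite /pure ki in pi.
have r0 (A : pred 'I_Nw) : (forall i, A i -> hgt (wd i) = 0%N) -> \rank (sel K A *m MD) = 0%N.
  move=> hA; apply/eqP; rewrite mxrank_eq0; apply/eqP/matrixP => i k.
  rewrite sel_mulE [RHS]mxE; have [/hA e|] := boolP (A i); last by rewrite mul0r.
  by case: (eqVneq (MD i k) 0) => [->|/(MD_supp gens2)[]]; rewrite ?mulr0 // e.
have := pure_rank h; have := killed_rank h; case: h cE => [|h] cE.
  have -> : \rank (sel K (ge_slice 0 0) *m MD) = 0%N by apply: r0 => i /andP[_ /eqP].
  have -> : \rank (sel K (killed_slice 0) *m MD) = 0%N by apply: r0 => i /andP[_ /eqP].
  lia.
have := pure_rank h; have := killed_rank h; lia.
Qed.

End Cone.

(** The boundaries coming from A' are cycles in A. This bound serves to rule out truncation in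
    [tor_dim]. *)
Lemma rank_complex (K : fieldType) N (M : 'M[K]_N) (A A' : pred 'I_N) : M *m M = 0 ->
  (forall i k, A' i -> M i k != 0 -> A k) ->
  (\rank (sel K A *m M) + \rank (sel K A' *m M) <= #|A|)%N.
Proof.
move=> MM MA; rewrite -(rank_sel K A) -(mxrank_mul_ker (sel K A) M) leq_add2l.
apply: mxrankS; rewrite sub_capmx; apply/andP; split; last first.
  by apply/sub_kermxP; rewrite -mulmxA MM mulmx0.
suff -> : sel K A' *m M = sel K A' *m M *m sel K A by rewrite submxMl.
apply/matrixP=> i k; rewrite mul_selE sel_mulE; have [Ai|] := boolP (A' i); rewrite ?mul0r // mul1r.
by case: (eqVneq (M i k) 0) => [->|/(MA _ _ Ai) ->]; rewrite ?mul0r ?mulr1.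
Qed.

(** * Identification of the quotient with the bar complex of R *)

Section BarResolution.
Variables (K : fieldType) (n N : nat) (gens : 'I_N -> mon n) (G : seq (mon n)).
Hypothesis gens2 : forall i, (2 <= mdeg (gens i))%N.
Hypothesis gensG : forall m, inI G m = [exists i, mdiv (gens i) m].
Local Notation X := (mon n * {set 'I_N})%type.
Local Notation lvalid := (lvalid gens).
Local Notation hgt := (@hgt n N).
Local Notation Dall := (@Dall K n N).
Local Notation sg := (@sg K N).
Implicit Types (m : mon n) (t : seq (mon n)) (f : seq X -> K).

Definition bare m : X := (m, set0).

(** A letter without generators has sign -1, so merging positions k and k + 1 carries (-1)^(k + 1),
    as in [bar_mx]. *)
Lemma Dall_bare f t : Dall f (map bare t) =
  \sum_(k < (size t).-1) (-1) ^+ k.+1 * f (map bare (bar_face k t)).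
Proof.
elim: t f => [|m t IHt] f; first by rewrite big_ord0.
have ld x : lin (ldel K (fun _ _ => true) (bare m)) x = 0.
  by rewrite lin_ldel big1 // => i; rewrite inE.
have pm : lpar K (bare m) = -1 by rewrite /lpar /par cards0 expr1.
case: t IHt => [|m' t] IHt.
  by rewrite big_ord0 /Dall /= ld oppr0 addr0 mulr0 addr0.
have -> : Dall f (map bare [:: m, m' & t]) = - (f (map bare (bar_face 0 [:: m, m' & t]))
    + Dall (fun w => f (bare m :: w)) (map bare (m' :: t))).
  rewrite {1}/Dall [bard _ _ _ _ _]/= ld oppr0 add0r pm mulN1r; congr (- (_ + _)).
  rewrite lin_lmul /ldisj -setI_eq0 setI0 eqxx /= /sg big_set0 mul1r /prodl /= setU0.
  by rewrite /bar_face /= drop0.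
rewrite IHt big_ord_recl /= expr1 mulN1r opprD; congr (_ + _).
rewrite -sumrN; apply: eq_bigr => k _; by rewrite [in RHS]exprS mulN1r mulNr.
Qed.

Variable j : mon n.
Local Notation barwords := (barwords gens j).
Local Notation wd := (@wd _ barwords).
Local Notation Nw := (size barwords).
Local Notation MD := (MD K gens j).
Local Notation pure_slice := (pure_slice (gens := gens) (j := j)).
Local Notation pure := (pure (gens := gens) (j := j)).

Definition standard m := (m != mzero n) && ~~ inI G m.

Lemma mem_bar_basis h t :
  (t \in bar_basis G h j) = [&& size t == h, all standard t & wdg id t == j].
Proof.
by rewrite bar_basisE (mem_wordlist (P := standard)) // => u m; rewrite mem_filter mem_mons_le.
Qed.

Lemma uniq_bar_basis h : uniq (bar_basis G h j).
Proof.
by rewrite bar_basisE uniq_wordlist // => u; rewrite filter_uniq ?uniq_mons_le.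
Qed.

Lemma bare_inj : injective bare. Proof. by move=> m m' []. Qed.

Lemma wdeg_bare t : wdeg (map bare t) = wdg id t.
Proof. by elim: t => //= m t ->. Qed.

Lemma standardE m : standard m = lvalid (bare m) && ~~ killed gens (bare m).
Proof. by rewrite killedE /standard gensG /lvalid mS0 /= mdiv0 andbT. Qed.

Lemma all_standard t : all standard t = all lvalid (map bare t) && ~~ has (killed gens) (map bare t).
Proof.
elim: t => //= m t ->; rewrite standardE negb_or.
by rewrite andbACA.
Qed.

Lemma hgt_bare t : hgt (map bare t) = size t.
Proof.
rewrite /hgt size_map; elim: t => //= m t IHt.
by rewrite wsum_cons /lcard cards0 add0n addnS IHt.
Qed.

Lemma bare_fst x : lvalid x -> ~~ killed gens x -> x = bare x.1.
Proof.
move=> vx; rewrite /killed; case e : (divisor gens x.1) => // _.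
by rewrite /bare -(divisor_none vx e) -surjective_pairing.
Qed.

Lemma bare_word w : all lvalid w -> ~~ has (killed gens) w -> w = map bare (map fst w).
Proof.
elim: w => //= x w IHw /andP[vx vw]; rewrite negb_or => /andP[kx kw].
by rewrite -IHw // -bare_fst.
Qed.

Lemma bar_index h : exists e : 'I_(size (bar_basis G h j)) -> 'I_Nw,
  [/\ forall k, wd (e k) = map bare (nth [::] (bar_basis G h j) k), injective e &
      forall i, pure_slice h i = (i \in codom e)].
Proof.
have ex (k : 'I_(size (bar_basis G h j))) : exists i, wd i = map bare (nth [::] (bar_basis G h j) k).
  have : nth [::] (bar_basis G h j) k \in bar_basis G h j by apply: mem_nth.
  rewrite mem_bar_basis all_standard => /and3P[_ /andP[v _] d].
  have /wdP[i ->] : map bare (nth [::] (bar_basis G h j) k) \in barwords by rewrite mem_barwords v wdeg_bare d.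
  by exists i.
have [e eE] := fin_all_exists ex; exists e; split=> //.
  move=> k k' ee; have := eE k; rewrite ee eE => /(inj_map bare_inj)/eqP.
  by rewrite nth_uniq ?uniq_bar_basis // => /eqP/val_inj.
move=> i; apply/andP/codomP => [[pi /eqP hi]|[k ->]]; last first.
  have : nth [::] (bar_basis G h j) k \in bar_basis G h j by apply: mem_nth.
  rewrite mem_bar_basis all_standard /pure eE hgt_bare => /and3P[/eqP -> /andP[_ ->] _].
  by rewrite eqxx.
rewrite /pure in pi; have wE := bare_word (wdv i) pi.
have : map fst (wd i) \in bar_basis G h j.
  by rewrite mem_bar_basis all_standard -wE wdv -wdeg_bare -wE wdj -hi -hgt_bare -wE !eqxx andbT pi.
move=> /(nthP [::])[k lk nk]; exists (Ordinal lk).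
by apply: (wd_inj (uniq_barwords gens j)); rewrite eE /= nk -wE.
Qed.

Lemma rank_bar_mx h : \rank (bar_mx K G h j) = \rank (sel K (pure_slice h.+1) *m MD *m sel K pure).
Proof.
have [e [eE eI ec]] := bar_index h.+1; have [g [gE gI gc]] := bar_index h.
have -> : sel K (pure_slice h.+1) *m MD *m sel K pure = sel K (pure_slice h.+1) *m MD *m sel K (pure_slice h).
  apply/matrixP=> i k; rewrite !mul_selE sel_mulE.
  have [/andP[_ /eqP hi]|_] := boolP (pure_slice h.+1 i); last by rewrite !mul0r.
  case: (eqVneq (MD i k) 0) => [->|/(MD_supp gens2)[e' _]]; first by rewrite mulr0 !mul0r.
  by rewrite /pure_slice -eqSS -e' hi eqxx andbT.
rewrite -(rank_sub_sel MD eI gI ec gc); congr (\rank _); apply/matrixP => a b; rewrite !mxE.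
rewrite eE Dall_bare; set s := nth _ _ a; set t := nth _ _ b.
have : s \in bar_basis G h.+1 j by apply: mem_nth.
rewrite mem_bar_basis => /and3P[/eqP ss _ _].
have : t \in bar_basis G h j by apply: mem_nth.
rewrite mem_bar_basis => /and3P[_ st _].
rewrite ss; apply: eq_bigr => k _; rewrite /dirac gE (inj_eq (inj_map bare_inj)) -/t -mulr_natr.
congr (_ * (nat_of_bool _)%:R); case: eqP => //= et.
(* The test in [bar_mx] that the product is outside I is automatic here: the product is a letter of
   t, whose letters are standard. *)
have : mplus (nth (mzero n) s k) (nth (mzero n) s k.+1) \in t.
  by rewrite -et /bar_face mem_cat inE eqxx orbT.
by move/(allP st) => /andP[].
Qed.

(** The point is that the natural-number subtractions in [tor_dim] are exact; the inequality is
    [rank_complex] for the Taylor bar complex, carried over by [pure_betti]. *)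
Lemma tor_dimE h : (tor_dim K G h j)%:Z =
  (#|pure_slice h|)%:Z - (if h is h'.+1 then \rank (sel K (pure_slice h) *m MD *m sel K pure) else 0%N)%:Z
     - (\rank (sel K (pure_slice h.+1) *m MD *m sel K pure))%:Z.
Proof.
have [e [eE eI ec]] := bar_index h.
have cE : size (bar_basis G h j) = #|pure_slice h|.
  by rewrite (eq_card ec) card_codom // card_ord.
have bE : bar_rank K G h j = if h is h'.+1 then \rank (sel K (pure_slice h) *m MD *m sel K pure) else 0%N.
  by case: (h) => // h'; rewrite /bar_rank rank_bar_mx.
have le : (bar_rank K G h j + bar_rank K G h.+1 j <= size (bar_basis G h j))%N.
  have bpos := pure_betti K gens2 j h.
  rewrite {2}/bar_rank rank_bar_mx bE cE.
  have : (\rank (sel K (ge_slice 0 h) *m MD) + \rank (sel K (ge_slice 0 h.+1) *m MD)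
    <= #|ge_slice (gens := gens) (j := j) 0 h|)%N.
    apply: rank_complex (MD_sq K gens2 j) _ => i k /andP[_ /eqP hi] /(MD_supp gens2)[e' _].
    by rewrite /ge_slice -eqSS -e' hi eqxx.
  move: bpos; move: (\rank _) (\rank _) (\rank _) (if h is _.+1 then _ else _) #|_| #|_|; lia.
rewrite -bE /tor_dim -cE -rank_bar_mx; rewrite /= in le *; lia.
Qed.

End BarResolution.

(** * Multigraded power series *)

Section Convolution.
Variables (n : nat) (R : comPzRingType).
Implicit Types (a b j : mon n) (F G H : mon n -> R).

(** Multiplication of power series in y given by their coefficient functions. *)
Definition conv F G j : R := \sum_(a <- mons_le j) F a * G (msub j a).

Definition conv1 j : R := (j == mzero n)%:R.

Lemma eq_conv F F' G G' j : F =1 F' -> G =1 G' -> conv F G j = conv F' G' j.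
Proof. by move=> eF eG; apply: eq_bigr => a _; rewrite eF eG. Qed.

Lemma mdiv_sub j a : mdiv (msub j a) j.
Proof. by apply/mdivP => v; rewrite msubE leq_subr. Qed.

Lemma msubK j a : mdiv a j -> msub j (msub j a) = a.
Proof. by move=> /mdivP h; apply/ffunP => v; rewrite !msubE subKn. Qed.

Lemma convC F G j : conv F G j = conv G F j.
Proof.
rewrite /conv [RHS](perm_big [seq msub j a | a <- mons_le j]) /=.
  rewrite big_map; apply: eq_big_seq => a; rewrite mem_mons_le => /msubK ->.
  by rewrite mulrC.
apply: uniq_perm; rewrite ?uniq_mons_le //.
  rewrite map_inj_in_uniq ?uniq_mons_le // => a b; rewrite !mem_mons_le => ha hb e.
  by rewrite -(msubK ha) e msubK.
move=> a; rewrite mem_mons_le; apply/idP/mapP => [ha|[b _ ->]]; last exact: mdiv_sub.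
by exists (msub j a); rewrite ?mem_mons_le ?mdiv_sub ?msubK.
Qed.

Lemma sum_shift a j (f : mon n -> R) : mdiv a j ->
  \sum_(b <- mons_le (msub j a)) f b = \sum_(c <- mons_le j | mdiv a c) f (msub c a).
Proof.
move=> aj; rewrite -[RHS]big_filter [RHS](perm_big [seq mplus a b | b <- mons_le (msub j a)]) /=.
  by rewrite big_map; apply: eq_bigr => b _; rewrite msub_plus.
apply: uniq_perm; first exact/filter_uniq/uniq_mons_le.
  by rewrite map_inj_uniq ?uniq_mons_le // => b c e; rewrite -(msub_plus a b) e msub_plus.
move=> c; rewrite mem_filter mem_mons_le; apply/andP/mapP => [[ac cj]|[b]]; last first.
  rewrite mem_mons_le => /mdivP h ->; rewrite mdiv_plusr; split=> //; apply/mdivP => v.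
  by have := h v; move/mdivP: aj => /(_ v); rewrite mplusE msubE; lia.
exists (msub c a); last by rewrite mplus_sub.
by rewrite mem_mons_le; apply/mdivP => v; move/mdivP: cj => /(_ v); rewrite !msubE; lia.
Qed.

Lemma sum_below c j (f : mon n -> R) : mdiv c j ->
  \sum_(a <- mons_le c) f a = \sum_(a <- mons_le j | mdiv a c) f a.
Proof.
move=> cj; rewrite -[RHS]big_filter; apply: perm_big; apply: uniq_perm; [exact: uniq_mons_le | exact/filter_uniq/uniq_mons_le |].
move=> a; rewrite [RHS]mem_filter !mem_mons_le; case: (boolP (mdiv a c)) => //= ac.
by rewrite (mdiv_trans ac cj).
Qed.

Lemma convA F G H j : conv F (conv G H) j = conv (conv F G) H j.
Proof.
pose f a c := F a * G (msub c a) * H (msub j c).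
transitivity (\sum_(a <- mons_le j) \sum_(c <- mons_le j) if mdiv a c then f a c else 0).
  apply: eq_big_seq => a; rewrite mem_mons_le => aj; rewrite /conv sum_shift // mulr_sumr big_mkcond.
  apply: eq_bigr => c _; case: ifP => // ac; rewrite /f mulrA; congr (_ * H _).
  by apply/ffunP => v; move/mdivP: ac => /(_ v); rewrite !msubE; lia.
rewrite exchange_big; apply: eq_big_seq => c; rewrite mem_mons_le => cj.
by rewrite /conv (sum_below _ cj) mulr_suml [RHS]big_mkcond.
Qed.

Lemma conv1l F j : conv conv1 F j = F j.
Proof.
have j0 : mzero n \in mons_le j by rewrite mem_mons_le mdiv0.
rewrite /conv (bigD1_seq _ j0) ?uniq_mons_le //= /conv1 eqxx mul1r big1 => [|a /negPf ->]; last by rewrite mul0r.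
by rewrite addr0; congr F; apply/ffunP=> v; rewrite msubE ffunE subn0.
Qed.

End Convolution.

(** * The series Q *)

Section SquarefreeSeries.
Variable n : nat.
Implicit Types (a b j : mon n).

Definition sqfree a := [forall k, a k <= 1]%N.
(** The coefficient of y^a in the product of the 1 + t y_k, as a polynomial in t; [Lam_inv] gives
    the inverse series. *)
Definition Lam a : {poly int} := (sqfree a)%:R * 'X^(mdeg a).
Definition Lam_inv a : {poly int} := (- 'X) ^+ mdeg a.

Lemma ecoefE i j : (Lam j)`_i = ecoef i j.
Proof.
rewrite /Lam /ecoef -/(sqfree j); case: (sqfree j); rewrite ?mul0r ?coef0 //= mul1r coefXn eq_sym.
by case: eqP.
Qed.

Definition flip v a : mon n := [ffun k => if k == v then (1 - a k)%N else a k].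

Lemma flipK v a : sqfree a -> flip v (flip v a) = a.
Proof.
move=> /forallP h; apply/ffunP => k; rewrite !ffunE; case: eqP => // _.
by have := h k; case: (a k) => [|[]].
Qed.

Lemma mdeg_flip v a : sqfree a -> odd (mdeg (flip v a)) = ~~ odd (mdeg a).
Proof.
move=> /forallP h; rewrite /mdeg (bigD1 v) //= [in RHS](bigD1 v) //= ffunE eqxx.
rewrite (eq_bigr (fun k => a k)) => [|k /negPf nk]; last by rewrite ffunE nk.
by rewrite !oddD; have := h v; case: (a v) => [|[]] //=; case: (odd _).
Qed.

(** If v occurs in j, flipping the exponent at v is a sign-reversing involution of the squarefree
    divisors of j, so the sum equals its negative. *)
Lemma Lam_invP j : conv Lam Lam_inv j = conv1 {poly int} j.
Proof.
rewrite /conv /conv1; case: (eqVneq j (mzero n)) => [->|j0].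
  rewrite (perm_big [:: mzero n]) ?big_seq1 /=; last first.
    apply: uniq_perm => // [|a]; first exact: uniq_mons_le.
    rewrite mem_mons_le inE; apply/idP/eqP => [h|->]; last exact: mdivv.
    by apply/eqP; rewrite -mdeg_eq0 -leqn0; apply: leq_trans (mdeg_le h) _; rewrite leqn0 mdeg_eq0.
  rewrite /Lam /Lam_inv mdeg_sub ?mdivv // subnn expr0 mulr1.
  have -> : mdeg (mzero n) = 0%N by apply/eqP; rewrite mdeg_eq0.
  by rewrite expr0 mulr1 /sqfree; case: forallP => // -[] k; rewrite ffunE.
have [v jv] : exists v, (0 < j v)%N.
  apply/existsP; apply: contraNT j0; rewrite negb_exists => /forallP h.
  by apply/eqP/ffunP => k; rewrite ffunE; have := h k; case: (j k).
pose g a : {poly int} := (-1) ^+ (mdeg a) * (- 'X) ^+ mdeg j.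
have -> : \sum_(a <- mons_le j) Lam a * Lam_inv (msub j a) = \sum_(a <- mons_le j | sqfree a) g a.
  rewrite [RHS]big_mkcond; apply: eq_big_seq => a; rewrite mem_mons_le => aj.
  rewrite /Lam; case: (sqfree a); rewrite ?mul0r //= mul1r /g /Lam_inv mdeg_sub //.
  rewrite -{2}(subnKC (mdeg_le aj)) exprD mulrA; congr (_ * _).
  by rewrite -exprMn mulN1r opprK.
rewrite -big_filter; set L := filter _ _.
have LE a : (a \in L) = sqfree a && mdiv a j by rewrite [LHS]mem_filter mem_mons_le.
have fL a : a \in L -> flip v a \in L.
  rewrite !LE => /andP[/forallP s1 /mdivP h]; apply/andP; split.
    by apply/forallP => k; rewrite ffunE; case: eqP => // _; rewrite leq_subr.
  apply/mdivP => k; rewrite ffunE; case: eqP => [->|_]; last exact: h.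
  exact: leq_trans (leq_subr _ _) jv.
have sL a : a \in L -> sqfree a by rewrite LE => /andP[].
have e : \sum_(a <- L) g a = - \sum_(a <- L) g a.
  rewrite [LHS](perm_big [seq flip v a | a <- L]) /=.
    rewrite big_map -sumrN; apply: eq_big_seq => a /sL sa.
    rewrite /g -signr_odd mdeg_flip // -[in RHS]signr_odd; case: (odd _); ring.
  apply: uniq_perm; first exact/filter_uniq/uniq_mons_le.
    rewrite map_inj_in_uniq; first exact/filter_uniq/uniq_mons_le.
    by move=> a b /sL sa /sL sb e; rewrite -(flipK v sa) e flipK.
  move=> a; apply/idP/mapP => [aL|[b bL ->]]; last exact: fL.
  by exists (flip v a); [exact: fL | rewrite flipK ?sL].
apply/polyP => i; have := congr1 (fun p : {poly int} => p`_i) e.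
rewrite coefN coef0; move: (_`_i) => x; lia.
Qed.

End SquarefreeSeries.

(** * Q as a sum over a homology basis *)

Section QCoefficients.
Variables (K : fieldType) (n N : nat) (gens : 'I_N -> mon n) (G : seq (mon n)).
Hypothesis gens2 : forall i, (2 <= mdeg (gens i))%N.
Hypothesis gensG : forall m, inI G m = [exists i, mdiv (gens i) m].
Local Notation X := (mon n * {set 'I_N})%type.
Local Notation NS := #|{: {set 'I_N}}|.
Local Notation mS := (mS gens).
Local Notation rk := (rk gens).
Local Notation lvalid := (lvalid gens).
Local Notation wgt := (wgt gens).
Local Notation hgt := (@hgt n N).
Local Notation lcard := (@lcard n N).
Variables (H : {set 'I_NS}) (inc pr s : 'M[K]_NS).
Local Notation selH := (sel K (fun i => i \in H)).
Local Notation homog := (homog (kappa gens) (@lsize N)).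
Local Notation tight_mx := (tight_mx K gens).
Hypotheses (ip : inc *m pr = selH) (id0 : inc *m tight_mx = 0) (dp0 : tight_mx *m pr = 0)
  (one : pr *m inc + tight_mx *m s + s *m tight_mx = 1%:M) (prH : pr *m selH = pr).
Hypotheses (hinc : homog 0 0 inc) (hpr : homog 0 0 pr) (hs : homog 1 0 s).
Implicit Types (x : X) (w : seq X) (S T : {set 'I_N}) (u j : mon n).

(** The contribution of a letter to P_R: its level wgt - 1 gives the sign, and the exponent is this
    level plus its homological degree |S| + 1. *)
Definition lwt x : {poly int} := (-1) ^+ (wgt x).-1 * 'X^(wgt x + lcard x).

Definition wwt w : {poly int} := \prod_(x <- w) lwt x.

Definition torgf j : {poly int} := \sum_(w <- barwords gens j | hword H w) wwt w.

Lemma wwtE w : all lvalid w -> wwt w = (-1) ^+ dlt gens w * 'X^(dlt gens w + hgt w).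
Proof.
move=> vw; have -> : (dlt gens w + hgt w = wsum wgt w + wsum lcard w)%N.
  by have := size_wgt gens2 vw; rewrite /dlt /hgt; lia.
elim: w vw => [|x w IHw] /= => [_|/andP[vx vw]]; first by rewrite /wwt big_nil mulr1.
rewrite /wwt big_cons -/(wwt w) IHw // /lwt.
have -> : dlt gens (x :: w) = ((wgt x).-1 + dlt gens w)%N.
  by have := size_wgt gens2 vw; have := wgt_ge1 gens2 vx; rewrite /dlt wsum_cons /=; lia.
by rewrite !wsum_cons mulrACA -!exprD addnACA.
Qed.

Lemma sign_polyC d : (-1) ^+ d = ((-1) ^+ d)%:P :> {poly int}.
Proof. by rewrite polyC_exp polyCN. Qed.

Lemma tor_torgf i j : (tor_dim K G i j)%:Z = (torgf j)`_i.
Proof.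
rewrite (tor_dimE K gens2 gensG) (pure_betti K gens2).
rewrite (betti_taylor gens2 ip id0 dp0 one prH hinc hpr hs) /torgf coef_sum.
rewrite [RHS]big_mkcond [LHS]big_mkcond; apply: eq_big_seq => w; rewrite mem_barwords => /andP[vw _].
case: (hword H w) => //=; rewrite wwtE // [in RHS]sign_polyC coefCM coefXn [i == _]eq_sym.
by case: (_ == i); rewrite ?mulr1 ?mulr0.
Qed.

Lemma tight_mx0 S : tight_mx (enum_rank S) (enum_rank set0) = 0.
Proof.
apply/eqP; apply: contraT => /(tight_mx_homog gens2).
rewrite /kappa /lsize !enum_rankK cards0 addn0 => -[[e _] c].
have S0 : S = set0 by apply: (mS_eq0 gens2); rewrite e mS0.
by move: c; rewrite S0 cards0.
Qed.

Lemma tight_0mx S : tight_mx (enum_rank set0) (enum_rank S) = 0.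
Proof.
apply/eqP; apply: contraT => /(tight_mx_homog gens2).
by rewrite /lsize !enum_rankK cards0 addn1 => -[_].
Qed.

(** Nothing is deleted from the empty set, and a tight deletion ending there would start from a set
    of lcm 1. So the empty set cannot cancel, and it supplies the constant term 1 of [lgf]. *)
Lemma empty_homology : enum_rank set0 \in H.
Proof.
have := congr1 (fun M : 'M_NS => M (enum_rank set0) (enum_rank set0)) one.
rewrite !mxE eqxx [X in _ + X + _]big1 => [|k _]; last by rewrite -[k]enum_valK tight_0mx mul0r.
rewrite [X in _ + X]big1 => [|k _]; last by rewrite -[k]enum_valK tight_mx0 mulr0.
rewrite !addr0 => e; apply: contraT => nH.
have : \sum_k pr (enum_rank set0) k * inc k (enum_rank set0) = 0.
  apply: big1 => k _; case: (eqVneq (inc k (enum_rank set0)) 0) => [->|/hinc[]]; first by rewrite mulr0.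
  rewrite /kappa enum_rankK => -[ek _] _.
  have k0 : enum_val k = set0 by apply: (mS_eq0 gens2); rewrite ek mS0.
  by rewrite -prH mul_selE -[k]enum_valK k0 (negPf nH) mulr0 mul0r.
by rewrite e => /eqP; rewrite oner_eq0.
Qed.

(** Splitting words after their first letter gives P = 1 + L P, with L the series of letters in
    H. *)
Lemma torgf_rec j : torgf j = conv1 {poly int} j +
  \sum_(x <- letters gens j | enum_rank x.2 \in H) lwt x * torgf (msub j x.1).
Proof.
have pe : perm_eq (barwords gens j) ((if j == mzero n then [:: [::]] else [::]) ++
    [seq x :: w | x <- letters gens j, w <- barwords gens (msub j x.1)]).
  apply: uniq_perm; first exact: uniq_barwords.
    rewrite cat_uniq; apply/and3P; split; first by case: ifP.
      apply/hasPn => w /allpairsPdep[x [v [_ _ ->]]]; by case: ifP.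
    apply: allpairs_uniq_dep => [|x _|]; [exact: uniq_letters | exact: uniq_barwords |].
    by move=> [x v] [y u] _ _ /= [-> ->].
  move=> w; rewrite mem_barwords mem_cat; case: w => [|x w].
    rewrite /= eq_sym; case: (eqVneq j (mzero n)) => [_|_]; first by rewrite inE.
    by apply/esym/allpairsPdep => -[x [v [_ _]]].
  rewrite (_ : (x :: w \in (if j == mzero n then [:: [::]] else [::])) = false); last by case: ifP.
  apply/idP/allpairsPdep => /=.
    move=> /andP[/andP[vx vw] /eqP <-]; exists x, w; rewrite mem_letters vx mdiv_plusr; split=> //.
    by rewrite mem_barwords vw msub_plus eqxx.
  move=> [y [v [yL vL [-> ->]]]]; move: yL vL; rewrite mem_letters mem_barwords.
  by move=> /andP[-> dy] /andP[-> /eqP ->]; rewrite mplus_sub //= eqxx.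
rewrite {1}/torgf (perm_big _ pe) big_cat; congr (_ + _) => /=.
  rewrite /conv1; case: (j == mzero n); last by rewrite big_nil.
  by rewrite big_cons big_nil /= addr0 /wwt big_nil.
rewrite big_flatten big_map [RHS]big_mkcond; apply: eq_bigr => x _; rewrite big_map.
case: ifP => hx; last by apply: big1 => w /=; rewrite hx.
rewrite /torgf mulr_sumr; apply: eq_big => [w|w _]; first by rewrite /= hx.
by rewrite /wwt big_cons.
Qed.

(** This is 1 - L, hence the inverse of P: for u nonconstant the sign exponent is one more than in
    [lwt]. *)
Definition lgf u : {poly int} :=
  \sum_(S | (enum_rank S \in H) && mdiv (mS S) u) (-1) ^+ (mdeg u - rk S) * 'X^(mdeg u - rk S + #|S|).

Lemma lgf0 : lgf (mzero n) = 1.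
Proof.
rewrite /lgf (bigD1 set0) /=; last by rewrite empty_homology mS0 mdiv0.
rewrite rk0 subn0 cards0 addn0.
have -> : mdeg (mzero n) = 0%N by apply/eqP; rewrite mdeg_eq0.
rewrite !expr0 mulr1 big1 ?addr0 // => S /andP[/andP[_ d] /eqP[]].
apply: (mS_eq0 gens2); apply/eqP; rewrite -mdeg_eq0 -leqn0.
by apply: leq_trans (mdeg_le d) _; rewrite leqn0 mdeg_eq0.
Qed.

Lemma lgf_torgf j : conv lgf torgf j = conv1 {poly int} j.
Proof.
have j0 : mzero n \in mons_le j by rewrite mem_mons_le mdiv0.
have s0 : msub j (mzero n) = j by apply/ffunP=> v; rewrite msubE ffunE subn0.
rewrite /conv (bigD1_seq _ j0) ?uniq_mons_le //= lgf0 mul1r s0 torgf_rec -addrA.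
rewrite -[RHS]addr0; congr (_ + _); rewrite /letters big_filter_cond big_flatten big_map /=.
rewrite [X in _ + X]big_mkcond -big_split big1_seq //= => u _.
rewrite big_map big_enum_cond /= /lgf; case: (eqVneq u (mzero n)) => [->|u0] /=.
  by rewrite addr0 big1 // => S; rewrite /lvalid eqxx.
have -> : \sum_(S | lvalid (u, S) && (enum_rank S \in H)) lwt (u, S) * torgf (msub j u) =
    (\sum_(S | (enum_rank S \in H) && mdiv (mS S) u) lwt (u, S)) * torgf (msub j u).
  rewrite mulr_suml; apply: eq_bigl => S.
  by rewrite /lvalid /= u0 andbC.
rewrite -mulrDl -big_split big1 ?mul0r // => S /andP[_ d].
have : (0 < mdeg u - rk S)%N by apply: (@wgt_ge1 _ _ gens gens2 (u, S)); rewrite /lvalid /= u0.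
rewrite /lwt /wgt /lcard /=; case: (_ - _)%N => // k _.
by rewrite /= [(-1) ^+ k.+1]exprS mulN1r mulNr addrN.
Qed.

Definition defect S := (mdeg (mS S) - rk S)%N.

Definition qgf u : {poly int} :=
  \sum_(S | (enum_rank S \in H) && (mS S == u)) (-1) ^+ defect S * 'X^(defect S + #|S|).

(** A pair (u, S) with m_S dividing u is S together with the monomial u / m_S; summing over these
    monomials produces the series [Lam_inv]. *)
Lemma lgf_qgf u : lgf u = conv qgf (@Lam_inv n) u.
Proof.
rewrite /lgf /conv /qgf; under [RHS]eq_bigr => a _ do rewrite mulr_suml.
rewrite (exchange_big_dep (fun S => enum_rank S \in H)) /=; last by move=> a S _ /andP[].
rewrite [RHS](bigID (fun S => mdiv (mS S) u)) /= [X in _ = _ + X]big1 ?addr0; last first.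
  move=> S /andP[_ nd]; rewrite big_seq_cond big1 // => a /andP[]; rewrite mem_mons_le => da /andP[_ /eqP e].
  by rewrite e da in nd.
apply: eq_bigr => S /andP[hS d].
have mu : mS S \in mons_le u by rewrite mem_mons_le.
rewrite big_mkcond (bigD1_seq _ mu) ?uniq_mons_le //= hS eqxx big1 ?addr0 => [|a /negPf na]; last first.
  by rewrite eq_sym na.
rewrite /Lam_inv mdeg_sub // /defect.
have le1 := rk_le gens2 S; have le2 := mdeg_le d.
have -> : (mdeg u - rk S = (mdeg (mS S) - rk S) + (mdeg u - mdeg (mS S)))%N by lia.
by rewrite [(- 'X) ^+ _]exprNn mulrACA -!exprD [in LHS]addnAC.
Qed.

Lemma torgf_qgf j : conv torgf qgf j = Lam j.
Proof.
transitivity (conv (conv (@Lam n) (@Lam_inv n)) (conv qgf torgf) j).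
  by rewrite convC -[LHS]conv1l; apply: eq_conv => // u; rewrite Lam_invP.
rewrite -convA; transitivity (conv (@Lam n) (conv1 {poly int}) j); last by rewrite convC conv1l.
apply: eq_conv => // u; rewrite convA -lgf_torgf; apply: eq_conv => // v.
by rewrite convC -lgf_qgf.
Qed.

Lemma size_Qcoefs i : size (Qcoefs K G i) = i.+1.
Proof. by elim: i => //= i IHi; rewrite size_rcons IHi. Qed.

Lemma nth_Qcoefs i k j : (k <= i)%N -> nth (fun _ => 0) (Qcoefs K G i) k j = Qcoef K G k j.
Proof.
elim: i => [|i IHi]; first by rewrite leqn0 => /eqP ->.
rewrite leq_eqVlt => /orP[/eqP -> //|lt].
by rewrite /= nth_rcons size_Qcoefs lt IHi.
Qed.

Lemma Qcoef_rec i j : Qcoef K G i j = ecoef i j -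
  \sum_(k < i) \sum_(a <- mons_le j) (tor_dim K G (i - k) a)%:Z * Qcoef K G k (msub j a).
Proof.
case: i => [|i]; first by rewrite big_ord0 subr0.
rewrite /Qcoef /= nth_rcons size_Qcoefs ltnn eqxx; congr (_ - _).
apply: eq_bigr => k _; apply: eq_bigr => a _; rewrite nth_Qcoefs //.
by rewrite -ltnS.
Qed.

Lemma tor_dim0 a : tor_dim K G 0 a = (a == mzero n).
Proof.
rewrite /tor_dim subn0 /bar_rank (_ : bar_mx K G 0 a = 0) ?mxrank0 ?subn0 /=; first by case: eqP.
by apply/matrixP => i k; rewrite !mxE big_ord0.
Qed.

(** Comparing coefficients of t^i in P Q = [Lam] gives the recursion of [Qcoefs], because the Tor in
    homological degree 0 is K in multidegree 1. *)
Lemma Qcoef_qgf i j : Qcoef K G i j = (qgf j)`_i.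
Proof.
elim/ltn_ind: i j => i IHi j; rewrite Qcoef_rec -ecoefE -torgf_qgf /conv coef_sum.
have j0 : mzero n \in mons_le j by rewrite mem_mons_le mdiv0.
have s0 : msub j (mzero n) = j by apply/ffunP=> v; rewrite msubE ffunE subn0.
apply/eqP; rewrite subr_eq; apply/eqP.
under eq_bigr => a _ do rewrite coefMr big_ord_recr /= subnn -tor_torgf tor_dim0.
rewrite big_split /= addrC; congr (_ + _).
  rewrite (bigD1_seq _ j0) ?uniq_mons_le //= eqxx mul1r s0 big1 ?addr0 // => a /negPf ->.
  by rewrite mul0r.
rewrite exchange_big; apply: eq_bigr => k _; apply: eq_bigr => a _.
by rewrite -tor_torgf IHi.
Qed.

Theorem Qcoef_homology i j : Qcoef K G i j =
  \sum_(S | [&& enum_rank S \in H, mS S == j & (defect S + #|S| == i)%N]) (-1) ^+ defect S.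
Proof.
rewrite Qcoef_qgf coef_sum; under [RHS]eq_bigl => S do rewrite andbA.
rewrite [RHS]big_mkcondr; apply: eq_bigr => S _.
rewrite sign_polyC coefCM coefXn [i == _]eq_sym.
by case: (_ == i); rewrite ?mulr1 ?mulr0.
Qed.

End QCoefficients.

(** * Transfer along lambda *)

Section Defect.
Variables (n N : nat) (gens : 'I_N -> mon n).
Hypothesis gens2 : forall i, (2 <= mdeg (gens i))%N.
Implicit Types S T C : {set 'I_N}.
Local Notation mS := (mS gens).

Definition splits S C := [&& C \subset S, C != set0, C != S & mcoprime (mS C) (mS (S :\: C))].

Lemma defectU S T : mcoprime (mS S) (mS T) ->
  defect gens (S :|: T) = (defect gens S + defect gens T)%N.
Proof.
move=> c; rewrite /defect mS_plus // mdeg_plus rk_coprime //.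
by have := rk_le gens2 S; have := rk_le gens2 T; lia.
Qed.

Lemma defect_splits S C : splits S C -> defect gens S = (defect gens C + defect gens (S :\: C))%N.
Proof.
case/and4P => CS _ _ c; rewrite -defectU //; congr defect.
by rewrite -{1}(setIidPr CS) setID.
Qed.

Lemma defect_connected S : S != set0 -> (forall C, ~~ splits S C) -> defect gens S = 1%N.
Proof.
move=> /set0Pn[i iS] ns; have [v iv] := gens_neq0 gens2 i.
have Sv : (0 < mS S v)%N by apply: leq_trans (iv) _; have /mdivP := gens_le_mS gens iS.
have Cv := component_pos Sv; have /andP[CS cop] := component_closed Sv.
have con : component gens S v = S.
  apply/eqP; apply: contraT => ne; have := ns (component gens S v).
  rewrite /splits CS ne cop /= !andbT negbK => /eqP C0.
  by move: Cv; rewrite C0 mS0 ffunE.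
by rewrite /defect -(rk_connected gens2 Sv con) subSnn.
Qed.

(** Only equality of lcms and component counts remain on the right, and these are data that lambda
    preserves. *)
Lemma tightE S i : i \in S ->
  tight gens S i = (mS (S :\ i) == mS S) && (defect gens (S :\ i) == defect gens S).
Proof.
move=> iS; apply/idP/andP => [t|[/eqP e /eqP d]].
  by rewrite /defect (tight_mS gens2 iS t) (eqP t).
apply/eqP; have := rk_le gens2 S; have := rk_le gens2 (S :\ i).
by move: d; rewrite /defect e => d l l'; rewrite -(subKn l) d subKn.
Qed.

End Defect.

Section Transfer.
Variables (K : fieldType) (N n n' : nat) (gens : 'I_N -> mon n) (gens' : 'I_N -> mon n').
Hypothesis gens2 : forall i, (2 <= mdeg (gens i))%N.
Hypothesis gens2' : forall i, (2 <= mdeg (gens' i))%N.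
Hypothesis mS_iff : forall S T, (mS gens S == mS gens T) = (mS gens' S == mS gens' T).
Hypothesis coprime_iff : forall S T,
  mcoprime (mS gens S) (mS gens T) = mcoprime (mS gens' S) (mS gens' T).
Implicit Types S T C : {set 'I_N}.

(** The coprime pairs alone determine the count: S is split into coprime parts until the parts are
    connected, each of which counts 1. *)
Lemma defect_transfer S : defect gens S = defect gens' S.
Proof.
elim: {S}_.+1 {-2}S (ltnSn #|S|) => // m IHm S le.
have sE C : splits gens S C = splits gens' S C by rewrite /splits coprime_iff.
case: (pickP (splits gens S)) => [C sC|ns].
  rewrite (defect_splits gens2 sC) (defect_splits gens2' (C := C)) -?sE //.
  case/and4P: sC => CS C0 CnS _; rewrite !IHm //.
    apply: leq_trans (proper_card _) le; rewrite properEneq subsetDl andbT.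
    apply: contraNneq C0 => e; apply/eqP/setP => i; rewrite inE; apply/negP => iC.
    by have := subsetP CS i iC; rewrite -e inE iC.
  by apply: leq_trans (proper_card _) le; rewrite properEneq CnS.
have [->|S0] := eqVneq S set0; first by rewrite /defect !rk0 !mS0 !subn0 /mdeg !big1 // => i; rewrite ffunE.
by rewrite !defect_connected // => C; rewrite -?sE ns.
Qed.

Lemma tight_mx_transfer : tight_mx K gens = tight_mx K gens'.
Proof.
apply/matrixP => i k; rewrite !mxE !lin_ldel; apply: eq_bigl => l.
case: (boolP (l \in _)) => //= li.
by rewrite !tightE // mS_iff !defect_transfer.
Qed.

(** Once the lcms agree, the rank is recovered as the degree of the lcm minus the defect. *)
Lemma homog_transfer a b (M : 'M[K]_#|{: {set 'I_N}}|) :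
  homog (kappa gens) (@lsize N) a b M -> homog (kappa gens') (@lsize N) a b M.
Proof.
move=> h x y /h[[/eqP e1 e2] ->]; split=> //; rewrite /kappa.
have e' : mS gens' (enum_val x) = mS gens' (enum_val y) by apply/eqP; rewrite -mS_iff.
move: (defect_transfer (enum_val x)) (defect_transfer (enum_val y)) (rk_le gens2' (enum_val x)) (rk_le gens2' (enum_val y)).
rewrite /defect (eqP e1) e2 e' => dx dy lx ly; congr (_, _).
by rewrite -(subKn lx) -dx dy subKn.
Qed.

(** A single elimination serves both ideals because their tight deletions form the same matrix; only
    homogeneity has to be read again for [gens']. *)
Lemma Qcoef_transfer (G : seq (mon n)) (G' : seq (mon n')) :
  (forall m, inI G m = [exists i, mdiv (gens i) m]) ->
  (forall m, inI G' m = [exists i, mdiv (gens' i) m]) ->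
  exists H : {set 'I_#|{: {set 'I_N}}|},
    (forall i j, Qcoef K G i j =
       \sum_(S | [&& enum_rank S \in H, mS gens S == j & (defect gens S + #|S| == i)%N])
         (-1) ^+ defect gens S) /\
    (forall i j, Qcoef K G' i j =
       \sum_(S | [&& enum_rank S \in H, mS gens' S == j & (defect gens' S + #|S| == i)%N])
         (-1) ^+ defect gens' S).
Proof.
move=> gensG gensG'.
have selT : sel K (fun i => i \in [set: 'I_#|{: {set 'I_N}}|]) = 1%:M.
  by apply/matrixP => i k; rewrite /sel !mxE inE.
have [||| H [inc [pr [s [[ip id0 dp0 one] [_ _ _ prH] [hinc hpr hs]]]]]] :=
    @elimination K _ _ (kappa gens) (@lsize _) setT (tight_mx K gens) (tight_mx_sq K gens).
- by rewrite selT mul1mx.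
- by rewrite selT mulmx1.
- exact: tight_mx_homog.
rewrite selT in one; exists H; split.
  by move=> i j; rewrite (Qcoef_homology gens2 gensG ip id0 dp0 one prH hinc hpr hs).
rewrite tight_mx_transfer in id0 dp0 one.
move=> i j; rewrite (Qcoef_homology gens2' gensG' ip id0 dp0 one prH) //; exact: homog_transfer.
Qed.

End Transfer.

(** * The lattice as the set of lcms of minimal generators *)

Section LcmLattice.
Variables (n : nat) (G : seq (mon n)).
Implicit Types (a b m : mon n).

Lemma mdiv_antisym a b : mdiv a b -> mdiv b a -> a = b.
Proof.
by move=> /mdivP h /mdivP h'; apply/ffunP => v; apply/eqP; rewrite eqn_leq h h'.
Qed.

Definition mingen (i : 'I_(size (mingens G))) : mon n := tnth (in_tuple (mingens G)) i.

Lemma mingen_mem i : mingen i \in G.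
Proof.
have : mingen i \in mingens G by apply: mem_tnth.
by rewrite mem_undup mem_filter => /andP[].
Qed.

(** Descent on the degree replaces a generator dividing m by a minimal one. *)
Lemma inI_mingen m : inI G m = [exists i, mdiv (mingen i) m].
Proof.
apply/hasP/existsP => [[g gG gm]|[i im]]; last by exists (mingen i); rewrite ?mingen_mem.
elim: {g}_.+1 {-2}g (ltnSn (mdeg g)) gG gm => // d IHd g le gG gm.
case: (boolP (has (fun h => mdiv h g && (h != g)) G)) => [/hasP[h hG /andP[hg ne]]|min].
  apply: (IHd h) => //; last exact: mdiv_trans gm.
  rewrite ltnS in le; apply: leq_trans le; rewrite ltn_neqAle mdeg_le // andbT; apply: contra ne => /eqP e.
  rewrite -(mplus_sub hg); have : mdeg (msub g h) == 0%N by rewrite mdeg_sub // e subnn.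
  by rewrite mdeg_eq0 => /eqP ->; rewrite mplusC mplus0.
have /tnthP[i e] : g \in in_tuple (mingens G) by rewrite /= mem_undup mem_filter min.
by exists i; rewrite /mingen -e.
Qed.

Lemma lcmE (l : seq (mon n)) v : (\big[@mlcm n/mzero n]_(g <- l) g) v = \max_(g <- l) g v.
Proof.
elim: l => [|g l IHl]; first by rewrite !big_nil ffunE.
by rewrite !big_cons ffunE IHl.
Qed.

Lemma lcm_latticeP m : reflect (exists S, m = mS mingen S) (m \in lcm_lattice G).
Proof.
have lE (t : (size (mingens G)).-tuple bool) :
    \big[@mlcm n/mzero n]_(g <- mask t (mingens G)) g = mS mingen [set i | tnth t i].
  apply/ffunP => v; rewrite lcmE ffunE.
  rewrite (big_mask_tuple _ _ _ (in_tuple (mingens G)) predT (fun g : mon n => g v)).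
  by apply: eq_bigl => i; rewrite andbT [RHS]inE (tnth_nth false).
rewrite mem_undup; apply: (iffP imageP) => [[t _ ->]|[S ->]].
  by exists [set i | tnth t i]; rewrite lE.
exists [tuple i \in S | i < size (mingens G)] => //; rewrite lE; congr mS.
by apply/setP => i; rewrite inE tnth_mktuple.
Qed.

End LcmLattice.

Local Close Scope ring_scope.

Theorem theorem2p7 (K : fieldType) (n n' : nat)
  (G : seq (mon n)) (G' : seq (mon n')) (lam : mon n -> mon n') :
  all (fun g => 2 <= mdeg g) G ->
  all (fun g => 2 <= mdeg g) G' ->
  lattice_iso G G' lam ->
  gcd_graph_iso G lam ->
  (forall (i : nat) (j : mon n), 0 < i -> Qcoef K G i j != 0%R -> j \in lcm_lattice G) /\
  (forall (i : nat) (j' : mon n'), 0 < i ->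
     Qcoef K G' i j' = (\sum_(j <- lcm_lattice G | lam j == j') Qcoef K G i j)%R).
Proof.
move=> /allP G2 /allP G2' [lamL lam_inj lam_surj lam_div] lam_cop.
(* The images of the minimal generators of I serve as generators of I', indexed by the same set, so
   that both sides share their subsets S. It suffices that these images generate I' and have degree
   at least 2. *)
pose gens := @mingen n G; pose gens' i := lam (gens i).
have LmS S : mS gens S \in lcm_lattice G by apply/lcm_latticeP; exists S.
have LmS' S : mS (@mingen n' G') S \in lcm_lattice G' by apply/lcm_latticeP; exists S.
have gS p k (g : 'I_k -> mon p) i : g i = mS g [set i] by apply/ffunP => v; rewrite ffunE big_set1.
have Lg i : gens i \in lcm_lattice G by rewrite (gS _ _ gens).
have gens2 i : (2 <= mdeg (gens i)) by apply/G2/mingen_mem.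
have gens2_' i : (2 <= mdeg (@mingen n' G' i)) by apply/G2'/mingen_mem.
have joins S : mS gens' S \in lcm_lattice G'.
  have /fin_all_exists[T TE] i : exists T, gens' i = mS (@mingen n' G') T.
    by apply/lcm_latticeP/lamL.
  apply/lcm_latticeP; exists (\bigcup_(i in S) T i); apply: mdiv_antisym.
    by apply/mS_le => i iS; rewrite TE; apply: mS_sub; apply: bigcup_sup iS.
  apply/mS_le => k /bigcupP[i iS kT]; apply: mdiv_trans (gens_le_mS gens' iS).
  by rewrite TE gens_le_mS.
(* The lcm of the images lies in the lattice of I' by [joins], so it is the image of some a;
   comparing a with m_S on the side of I gives one divisibility. *)
have lamS S : lam (mS gens S) = mS gens' S.
  have [a aL ea] := lam_surj _ (joins S); apply: mdiv_antisym; last first.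
    by apply/mS_le => i iS; rewrite -lam_div // gens_le_mS.
  rewrite -ea -lam_div //; apply/mS_le => i iS; rewrite lam_div // ea.
  exact: (gens_le_mS gens').
have lam0 : lam (mzero n) = mzero n' by rewrite -(mS0 gens) lamS mS0.
have L0 : mzero n \in lcm_lattice G by rewrite -(mS0 gens).
(* By injectivity the image of a generator is not 1, so it is the lcm of a nonempty set of minimal
   generators of I'. *)
have below i : exists k, mdiv (@mingen n' G' k) (gens' i).
  have /lcm_latticeP[T eT] := lamL _ (Lg i).
  have [T0|/set0Pn[k kT]] := eqVneq T set0; last by exists k; rewrite [gens' i]eT gens_le_mS.
  have : gens i = mzero n by apply: lam_inj => //; rewrite eT T0 mS0 lam0.
  by move=> e; have := gens2 i; rewrite ltnNge e (_ : mdeg _ = 0) //; apply/eqP; rewrite mdeg_eq0.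
have gens2' i : (2 <= mdeg (gens' i)).
  by have [k /mdeg_le] := below i; apply: leq_trans.
have gensG' m : inI G' m = [exists i, mdiv (gens' i) m].
  rewrite inI_mingen; apply/existsP/existsP => [[k km]|[i im]]; last first.
    by have [k ki] := below i; exists k; apply: mdiv_trans im.
  have kL : @mingen n' G' k \in lcm_lattice G' by rewrite (gS _ _ (@mingen n' G')).
  have [a /[dup] aL /lcm_latticeP[S aS] ea] := lam_surj _ kL.
  have [S0|/set0Pn[i iS]] := eqVneq S set0.
    have := gens2_' k; rewrite ltnNge -ea aS S0 mS0 lam0 (_ : mdeg _ = 0) //.
    by apply/eqP; rewrite mdeg_eq0.
  exists i; apply: mdiv_trans km; rewrite -ea -lam_div // aS.
  exact: gens_le_mS.
have mS_iff S T : (mS gens S == mS gens T) = (mS gens' S == mS gens' T).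
  by rewrite -!lamS; apply/eqP/eqP => [->|/lam_inj ->].
have cop_iff S T : mcoprime (mS gens S) (mS gens T) = mcoprime (mS gens' S) (mS gens' T).
  by rewrite -!lamS lam_cop.
have dE := defect_transfer gens2 gens2' cop_iff.
have [H [QE QE']] := Qcoef_transfer K gens2 gens2' mS_iff cop_iff (@inI_mingen n G) gensG'.
split=> [i j _|i j' _].
  rewrite QE; apply: contraR => jL; rewrite big1 // => S /and3P[_ /eqP e _].
  by rewrite -e LmS in jL.
rewrite QE'; under [RHS]eq_bigr => j _ do rewrite QE.
(* Each S contributes to the single lattice element j = m_S, and this j satisfies [lam j = j']
   exactly when S contributes on the side of I'. *)
rewrite (exchange_big_dep (fun S => [&& enum_rank S \in H, mS gens' S == j' & (defect gens' S + #|S| == i)])) /=.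
  apply: eq_bigr => S /and3P[hS /eqP mj di].
  rewrite big_mkcond (bigD1_seq _ (LmS S)) ?undup_uniq //= lamS mj eqxx hS eqxx -dE in di *.
  by rewrite di big1 ?addr0 // => a /negPf na; rewrite [mS _ S == a]eq_sym na andbF.
move=> j S /eqP ej /and3P[-> /eqP e d]; rewrite -dE d -lamS e ej eqxx //.
Qed.
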